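(* Let $L=\{(x,y)\in\mathbb{R}^2:\sqrt{1-|x|}+\sqrt{1-|y|}\ge1\}$. Then for $\Re(s)>2$, $$Z_L(s)=\left(8-2^{2-s}\frac{\zeta_{\mathrm{SU}(3)}(s)}{\zeta(3s)}\right)\frac{1}{s(s-1)}.$$ In particular, $Z_L(s)$ admits a meromorphic continuation to every point where $\zeta_{\mathrm{SU}(3)}(s)$ does.
   Context: For a compact convex $K\subset\mathbb{R}^2$ with nonempty interior: $h_K(u)=\min_{x\in K}\langle u,x\rangle$, $\rho_K(x)=\min_{u}(\langle u,x\rangle-h_K(u))$ over nonzero integer vectors $u$ with coprime coordinates (on the interior, extended by $0$ to $\partial K$), and $Z_K(s)=\int_K\rho_K(x)^{s-2}dx$. Witten's $\mathrm{SU}(3)$ zeta function is $\zeta_{\mathrm{SU}(3)}(s)=2^s\sum_{p,q\ge1}(pq(p+q))^{-s}$, and $\zeta$ is the Riemann zeta function. *)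

(* Defs.v *)
From HB Require Import structures.
From mathcomp Require Import all_boot all_order all_algebra.
From mathcomp Require Import complex.
From mathcomp Require Import all_classical all_reals all_analysis.

Set Implicit Arguments.
Unset Strict Implicit.
Unset Printing Implicit Defensive.

Import Order.TTheory GRing.Theory Num.Theory.
Import numFieldNormedType.Exports.

Local Open Scope classical_set_scope.
Local Open Scope ring_scope.
Local Open Scope complex_scope.

(* R[i] with its modulus topology, as a normed module over itself. In
   particular derivable f z 1 below is complex differentiability at z. *)
HB.instance Definition _ (R : realType) := GRing.ComAlgebra.copy R[i] R[i]^o.
HB.instance Definition _ (R : realType) := Vector.copy R[i] R[i]^o.
HB.instance Definition _ (R : realType) := NormedModule.copy R[i] R[i]^o.

Section ConvexBody.
Context {R : realType}.
Implicit Types (K : set (R * R)) (u : int * int) (x : R * R) (s : R[i]).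

(* x^s = exp (s ln x) for x > 0, and 0^s = 0 as soon as Re s != 0. *)
Definition cpow (x : R) s : R[i] :=
  (x `^ complex.Re s)%:C *
  (cos (complex.Im s * ln x) +i* sin (complex.Im s * ln x)).

Definition pairing u x : R := u.1%:~R * x.1 + u.2%:~R * x.2.

(* The infimum is a minimum, since K is compact and nonempty. *)
Definition support_min K u : R := inf [set pairing u x | x in K].

(* coprimez 0 0 is false, so primitive vectors are nonzero. *)
Definition primitive u : bool := coprimez u.1 u.2.

(* For x interior to K the infimum is a minimum: if K contains the disc of
   radius r around x, then pairing u x - support_min K u >= r |u|, so that only
   finitely many u compete. *)
Definition rho K x : R :=
  if `[< K° x >]
  then inf [set pairing u x - support_min K u | u in [set u | primitive u]]
  else 0.

Definition Z K s : R[i] :=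
  (\int[(lebesgue_measure \x lebesgue_measure)%E]_(x in K)
      complex.Re (cpow (rho K x) (s - 2))) +i*
  (\int[(lebesgue_measure \x lebesgue_measure)%E]_(x in K)
      complex.Im (cpow (rho K x) (s - 2))).

End ConvexBody.

(* Num.sqrt vanishes on negative numbers, hence the explicit conditions
   under which the square roots are defined. *)
Definition L {R : realType} : set (R * R) :=
  [set x | [/\ `|x.1| <= 1, `|x.2| <= 1 &
               1 <= Num.sqrt (1 - `|x.1|) + Num.sqrt (1 - `|x.2|)]].

Section Zeta.
Context {R : realType}.
Implicit Types s : R[i].

(* Convergent for Re s > 1. *)
Definition zeta s : R[i] :=
  limn (fun n : nat => \sum_(1 <= k < n) cpow (k%:R : R) (- s)).

(* The double series converges absolutely for Re s > 2/3; it is summed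
   iteratively. *)
Definition zetaSU3 s : R[i] :=
  cpow 2 s *
  limn (fun m : nat => \sum_(1 <= p < m)
    limn (fun n : nat => \sum_(1 <= q < n)
      cpow ((p * q * (p + q))%:R : R) (- s))).

End Zeta.

Section Meromorphic.
Context {R : realType}.
Implicit Types (f : R[i] -> R[i]) (p : R[i]) (U V : set R[i]).

Definition holomorphic_at f p : Prop := \forall z \near p, derivable f z 1.

(* The value of f at p itself is irrelevant. *)
Definition meromorphic_at f p : Prop :=
  exists (n : nat) (g : R[i] -> R[i]), holomorphic_at g p /\
    \forall z \near p^', f z = g z / (z - p) ^+ n.

Definition meromorphic_on U f : Prop := forall p, U p -> meromorphic_at f p.

(* f, considered on V only, extends meromorphically to the domain U. *)
Definition meromorphic_continuation V f U : Prop :=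
  [/\ open U, connected U, V `<=` U &
      exists2 F : R[i] -> R[i],
        meromorphic_on U F & forall s, V s -> F s = f s].

End Meromorphic.

(* Main.v *)
(* Fold L onto the unit square by X = 1 - |x|, Y = 1 - |y|. For a = |u_1| and
   b = |u_2| the support function of L is - (a + b) + ab / (a + b), so that rho is
   the infimum over coprime (a, b) of the forms aX + bY - ab / (a + b); in the part
   of the square outside of L this infimum is not positive. If u and v are adjacent
   primitive vectors with coordinate sums p and q, the form of u + v is the sum of
   the forms of u and v minus 1 / (pq(p + q)). Hence the infimum is reached by
   descending the Stern-Brocot tree, each node cutting a corner of the region, and in
   the coordinates given by the forms of u and v, which are a shear away from those of
   the parent, the node with coordinate sums (p, q) removes from the integral of
   phi (min X Y) over the square exactly the integral of (d - t) phi(t) over [0, d],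
   d = 1 / (pq(p + q)). For phi(t) = t^(s-2) this is d^s / (s(s-1)). Every coprime
   pair (p, q) with p, q >= 1 occurs once, and the sum of (pq(p + q))^-s over these
   pairs is 2^-s zetaSU3(s) / zeta(3s).

   For the continuation, theta(s) = 2^-s - 3^-s + ... satisfies
   2 theta(s) = 1 - sum_(k >= 1) (s)_k / k! theta(s + k), which extends it to an
   entire function, and zeta(s) = (1 - theta(s)) / (1 - 2^(1-s)). *)

Require Import Defs.
From HB Require Import structures.
From mathcomp Require Import all_boot all_order all_algebra.
From mathcomp Require Import complex.
From mathcomp Require Import all_classical all_reals all_analysis.
From mathcomp Require Import measurable_realfun finmap lra ring zify.
Import Order.TTheory GRing.Theory Num.Theory.
Import numFieldNormedType.Exports.
Local Open Scope classical_set_scope.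
Local Open Scope ring_scope.
Local Open Scope complex_scope.
Import Normc.
Set Implicit Arguments.
Unset Strict Implicit.
Unset Printing Implicit Defensive.

(** * Unordered sums *)

(** The geometry is carried out for a real continuous [phi] that vanishes on t <= 0, so that
    negative values of the forms, which occur outside of L, do no harm; phi(t) = Re (c t^(s-2)) with
    c = 1 and c = -i then gives the two components of [Z]. At each finite depth the tree yields an
    exact identity, and only afterwards does the depth tend to infinity, by dominated convergence
    for the integrals and absolute summability for the sum over pairs. Exactness at finite depth is
    the delicate point: the loss of [phi] at a minimum over two subtrees must be the sum of two
    losses. A subtree acts only on a rectangle with sides given by [reach], and reach p (p + q) +
    reach q (p + q) = cut p q keeps the two children from acting at the same point. For the
    continuation, holomorphy is carried by power series with weighted bounds on their coefficients.
    The functional equation of theta, iterated on coefficients, gives series of any prescribed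
    radius that equal theta on a small disc; uniqueness of coefficients makes them one entire
    series. As 1 - theta is nonzero at one point, its inverse is meromorphic everywhere, hence so is
    1 / zeta(3s). *)

Section NonnegativeSums.
Context {R : realType}.

(** [fine] sends [+oo] to 0, so this is the true sum only under [nsummable]. *)
Definition nsum (T : choiceType) (D : set T) (g : T -> R) : R :=
  fine (\esum_(t in D) (g t)%:E).

Definition nsummable (T : choiceType) (D : set T) (g : T -> R) : Prop :=
  (\esum_(t in D) (g t)%:E < +oo)%E.

Lemma nsumE (T : choiceType) (D : set T) (g : T -> R) :
  (forall t, D t -> 0 <= g t) -> nsummable D g ->
  (nsum D g)%:E = (\esum_(t in D) (g t)%:E)%E.
Proof.
move=> g0 sg; rewrite /nsum fineK// ge0_fin_numE//.
by apply: esum_ge0 => t Dt; rewrite lee_fin g0.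
Qed.

Lemma nsum_ge0 (T : choiceType) (D : set T) (g : T -> R) :
  (forall t, D t -> 0 <= g t) -> 0 <= nsum D g.
Proof. by move=> g0; apply: fine_ge0; apply: esum_ge0 => t Dt; rewrite lee_fin g0. Qed.

Lemma eq_nsum (T : choiceType) (D : set T) (g h : T -> R) :
  (forall t, D t -> g t = h t) -> nsum D g = nsum D h.
Proof. by move=> gh; congr fine; apply: eq_esum => t Dt; rewrite gh. Qed.

Lemma le_nsummable (T : choiceType) (D : set T) (g h : T -> R) :
  (forall t, D t -> g t <= h t) -> nsummable D h -> nsummable D g.
Proof.
by move=> gh; apply: le_lt_trans; apply: le_esum => t Dt; rewrite lee_fin gh.
Qed.

Lemma le_nsum (T : choiceType) (D : set T) (g h : T -> R) :
  (forall t, D t -> 0 <= g t) -> (forall t, D t -> g t <= h t) -> nsummable D h ->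
  nsum D g <= nsum D h.
Proof.
move=> g0 gh sh; rewrite -lee_fin !nsumE//.
- by apply: le_esum => t Dt; rewrite lee_fin gh.
- by move=> t Dt; exact: le_trans (g0 t Dt) (gh t Dt).
- exact: le_nsummable sh.
Qed.

Lemma nsummableD (T : choiceType) (D : set T) (g h : T -> R) :
  (forall t, D t -> 0 <= g t) -> (forall t, D t -> 0 <= h t) ->
  nsummable D g -> nsummable D h -> nsummable D (fun t => g t + h t).
Proof.
move=> g0 h0 sg sh; rewrite /nsummable.
under eq_esum do rewrite EFinD.
rewrite esumD//; first exact: lte_add_pinfty.
Qed.

Lemma nsumD (T : choiceType) (D : set T) (g h : T -> R) :
  (forall t, D t -> 0 <= g t) -> (forall t, D t -> 0 <= h t) ->
  nsummable D g -> nsummable D h ->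
  nsum D (fun t => g t + h t) = nsum D g + nsum D h.
Proof.
move=> g0 h0 sg sh; apply: EFin_inj; rewrite nsumE; last exact: nsummableD.
  rewrite EFinD !nsumE// -esumD//; apply: eq_esum => //.
by move=> t Dt; rewrite addr_ge0 ?g0 ?h0.
Qed.

(** An extended sum of nonnegative terms is a supremum over finite sets, so a uniform bound on
    duplicate-free lists gives finiteness and the bound at once. Most summability proofs below end
    here. *)
Lemma nsum_le (T : choiceType) (D : set T) (g : T -> R) (M : R) :
  (forall t, D t -> 0 <= g t) ->
  (forall s : seq T, uniq s -> (forall t, t \in s -> D t) -> \sum_(t <- s) g t <= M) ->
  nsummable D g /\ nsum D g <= M.
Proof.
move=> g0 H.
have le : (\esum_(t in D) (g t)%:E <= M%:E)%E.
  apply: ge_ereal_sup => x [A [finA AD] <-].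
  rewrite fsbig_finite//= sumEFin lee_fin; apply: H; first exact: fset_uniq.
  by move=> t; rewrite in_fset_set// => /set_mem/AD.
have s : nsummable D g by apply: le_lt_trans le (ltry _).
by split => //; rewrite -lee_fin nsumE.
Qed.

Lemma nsum_ge_seq (T : choiceType) (D : set T) (g : T -> R) (s : seq T) :
  (forall t, D t -> 0 <= g t) -> nsummable D g ->
  uniq s -> (forall t, t \in s -> D t) -> \sum_(t <- s) g t <= nsum D g.
Proof.
move=> g0 sg us sD; rewrite -lee_fin nsumE//; apply: esum_ge.
exists [set` s]; first by split => // t; exact: sD.
by rewrite -sumEFin fsbig_seq.
Qed.

Lemma ler_sum_subset (T : eqType) (g : T -> R) (r s : seq T) :
  (forall t, 0 <= g t) -> uniq r -> uniq s -> {subset r <= s} ->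
  \sum_(t <- r) g t <= \sum_(t <- s) g t.
Proof.
move=> g0 ur us rs; rewrite [leRHS](bigID (mem r)) /= -[X in _ <= X + _]big_filter.
have -> : \sum_(t <- [seq t <- s | t \in r]) g t = \sum_(t <- r) g t.
  apply: perm_big; apply: uniq_perm => //; first by rewrite filter_uniq.
  by move=> t; rewrite mem_filter; case: (boolP (t \in r)) => //= /rs ->.
by rewrite lerDl sumr_ge0.
Qed.

Lemma nsum_nat_le (g : nat -> R) (M : R) : (forall n, 0 <= g n) ->
  (forall n, \sum_(0 <= k < n) g k <= M) -> nsummable setT g /\ nsum setT g <= M.
Proof.
move=> g0 gM; apply: nsum_le => // r ur _.
apply: le_trans (gM (\max_(k <- r) k).+1); apply: ler_sum_subset => //.
  exact: iota_uniq.
by move=> k kr; rewrite mem_index_iota ltnS; exact: leq_bigmax_seq.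
Qed.

Lemma nsummableZ (T : choiceType) (D : set T) (g : T -> R) (c : R) :
  0 <= c -> (forall t, D t -> 0 <= g t) -> nsummable D g ->
  nsummable D (fun t => c * g t).
Proof.
move=> c0 g0 sg; apply: (nsum_le (M := c * nsum D g) _ _).1.
  by move=> t Dt; rewrite mulr_ge0 ?g0.
by move=> s us sD; rewrite -mulr_sumr ler_wpM2l//; exact: nsum_ge_seq.
Qed.

Lemma nsumZ (T : choiceType) (D : set T) (g : T -> R) (c : R) :
  0 <= c -> (forall t, D t -> 0 <= g t) -> nsummable D g ->
  nsum D (fun t => c * g t) = c * nsum D g.
Proof.
have le (c' : R) g' : 0 <= c' -> (forall t, D t -> 0 <= g' t) -> nsummable D g' ->
    nsum D (fun t => c' * g' t) <= c' * nsum D g'.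
  move=> c0 g0 sg; apply: (nsum_le _ _).2.
    by move=> t Dt; rewrite mulr_ge0 ?g0.
  by move=> s us sD; rewrite -mulr_sumr ler_wpM2l//; exact: nsum_ge_seq.
move=> c0 g0 sg; have [->|cn0] := eqVneq c 0.
  by rewrite mul0r /nsum esum1// => t Dt; rewrite mul0r.
have cp : 0 < c by rewrite lt_neqAle eq_sym cn0.
apply/eqP; rewrite eq_le le//= -ler_pdivlMl//.
apply: le_trans (le c^-1 (fun t => c * g t) _ _ _).
- by rewrite le_eqVlt; apply/orP; left; apply/eqP/eq_nsum => t _; rewrite mulKf.
- by rewrite invr_ge0.
- by move=> t Dt; rewrite mulr_ge0 ?g0.
- exact: nsummableZ.
Qed.

Lemma nsum_pair (I J : choiceType) (A : set I) (B : I -> set J) (g : I -> J -> R) :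
  (forall i j, A i -> B i j -> 0 <= g i j) ->
  nsummable (A `*`` B) (fun k => g k.1 k.2) ->
  [/\ forall i, A i -> nsummable (B i) (g i),
      nsummable A (fun i => nsum (B i) (g i)) &
      nsum (A `*`` B) (fun k => g k.1 k.2) = nsum A (fun i => nsum (B i) (g i))].
Proof.
move=> g0 sg.
have E : (\esum_(k in A `*`` B) (g k.1 k.2)%:E =
          \esum_(i in A) \esum_(j in B i) (g i j)%:E)%E.
  by rewrite esum_esum.
have S i : A i -> nsummable (B i) (g i).
  move=> Ai; move: sg; rewrite /nsummable E; apply: le_lt_trans.
  rewrite (esumID [set i])//; last first.
    by move=> k Ak; apply: esum_ge0 => j Bj; rewrite lee_fin g0.
  have -> : A `&` [set i] = [set i] by apply/seteqP; split => [k []//|k -> /=].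
  rewrite esum_set1; last by apply: esum_ge0 => j Bj; rewrite lee_fin g0.
  rewrite leeDl//; apply: esum_ge0 => k [Ak _].
  by apply: esum_ge0 => j Bj; rewrite lee_fin g0.
have E2 : (\esum_(i in A) \esum_(j in B i) (g i j)%:E =
    \esum_(i in A) (nsum (B i) (g i))%:E)%E.
  apply: eq_esum => i Ai; rewrite nsumE//; last exact: S.
  by move=> t; apply: g0.
split => //; first by rewrite /nsummable -E2 -E.
by rewrite /nsum E E2.
Qed.

Lemma nsummable_pair (I J : choiceType) (A : set I) (B : I -> set J) (g : I -> J -> R)
    (h : I -> R) :
  (forall i j, A i -> B i j -> 0 <= g i j) ->
  (forall i, A i -> nsummable (B i) (g i)) ->
  (forall i, A i -> nsum (B i) (g i) <= h i) ->
  nsummable A h ->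
  nsummable (A `*`` B) (fun k => g k.1 k.2).
Proof.
move=> g0 sB gh sh; rewrite /nsummable -(@esum_esum _ _ _ A B (fun i j => (g i j)%:E))//.
apply: le_lt_trans sh; apply: le_esum => i Ai.
by rewrite -nsumE ?lee_fin ?gh//; [move=> j Bj; exact: g0|exact: sB].
Qed.

Lemma nsum_bij (I J : choiceType) (A : set I) (B : set J) (e : I -> J) (g : J -> R) :
  set_bij A B e ->
  (nsummable B g <-> nsummable A (g \o e)) /\ nsum B g = nsum A (g \o e).
Proof.
move=> eb; rewrite /nsummable /nsum (@reindex_esum _ _ _ A B e)//.
Qed.

Lemma nsummableS (T : choiceType) (A B : set T) (g : T -> R) :
  (forall t, B t -> 0 <= g t) -> A `<=` B -> nsummable B g -> nsummable A g.
Proof.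
move=> g0 AB sB; apply: (nsum_le (M := nsum B g) _ _).1.
  by move=> t /AB/g0.
by move=> s us sA; apply: nsum_ge_seq => // t /sA/AB.
Qed.

End NonnegativeSums.

(** * Signed sums as differences of nonnegative sums *)

Section SignedSums.
Context {R : realType}.

Definition rsum (T : choiceType) (D : set T) (f : T -> R) : R :=
  nsum D (fun t => Num.max (f t) 0) - nsum D (fun t => Num.max (- f t) 0).

Definition rsummable (T : choiceType) (D : set T) (f : T -> R) : Prop :=
  nsummable D (fun t => `|f t|).

Lemma maxr_norm (x : R) : Num.max x 0 <= `|x|.
Proof. by rewrite ge_max ler_norm normr_ge0. Qed.

Lemma maxrN_norm (x : R) : Num.max (- x) 0 <= `|x|.
Proof. by rewrite -normrN maxr_norm. Qed.

Lemma maxrB (x : R) : Num.max x 0 - Num.max (- x) 0 = x.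
Proof.
have [x0|x0] := leP x 0.
  by rewrite (max_idPl _) ?oppr_ge0// sub0r opprK.
by rewrite (max_idPr _) ?oppr_le0 ?ltW// subr0.
Qed.

Lemma maxr_ge0 (x : R) : 0 <= Num.max x 0.
Proof. by rewrite le_max lexx orbT. Qed.

(** The value does not depend on the way [f] is split into summable nonnegative parts: the two
    differences are compared after moving the subtracted sums across, where [nsumD] applies.
    Linearity and Fubini for signed sums come from this. *)
Lemma rsum_sub (T : choiceType) (D : set T) (f g h : T -> R) :
  (forall t, D t -> 0 <= g t) -> (forall t, D t -> 0 <= h t) ->
  nsummable D g -> nsummable D h ->
  (forall t, D t -> f t = g t - h t) -> rsum D f = nsum D g - nsum D h.
Proof.
move=> g0 h0 sg sh fE.
have sgh : nsummable D (fun t => g t + h t) by exact: nsummableD.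
have ab t : D t -> `|f t| <= g t + h t.
  by move=> Dt; rewrite fE// (le_trans (ler_normB _ _))// !ger0_norm ?g0 ?h0.
have sp : nsummable D (fun t => Num.max (f t) 0).
  by apply: le_nsummable sgh => t Dt; exact: le_trans (maxr_norm _) (ab t Dt).
have sn : nsummable D (fun t => Num.max (- f t) 0).
  by apply: le_nsummable sgh => t Dt; exact: le_trans (maxrN_norm _) (ab t Dt).
apply/eqP; rewrite subr_eq addrAC eq_sym subr_eq -!nsumD//; try by move=> *; exact: maxr_ge0.
apply/eqP/eq_nsum => t Dt; apply/eqP; rewrite -subr_eq addrAC -subr_eq0.
by have /(congr1 (fun z => z - (g t - h t))) := maxrB (f t); rewrite fE//; lra.
Qed.

Lemma eq_rsum (T : choiceType) (D : set T) (f g : T -> R) :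
  (forall t, D t -> f t = g t) -> rsum D f = rsum D g.
Proof. by move=> fg; congr (_ - _); apply: eq_nsum => t Dt; rewrite fg. Qed.

Lemma rsummable_max (T : choiceType) (D : set T) (f : T -> R) : rsummable D f ->
  nsummable D (fun t => Num.max (f t) 0) /\ nsummable D (fun t => Num.max (- f t) 0).
Proof.
by split; [apply: le_nsummable H => t _; exact: maxr_norm
          |apply: le_nsummable H => t _; exact: maxrN_norm].
Qed.

Lemma rsumD (T : choiceType) (D : set T) (f g : T -> R) :
  rsummable D f -> rsummable D g -> rsum D (fun t => f t + g t) = rsum D f + rsum D g.
Proof.
move=> /rsummable_max[sf sf'] /rsummable_max[sg sg'].
rewrite (@rsum_sub _ _ _ (fun t => Num.max (f t) 0 + Num.max (g t) 0)
   (fun t => Num.max (- f t) 0 + Num.max (- g t) 0)).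
- by rewrite !nsumD// /rsum; [lra|..]; move=> *; exact: maxr_ge0.
- by move=> *; rewrite addr_ge0 ?maxr_ge0.
- by move=> *; rewrite addr_ge0 ?maxr_ge0.
- by apply: nsummableD => // *; exact: maxr_ge0.
- by apply: nsummableD => // *; exact: maxr_ge0.
- by move=> t _; have := maxrB (f t); have := maxrB (g t); lra.
Qed.

Lemma rsumN (T : choiceType) (D : set T) (f : T -> R) :
  rsum D (fun t => - f t) = - rsum D f.
Proof.
by rewrite /rsum opprB; congr (_ - _); apply: eq_nsum => t _; rewrite opprK.
Qed.

Lemma rsumZ (T : choiceType) (D : set T) (f : T -> R) (c : R) :
  rsummable D f -> rsum D (fun t => c * f t) = c * rsum D f.
Proof.
move=> sf; wlog c0 : c / 0 <= c => [H|].
  have [/H//|c0] := leP 0 c.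
  rewrite -[c]opprK mulNr -H ?oppr_ge0 ?ltW// -rsumN.
  by apply: eq_rsum => t _; rewrite mulNr.
have [sp sn] := rsummable_max sf.
rewrite (@rsum_sub _ _ _ (fun t => c * Num.max (f t) 0) (fun t => c * Num.max (- f t) 0)).
- by rewrite !nsumZ ?mulrBr//; move=> *; exact: maxr_ge0.
- by move=> *; rewrite mulr_ge0 ?maxr_ge0.
- by move=> *; rewrite mulr_ge0 ?maxr_ge0.
- by apply: nsummableZ => // *; exact: maxr_ge0.
- by apply: nsummableZ => // *; exact: maxr_ge0.
- by move=> t _; rewrite -mulrBr maxrB.
Qed.

Lemma rsum_pair (I J : choiceType) (A : set I) (B : I -> set J) (f : I -> J -> R) :
  rsummable (A `*`` B) (fun k => f k.1 k.2) ->
  rsum (A `*`` B) (fun k => f k.1 k.2) = rsum A (fun i => rsum (B i) (f i)).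
Proof.
move=> /rsummable_max[sp sn].
have [|_ sp1 sp2] := @nsum_pair _ _ _ A B (fun i j => Num.max (f i j) 0) _ sp; first by move=> *; exact: maxr_ge0.
have [|_ sn1 sn2] := @nsum_pair _ _ _ A B (fun i j => Num.max (- f i j) 0) _ sn; first by move=> *; exact: maxr_ge0.
rewrite [LHS]/rsum sp2 sn2; apply/esym/rsum_sub => //.
- by move=> i Ai; apply: nsum_ge0 => *; exact: maxr_ge0.
- by move=> i Ai; apply: nsum_ge0 => *; exact: maxr_ge0.
Qed.

Lemma rsum_bij (I J : choiceType) (A : set I) (B : set J) (e : I -> J) (f : J -> R) :
  set_bij A B e -> rsum B f = rsum A (f \o e).
Proof. by move=> eb; rewrite /rsum !(nsum_bij _ eb).2. Qed.

End SignedSums.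

Section ComplexModulus.
Context {R : realType}.
Implicit Types z w : R[i].

Lemma normc_ge0 z : 0 <= normc z.
Proof. by case: z => a b /=; rewrite sqrtr_ge0. Qed.

Lemma Re_le_normc z : `|complex.Re z| <= normc z.
Proof.
by case: z => a b /=; rewrite -sqrtr_sqr ler_wsqrtr// lerDl sqr_ge0.
Qed.

Lemma Im_le_normc z : `|complex.Im z| <= normc z.
Proof.
by case: z => a b /=; rewrite -sqrtr_sqr ler_wsqrtr// lerDr sqr_ge0.
Qed.

Lemma normc_le_ReIm z : normc z <= `|complex.Re z| + `|complex.Im z|.
Proof.
case: z => a b /=; rewrite -(ger0_norm (addr_ge0 (normr_ge0 a) (normr_ge0 b))) -sqrtr_sqr.
rewrite ler_wsqrtr// sqrrD !real_normK ?num_real// lerD2r lerDl.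
by rewrite mulrn_wge0// mulr_ge0.
Qed.

Lemma normcR (x : R) : normc x%:C = `|x|.
Proof. by rewrite /= expr0n/= addr0 sqrtr_sqr. Qed.

Lemma normc_gt0 z : (0 < normc z) = (z != 0).
Proof.
rewrite lt_neqAle normc_ge0 andbT eq_sym; apply/idP/idP; apply: contra => /eqP.
  by move=> ->; rewrite normc0.
by move/eq0_normc => ->.
Qed.

Lemma normcB z w : normc (z - w) = normc (w - z).
Proof. by rewrite -normcN opprB. Qed.

Lemma normcX z n : normc (z ^+ n) = normc z ^+ n.
Proof. by elim: n => [|n IH]; rewrite ?expr0 ?normc1// !exprS normcM IH. Qed.

Lemma normc_sum (I : Type) (s : seq I) (P : pred I) (f : I -> R[i]) :
  normc (\sum_(i <- s | P i) f i) <= \sum_(i <- s | P i) normc (f i).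
Proof.
apply: (big_ind2 (fun z x => normc z <= x)) => [|z1 x1 z2 x2 h1 h2|//].
  by rewrite normc0.
by rewrite (le_trans (le_normcD _ _))// lerD.
Qed.

Lemma ReD z w : complex.Re (z + w) = complex.Re z + complex.Re w.
Proof. by case: z; case: w. Qed.

Lemma ImD z w : complex.Im (z + w) = complex.Im z + complex.Im w.
Proof. by case: z; case: w. Qed.

Lemma ReM z w :
  complex.Re (z * w) = complex.Re z * complex.Re w - complex.Im z * complex.Im w.
Proof. by case: z; case: w. Qed.

Lemma ImM z w :
  complex.Im (z * w) = complex.Re z * complex.Im w + complex.Im z * complex.Re w.
Proof. by case: z => a b; case: w => c d /=; rewrite addrC. Qed.

Lemma ReN z : complex.Re (- z) = - complex.Re z.
Proof. by case: z. Qed.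

Lemma ImN z : complex.Im (- z) = - complex.Im z.
Proof. by case: z. Qed.

Lemma complex_eq z w :
  complex.Re z = complex.Re w -> complex.Im z = complex.Im w -> z = w.
Proof. by case: z => a b; case: w => c d /= -> ->. Qed.

End ComplexModulus.

(** * Absolutely convergent complex sums *)

Section ComplexSums.
Context {R : realType}.

Definition csum (T : choiceType) (D : set T) (f : T -> R[i]) : R[i] :=
  rsum D (fun t => complex.Re (f t)) +i* rsum D (fun t => complex.Im (f t)).

Definition csummable (T : choiceType) (D : set T) (f : T -> R[i]) : Prop :=
  nsummable D (fun t => normc (f t)).

Section Basic.
Variables (T : choiceType) (D : set T).
Implicit Types f g : T -> R[i].

Lemma csummable_Re f : csummable D f -> rsummable D (fun t => complex.Re (f t)).
Proof. by apply: le_nsummable => t _; exact: Re_le_normc. Qed.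

Lemma csummable_Im f : csummable D f -> rsummable D (fun t => complex.Im (f t)).
Proof. by apply: le_nsummable => t _; exact: Im_le_normc. Qed.

Lemma le_csummable f (h : T -> R) :
  (forall t, D t -> normc (f t) <= h t) -> nsummable D h -> csummable D f.
Proof. exact: le_nsummable. Qed.

Lemma eq_csum f g : (forall t, D t -> f t = g t) -> csum D f = csum D g.
Proof. by move=> fg; congr (_ +i* _); apply: eq_rsum => t Dt; rewrite fg. Qed.

Lemma eq_csummable f g :
  (forall t, D t -> f t = g t) -> csummable D f -> csummable D g.
Proof. by move=> fg; apply: le_nsummable => t Dt; rewrite fg. Qed.

Lemma csummableZ (c : R[i]) f : csummable D f -> csummable D (fun t => c * f t).
Proof.
move=> sf; apply: (le_csummable (h := fun t => normc c * normc (f t))).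
  by move=> t _; rewrite normcM.
by apply: nsummableZ => // *; exact: normc_ge0.
Qed.

Lemma csumD f g : csummable D f -> csummable D g ->
  csum D (fun t => f t + g t) = csum D f + csum D g.
Proof.
move=> sf sg; apply: complex_eq; rewrite ?ReD ?ImD /=.
- rewrite -rsumD; [|exact: csummable_Re|exact: csummable_Re].
  by apply: eq_rsum => t _; rewrite ReD.
- rewrite -rsumD; [|exact: csummable_Im|exact: csummable_Im].
  by apply: eq_rsum => t _; rewrite ImD.
Qed.

Lemma csumZ (c : R[i]) f : csummable D f -> csum D (fun t => c * f t) = c * csum D f.
Proof.
move=> sf; have sr := csummable_Re sf; have si := csummable_Im sf.
have sZ (x : R) (g : T -> R) : rsummable D g -> rsummable D (fun t => x * g t).
  move=> sg; apply: (le_nsummable (h := fun t => `|x| * `|g t|)).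
    by move=> t _; rewrite normrM.
  by apply: nsummableZ.
apply: complex_eq; rewrite ?ReM ?ImM /=.
- rewrite -!rsumZ// -rsumN -rsumD; last 2 first.
  + exact: sZ.
  + by under eq_fun do rewrite -mulNr; exact: sZ.
  by apply: eq_rsum => t _; rewrite ReM.
- rewrite -!rsumZ// -rsumD; last 2 first.
  + exact: sZ.
  + exact: sZ.
  by apply: eq_rsum => t _; rewrite ImM.
Qed.

Lemma csumZr (c : R[i]) f : csummable D f -> csum D (fun t => f t * c) = csum D f * c.
Proof. by move=> sf; rewrite mulrC -csumZ//; apply: eq_csum => t _; rewrite mulrC. Qed.

Lemma csumN f : csum D (fun t => - f t) = - csum D f.
Proof.
by apply: complex_eq; rewrite ?ReN ?ImN /= -rsumN; apply: eq_rsum => t _;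
  rewrite ?ReN ?ImN.
Qed.

Lemma csummableN f : csummable D f -> csummable D (fun t => - f t).
Proof. by apply: le_nsummable => t _; rewrite normcN. Qed.

Lemma csumB f g : csummable D f -> csummable D g ->
  csum D (fun t => f t - g t) = csum D f - csum D g.
Proof. by move=> sf sg; rewrite csumD ?csumN//; exact: csummableN. Qed.

Lemma csum0 f : (forall t, D t -> f t = 0) -> csum D f = 0.
Proof.
move=> f0; rewrite (eq_csum f0) /csum /= /rsum; apply/eqP.
by rewrite eq_complex /= oppr0 maxxx !subrr eqxx.
Qed.

(** With S the sum, |S|^2 is the real part of conj(S) S, that is, the sum of the real parts of
    conj(S) f(t), each of which is at most |S| |f(t)|; then divide by |S|. *)
Lemma normc_csum f : csummable D f -> normc (csum D f) <= nsum D (fun t => normc (f t)).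
Proof.
move=> sf; set S := csum D f.
have [->|S0] := eqVneq S 0.
  by rewrite normc0 nsum_ge0// => t _; exact: normc_ge0.
have nS : normc S^*%C = normc S by case: (S) => a b /=; rewrite sqrrN.
have sSf := csummableZ S^*%C sf.
rewrite -(ler_pM2l (x := normc S)) ?normc_gt0// -nsumZ//; last 2 first.
- exact: normc_ge0.
- by move=> *; exact: normc_ge0.
have -> : normc S * normc S = complex.Re (S^*%C * S).
  by case: (S) => a b /=; rewrite -expr2 sqr_sqrtr ?addr_ge0 ?sqr_ge0// !expr2; lra.
rewrite -csumZ// /csum /= /rsum.
have [s1 s2] := rsummable_max (csummable_Re sSf).
rewrite lerBlDr -[leLHS]addr0 lerD//; last first.
  by apply: nsum_ge0 => *; exact: maxr_ge0.
apply: le_nsum; first by move=> *; exact: maxr_ge0.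
- by move=> t _; rewrite (le_trans (maxr_norm _))// (le_trans (Re_le_normc _))// normcM nS.
- by apply: le_nsummable sSf => t _; rewrite normcM nS.
Qed.

End Basic.

Lemma csum_pair (I J : choiceType) (A : set I) (B : I -> set J) (f : I -> J -> R[i]) :
  csummable (A `*`` B) (fun k => f k.1 k.2) ->
  [/\ forall i, A i -> csummable (B i) (f i),
      csummable A (fun i => csum (B i) (f i)) &
      csum (A `*`` B) (fun k => f k.1 k.2) = csum A (fun i => csum (B i) (f i))].
Proof.
move=> sf; have [|s1 s2 _] := @nsum_pair _ _ _ A B (fun i j => normc (f i j)) _ sf.
  by move=> *; exact: normc_ge0.
split => //; first by apply: le_csummable s2 => i Ai; apply: normc_csum; exact: s1.
congr (_ +i* _).
  exact: (@rsum_pair _ _ _ A B (fun i j => complex.Re (f i j)) (csummable_Re sf)).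
exact: (@rsum_pair _ _ _ A B (fun i j => complex.Im (f i j)) (csummable_Im sf)).
Qed.

Lemma csummable_pair (I J : choiceType) (A : set I) (B : I -> set J)
    (f : I -> J -> R[i]) (h : I -> R) :
  (forall i, A i -> csummable (B i) (f i)) ->
  (forall i, A i -> nsum (B i) (fun j => normc (f i j)) <= h i) ->
  nsummable A h ->
  csummable (A `*`` B) (fun k => f k.1 k.2).
Proof.
move=> s1 s2 s3; apply: (@nsummable_pair _ _ _ A B (fun i j => normc (f i j)) h) => //.
by move=> *; exact: normc_ge0.
Qed.

Lemma csum_bij (I J : choiceType) (A : set I) (B : set J) (e : I -> J) (f : J -> R[i]) :
  set_bij A B e ->
  (csummable B f <-> csummable A (f \o e)) /\ csum B f = csum A (f \o e).
Proof.
move=> eb; split; first exact: (nsum_bij _ eb).1.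
by congr (_ +i* _); rewrite (rsum_bij _ eb).
Qed.

Lemma csum_exchange (I J : choiceType) (f : I -> J -> R[i]) :
  csummable setT (fun k : I * J => f k.1 k.2) ->
  csum setT (fun i => csum setT (f i)) = csum setT (fun j => csum setT (fun i => f i j)).
Proof.
move=> sf.
have eI : [set: I * J] = setT `*`` (fun=> setT) by apply/seteqP; split.
have eJ : [set: J * I] = setT `*`` (fun=> setT) by apply/seteqP; split.
have sb : set_bij [set: J * I] [set: I * J] (fun k => (k.2, k.1)).
  split => //; first by move=> [a b] [c d] _ _ /= [-> ->].
  by move=> [a b] _; exists (b, a).
have [s E] := csum_bij (fun k : I * J => f k.1 k.2) sb.
move: (sf); rewrite eI => /csum_pair[_ _ <-].
move: (sf); rewrite s eJ => /(@csum_pair _ _ _ _ (fun j i => f i j))[_ _ <-].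
by rewrite -eI -eJ E.
Qed.

Lemma csumID (T : choiceType) (A D : set T) (f : T -> R[i]) : csummable D f ->
  csum D f = csum (D `&` A) f + csum (D `&` ~` A) f.
Proof.
move=> sf.
have nID (g : T -> R) : (forall t, 0 <= g t) -> nsummable D g ->
    nsum D g = nsum (D `&` A) g + nsum (D `&` ~` A) g.
  move=> g0 sg; apply: EFin_inj; rewrite EFinD !nsumE//.
  - by rewrite (esumID A)// => t _; rewrite lee_fin.
  - by apply: nsummableS sg => // t [].
  - by apply: nsummableS sg => // t [].
have rID (g : T -> R) : rsummable D g ->
    rsum D g = rsum (D `&` A) g + rsum (D `&` ~` A) g.
  move=> /rsummable_max[s1 s2]; rewrite /rsum nID//; last by move=> *; exact: maxr_ge0.
  by rewrite [X in _ - X]nID; [lra|move=> *; exact: maxr_ge0|].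
apply: complex_eq; rewrite ?ReD ?ImD /=; apply: rID.
- exact: csummable_Re.
- exact: csummable_Im.
Qed.

Lemma csummableS (T : choiceType) (A B : set T) (f : T -> R[i]) :
  A `<=` B -> csummable B f -> csummable A f.
Proof. by apply: nsummableS => *; exact: normc_ge0. Qed.

Lemma csum_set1 (T : choiceType) (x : T) (f : T -> R[i]) : csum [set x] f = f x.
Proof.
have n1 (g : T -> R) : (forall t, 0 <= g t) -> nsum [set x] g = g x.
  by move=> g0; rewrite /nsum esum_set1//= lee_fin.
apply: complex_eq; rewrite /= /rsum !n1 ?maxrB//; move=> *; exact: maxr_ge0.
Qed.

Lemma csum_set0 (T : choiceType) (f : T -> R[i]) : csum set0 f = 0.
Proof. by apply: csum0. Qed.

Lemma csummable_seq (T : choiceType) (s : seq T) (f : T -> R[i]) : csummable [set` s] f.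
Proof.
apply: (nsum_le (M := \sum_(t <- undup s) normc (f t)) _ _).1.
  by move=> *; exact: normc_ge0.
move=> r ur rs; apply: ler_sum_subset => //; [|exact: undup_uniq|].
  by move=> *; exact: normc_ge0.
by move=> t /rs; rewrite mem_undup.
Qed.

Lemma csum_seqE (T : choiceType) (s : seq T) (f : T -> R[i]) : uniq s ->
  csum [set` s] f = \sum_(t <- s) f t.
Proof.
elim: s => [_|x s IH /= /andP[xs us]].
  by rewrite big_nil (_ : [set` [::]] = set0) ?csum_set0//; apply/seteqP; split.
rewrite (@csumID _ [set x] _ _ (csummable_seq _ _)) big_cons -IH//; congr (_ + _).
  rewrite (_ : _ `&` _ = [set x]) ?csum_set1//.
  by apply/seteqP; split => [t []//|t -> /=]; rewrite mem_head.
congr csum; apply/seteqP; split => t /=; rewrite in_cons.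
  by case=> /orP[/eqP ->//|].
by move=> ts; split; [rewrite ts orbT|move=> tx; rewrite -tx ts in xs].
Qed.

Lemma csum_split_seq (T : choiceType) (D : set T) (s : seq T) (f : T -> R[i]) :
  csummable D f -> uniq s -> [set` s] `<=` D ->
  csum D f = \sum_(t <- s) f t + csum (D `&` ~` [set` s]) f.
Proof.
by move=> sf us sD; rewrite (csumID [set` s] sf) setIC (setIidl sD) csum_seqE.
Qed.

Lemma nsum_approx (T : choiceType) (D : set T) (g : T -> R) (e : R) : 0 < e ->
  (forall t, D t -> 0 <= g t) -> nsummable D g ->
  exists s : seq T, [/\ uniq s, [set` s] `<=` D & nsum D g - e < \sum_(t <- s) g t].
Proof.
move=> e0 g0 sg; have := nsumE g0 sg; rewrite /esum => H.
have : ((nsum D g - e)%:E < ereal_sup [set (\sum_(x \in A) (g x)%:E)%E | A in fsets D])%E.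
  by rewrite -H lte_fin; lra.
move=> /ereal_sup_gt[x [A [finA AD] <-]].
rewrite fsbig_finite//= sumEFin lte_fin => lt.
exists (fset_set A); split => //.
by move=> t /=; rewrite in_fset_set// => /set_mem/AD.
Qed.

(** A finite list [s] carries all of the mass but [e]; once [s_ n] contains it, the terms outside of
    [s_ n] weigh less than [e]. This serves for ordinary partial sums and for the growing levels of
    the Stern-Brocot tree. *)
Lemma csum_cvg (T : choiceType) (D : set T) (f : T -> R[i]) (s_ : nat -> seq T) :
  csummable D f -> (forall n, uniq (s_ n)) -> (forall n, [set` s_ n] `<=` D) ->
  (forall t, D t -> exists N, forall n, (N <= n)%N -> t \in s_ n) ->
  forall e : R, 0 < e -> exists N, forall n, (N <= n)%N ->
    normc (\sum_(t <- s_ n) f t - csum D f) < e.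
Proof.
move=> sf us sD ev e e0.
have n0 t : D t -> 0 <= normc (f t) by move=> _; exact: normc_ge0.
have [s [uu ss lt]] := nsum_approx e0 n0 sf.
have [N HN] : exists N, forall n, (N <= n)%N -> {subset s <= s_ n}.
  elim: s {uu lt} ss => [|x s IH] ss; first by exists 0%N.
  have [|N HN] := IH; first by move=> t /= ts; apply: ss; rewrite /= in_cons ts orbT.
  have [|M HM] := ev x; first by apply: ss; rewrite /= mem_head.
  exists (maxn N M) => n; rewrite geq_max => /andP[/HN Nn /HM Mn] t.
  by rewrite in_cons => /orP[/eqP ->//|/Nn].
exists N => n /HN sub.
rewrite (csum_split_seq sf (us n) (sD n)) opprD addNKr normcN.
apply: le_lt_trans (normc_csum _) _; first by apply: csummableS sf => t [].
suff: nsum (D `&` ~` [set` s_ n]) (fun t => normc (f t)) + \sum_(t <- s) normc (f t)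
      <= nsum D (fun t => normc (f t)) by lra.
rewrite addrC -lerBrDl; apply: (nsum_le _ _).2; first by move=> *; exact: normc_ge0.
move=> r ur rD; rewrite lerBrDl -big_cat /=.
apply: nsum_ge_seq => //.
  rewrite cat_uniq uu ur andbT /=; apply/hasPn => t /rD[_ /= tn].
  by apply/negP => /sub.
by move=> t; rewrite mem_cat => /orP[/ss//|/rD[]].
Qed.

Lemma csum_cvg_nat (D : set nat) (f : nat -> R[i]) (a : nat) :
  csummable D f -> (forall k, D k <-> (a <= k)%N) ->
  forall e : R, 0 < e -> exists N, forall n, (N <= n)%N ->
    normc (\sum_(a <= k < n) f k - csum D f) < e.
Proof.
move=> sf Da; apply: (@csum_cvg _ _ _ (fun n => index_iota a n)) => //.
- by move=> n; exact: iota_uniq.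
- by move=> n t /=; rewrite mem_index_iota => /andP[/Da].
- by move=> t /Da at_; exists t.+1 => n tn; rewrite mem_index_iota at_.
Qed.

End ComplexSums.

Lemma cvg_normc {R : realType} (u : nat -> R[i]) (l : R[i]) :
  (forall e : R, 0 < e -> exists N, forall n, (N <= n)%N -> normc (u n - l) < e) ->
  u @ \oo --> l.
Proof.
move=> H; apply/cvgrPdist_lt => -[e i] /=.
rewrite ltcE /= => /andP[/eqP -> e0].
have [N HN] := H e e0.
exists N => // n /= Nn; rewrite distrC -[ `| _ |]/((normc _)%:C) ltcR; exact: HN.
Qed.

Lemma limn_normc {R : realType} (u : nat -> R[i]) (l : R[i]) :
  (forall e : R, 0 < e -> exists N, forall n, (N <= n)%N -> normc (u n - l) < e) ->
  limn u = l.
Proof. by move/cvg_normc; exact: cvg_lim. Qed.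

(** * Summation along antidiagonals and Cauchy products *)

Section CauchyProducts.
Context {R : realType}.

Definition upto (n : nat) : set nat := [set` iota 0 n.+1].

Lemma diag_bij :
  set_bij (setT `*`` upto) [set: nat * nat] (fun k => (k.2, (k.1 - k.2)%N)).
Proof.
have upE n i : upto n i <-> (i <= n)%N by rewrite /upto /mkset mem_iota add0n ltnS.
split => //.
  move=> [n i] [m j] /set_mem[_ /upE /= ni] /set_mem[_ /upE /= mj] [ij].
  by rewrite -ij in mj *; move=> h; congr (_, _); rewrite -(subnK ni) h subnK.
move=> [i j] _; exists ((i + j)%N, i); last by rewrite /= addKn.
by split => //=; apply/upE; rewrite leq_addr.
Qed.

Lemma csum_upto n (f : nat -> R[i]) : csum (upto n) f = \sum_(i < n.+1) f i.
Proof. by rewrite (csum_seqE f (iota_uniq 0 n.+1)) -(big_mkord xpredT f). Qed.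

Lemma nsum_upto n (f : nat -> R) : (forall i, 0 <= f i) ->
  nsum (upto n) f = \sum_(i < n.+1) f i.
Proof.
move=> f0; rewrite /nsum esum_fset//; first last.
- by move=> *; rewrite lee_fin.
- exact: finite_seq.
by rewrite -(fsbig_seq _ _ (iota_uniq 0 n.+1)) sumEFin -(big_mkord xpredT f).
Qed.

Lemma csum_diag (F : nat -> nat -> R[i]) :
  csummable setT (fun k : nat * nat => F k.1 k.2) ->
  [/\ csummable setT (fun n => \sum_(i < n.+1) F i (n - i)%N),
      nsummable setT (fun n => \sum_(i < n.+1) normc (F i (n - i)%N)) &
      csum setT (fun k : nat * nat => F k.1 k.2) =
      csum setT (fun n => \sum_(i < n.+1) F i (n - i)%N)].
Proof.
move=> sF; have [sFe E] := csum_bij (fun k : nat * nat => F k.1 k.2) diag_bij.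
have s2 := (sFe.1 sF).
have [t1 t2 t3] := @csum_pair R _ _ setT upto (fun n i => F i (n - i)%N) s2.
have [|u1 u2 _] := @nsum_pair R _ _ setT upto (fun n i => normc (F i (n - i)%N)) _ s2.
  by move=> *; exact: normc_ge0.
split.
- by apply: eq_csummable t2 => n _; rewrite csum_upto.
- by apply: le_nsummable u2 => n _; rewrite nsum_upto// => *; exact: normc_ge0.
- by rewrite E [LHS]t3; apply: eq_csum => n _; rewrite csum_upto.
Qed.

Lemma csummable_diag (F : nat -> nat -> R[i]) :
  nsummable setT (fun n => \sum_(i < n.+1) normc (F i (n - i)%N)) ->
  csummable setT (fun k : nat * nat => F k.1 k.2).
Proof.
move=> sF; apply: (csum_bij (fun k : nat * nat => F k.1 k.2) diag_bij).1.2.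
apply: (@csummable_pair _ _ _ setT upto (fun n i => F i (n - i)%N) _ _ _ sF).
- by move=> n _; exact: csummable_seq.
- by move=> n _; rewrite nsum_upto// => *; exact: normc_ge0.
Qed.

Lemma csum_prod (I J : choiceType) (f : I -> R[i]) (g : J -> R[i]) :
  csummable setT f -> csummable setT g ->
  csummable setT (fun k : I * J => f k.1 * g k.2) /\
  csum setT (fun k : I * J => f k.1 * g k.2) = csum setT f * csum setT g.
Proof.
move=> sf sg.
have eT : [set: I * J] = setT `*`` (fun=> setT) by apply/seteqP; split.
have s : csummable setT (fun k : I * J => f k.1 * g k.2).
  rewrite eT; apply: (@csummable_pair _ _ _ _ _ (fun i j => f i * g j)
    (fun i => nsum setT (fun j => normc (g j)) * normc (f i))).
  - by move=> i _; exact: csummableZ.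
  - move=> i _; under eq_nsum do rewrite normcM.
    by rewrite nsumZ ?normc_ge0//; [rewrite mulrC|move=> *; exact: normc_ge0].
  - apply: nsummableZ => //; first by apply: nsum_ge0 => *; exact: normc_ge0.
    by move=> *; exact: normc_ge0.
split => //; move: (s); rewrite eT => /(@csum_pair _ _ _ _ _ (fun i j => f i * g j))[_ _ ->].
by rewrite -csumZr//; apply: eq_csum => i _; rewrite csumZ.
Qed.

(** The bridge from sequential limits to unordered sums, through which the real exponential, the
    cosine and the sine are recognised. *)
Lemma csum_limit (f : nat -> R[i]) (l : R[i]) : csummable setT f ->
  (forall e : R, 0 < e -> exists N, forall n, (N <= n)%N ->
    normc (\sum_(0 <= k < n) f k - l) < e) ->
  csum setT f = l.
Proof.
move=> sf H; apply/eqP; rewrite -subr_eq0; apply: contraT => d0.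
have e0 : 0 < normc (csum setT f - l) / 2 by rewrite divr_gt0// normc_gt0.
have [|N HN] := @csum_cvg_nat _ setT f 0 sf _ _ e0; first by move=> k; split.
have [M HM] := H _ e0.
have := HN (maxn N M) (leq_maxl _ _); have := HM (maxn N M) (leq_maxr _ _).
set S := \sum_(_ <= _ < _) _ => h1 h2.
have E : csum setT f - l = (S - l) - (S - csum setT f) by ring.
have := le_normcD (S - l) (- (S - csum setT f)).
by rewrite -E normcN; lra.
Qed.

End CauchyProducts.

(** * Complex powers and power series *)

Section ComplexExponential.
Context {R : realType}.
Implicit Types (w s : R[i]) (x : R).

Definition cexp w : R[i] :=
  (expR (complex.Re w))%:C * (cos (complex.Im w) +i* sin (complex.Im w)).

Lemma cexpD w s : cexp (w + s) = cexp w * cexp s.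
Proof.
rewrite /cexp ReD ImD expRD cosD sinD.
by apply: complex_eq; rewrite ?(ReM, ImM) /=; ring.
Qed.

Lemma cexp0 : cexp 0 = 1.
Proof. by rewrite /cexp /= expR0 cos0 sin0 mul1r. Qed.

Lemma nsum_exp x : 0 <= x ->
  nsummable setT (fun k : nat => x ^+ k / k`!%:R) /\
  nsum setT (fun k : nat => x ^+ k / k`!%:R) <= expR x.
Proof.
move=> x0.
have p k : 0 <= x ^+ k / k`!%:R by rewrite divr_ge0// exprn_ge0.
apply: nsum_nat_le => // n; apply: nondecreasing_cvgn_le.
  by apply: nondecreasing_series => k _ _; exact: p.
exact: is_cvg_series_exp_coeff.
Qed.

Lemma normc_fact_inv k : normc (k`!%:R^-1 : R[i]) = k`!%:R^-1.
Proof. by rewrite normcV -(rmorph_nat (real_complex R)) normcR ger0_norm. Qed.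

Lemma csummable_exp w : csummable setT (fun k : nat => w ^+ k / k`!%:R).
Proof.
apply: le_csummable (nsum_exp (normc_ge0 w)).1 => k _.
by rewrite normcM normcX normc_fact_inv.
Qed.

Lemma csum_expR x : csum setT (fun k : nat => x%:C ^+ k / k`!%:R) = (expR x)%:C.
Proof.
apply: csum_limit; first exact: csummable_exp.
move=> e e0; have /cvgrPdist_lt/(_ e e0)[N _ HN] := @is_cvg_series_exp_coeff R x.
exists N => n /HN /=; rewrite distrC; apply: le_lt_trans.
rewrite -normcR rmorphB rmorph_sum /=.
rewrite le_eqVlt; apply/orP; left; apply/eqP; congr (normc (_ - _)).
by apply: eq_bigr => k _; rewrite rmorphM rmorphXn fmorphV /= rmorph_nat.
Qed.

Lemma exp_coeff_i x k : ((0 +i* x) ^+ k / k`!%:R : R[i]) = cos_coeff x k +i* sin_coeff x k.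
Proof.
have -> : (0 +i* x : R[i]) = 'i * x%:C by apply: complex_eq; rewrite ?(ReM, ImM) /=; ring.
rewrite exprMn.
have -> : ('i : R[i]) ^+ k =
    ((~~ odd k)%:R * (-1) ^+ k./2) +i* ((odd k)%:R * (-1) ^+ k.-1./2).
  have I2 m : ('i : R[i]) ^+ m.*2 = ((-1) ^+ m)%:C.
    by rewrite -muln2 mulnC exprM sqr_i rmorphXn rmorphN1.
  have := odd_double_half k; case: (odd k) => /= E.
    rewrite -{1}E add1n exprS I2 /= mul0r mul1r -[k.-1]/(k.-1).
    rewrite (_ : k.-1 = k./2.*2) ?doubleK; last by rewrite -{1}E.
    by apply: complex_eq; rewrite ?(ReM, ImM) /=; ring.
  by rewrite -{1}E add0n I2 mul1r mul0r.
rewrite -rmorphXn -(rmorph_nat (real_complex R)) -fmorphV /=.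
by apply: complex_eq; rewrite ?(ReM, ImM) /= /cos_coeff /sin_coeff /= -?exprnP; ring.
Qed.

Lemma csum_expi x : csum setT (fun k : nat => (0 +i* x) ^+ k / k`!%:R) = cos x +i* sin x.
Proof.
apply: csum_limit; first exact: csummable_exp.
move=> e e0; have e2 : 0 < e / 2 by rewrite divr_gt0.
have := @is_cvg_series_cos_coeff R x; have := @is_cvg_series_sin_coeff R x.
move=> /cvgrPdist_lt/(_ _ e2)[N _ HN] /cvgrPdist_lt/(_ _ e2)[M _ HM].
exists (maxn N M) => n; rewrite geq_max => /andP[/HN /= h1 /HM /= h2].
apply: le_lt_trans (normc_le_ReIm _) _.
have -> : \sum_(0 <= k < n) ((0 +i* x) ^+ k / k`!%:R : R[i]) =
    series (cos_coeff x) n +i* series (sin_coeff x) n.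
  rewrite /series /=; elim: n {h1 h2} => [|n IH]; first by rewrite !big_geq.
  by rewrite !big_nat_recr//= IH exp_coeff_i.
have -> : cos x = limn (series (cos_coeff x)) by rewrite unlock.
have -> : sin x = limn (series (sin_coeff x)) by rewrite unlock.
by rewrite /= distrC (distrC (\sum_(_ <= _ < _) _) (limn (series (sin_coeff x)))); lra.
Qed.

(** With w = a + ib, the Cauchy product of the series of exp(a) and exp(ib) is the series of exp(w)
    by the binomial formula. *)
Lemma csum_exp w : csum setT (fun k : nat => w ^+ k / k`!%:R) = cexp w.
Proof.
pose a := (complex.Re w)%:C; pose b : R[i] := 0 +i* complex.Im w.
have wE : w = a + b by apply: complex_eq; rewrite ?(ReD, ImD) /=; ring.
have [s E] := csum_prod (csummable_exp a) (csummable_exp b).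
have [_ _ ED] := csum_diag (F := fun i j => a ^+ i / i`!%:R * (b ^+ j / j`!%:R)) s.
have := etrans (esym E) ED; rewrite csum_expR csum_expi /cexp => ->; apply: eq_csum => n _.
rewrite wE addrC exprDn mulr_suml; apply: eq_bigr => i _.
have ni : (i <= n)%N by rewrite -ltnS.
rewrite -mulr_natr -(bin_fact ni) !natrM.
have f0 m : (m`!%:R : R[i]) != 0 by rewrite pnatr_eq0 -lt0n fact_gt0.
have b0 : ('C(n, i)%:R : R[i]) != 0 by rewrite pnatr_eq0 -lt0n bin_gt0.
by field; rewrite !f0 b0.
Qed.

End ComplexExponential.

Section ComplexPowers.
Context {R : realType}.
Implicit Types (s t : R[i]) (x y : R).

Lemma cpowE x s : 0 < x -> cpow x s = cexp (s * (ln x)%:C).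
Proof.
move=> x0; rewrite /cpow /cexp ReM ImM /= !mulr0 subr0 add0r.
by rewrite /powR gt_eqF.
Qed.

Lemma normc_cpow x s : normc (cpow x s) = x `^ complex.Re s.
Proof.
rewrite normcM normcR ger0_norm ?powR_ge0//.
by rewrite /normc cos2Dsin2 sqrtr1 mulr1.
Qed.

Lemma cpow_neq0 x s : 0 < x -> cpow x s != 0.
Proof. by move=> x0; rewrite -normc_gt0 normc_cpow powR_gt0. Qed.

Lemma cpowM x y s : 0 < x -> 0 < y -> cpow (x * y) s = cpow x s * cpow y s.
Proof.
move=> x0 y0; rewrite !cpowE ?mulr_gt0// -cexpD -mulrDr -rmorphD lnM//.
Qed.

Lemma cpowD x s t : 0 < x -> cpow x (s + t) = cpow x s * cpow x t.
Proof. by move=> x0; rewrite !cpowE// -cexpD mulrDl. Qed.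

Lemma cpow1 s : cpow 1 s = 1.
Proof. by rewrite cpowE// ln1 mulr0 cexp0. Qed.

Lemma cpow_real x (r : R) : 0 < x -> cpow x r%:C = (x `^ r)%:C.
Proof. by move=> x0; rewrite /cpow /= mul0r cos0 sin0 mulr1. Qed.

Lemma cpow_nat x n : 0 < x -> cpow x n%:R = (x ^+ n)%:C.
Proof.
by move=> x0; rewrite -(rmorph_nat (real_complex R)) cpow_real// powR_mulrn// ltW.
Qed.

Lemma cpowN x s : 0 < x -> cpow x (- s) = (cpow x s)^-1.
Proof.
move=> x0; apply: (mulfI (cpow_neq0 s x0)); rewrite -cpowD// subrr.
by rewrite divff ?cpow_neq0// (_ : 0 = 0%:R)// cpow_nat// expr0.
Qed.

End ComplexPowers.

(** * Power series that converge absolutely on closed discs *)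

Section PowerSeries.
Context {R : realType}.
Implicit Types (a b : nat -> R[i]) (z h p : R[i]) (r : R).

Definition psum a z : R[i] := csum setT (fun n => a n * z ^+ n).

(** Absolute convergence on the closed disc of radius [r], with [pnorm] as the weighted l1 norm.
    This norm is submultiplicative and dominates the values on the disc, so bounds on coefficients
    can replace bounds on functions. *)
Definition pconv a r : Prop := nsummable setT (fun n => normc (a n) * r ^+ n).

Definition pnorm a r : R := nsum setT (fun n => normc (a n) * r ^+ n).

Lemma normcMX_ge0 a r n : 0 <= r -> 0 <= normc (a n) * r ^+ n.
Proof. by move=> r0; rewrite mulr_ge0 ?normc_ge0 ?exprn_ge0. Qed.

Lemma normc_termE a z n : normc (a n * z ^+ n) = normc (a n) * normc z ^+ n.
Proof. by rewrite normcM normcX. Qed.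

Lemma le_pconv a r1 r2 : 0 <= r1 -> r1 <= r2 -> pconv a r2 -> pconv a r1.
Proof.
move=> r0 r12; apply: le_nsummable => n _.
by rewrite ler_wpM2l ?normc_ge0// lerXn2r ?nnegrE// (le_trans r0).
Qed.

Lemma csummable_psum a z r : pconv a r -> normc z <= r ->
  csummable setT (fun n => a n * z ^+ n).
Proof.
move=> ar zr; apply: le_csummable (le_pconv (normc_ge0 z) zr ar) => n _.
by rewrite normc_termE.
Qed.

Lemma normc_psum a z r : pconv a r -> normc z <= r -> normc (psum a z) <= pnorm a r.
Proof.
move=> ar zr; apply: le_trans (normc_csum (csummable_psum ar zr)) _.
have r0 : 0 <= r := le_trans (normc_ge0 z) zr.
apply: le_nsum => // n _; first exact: normc_ge0.
rewrite normc_termE ler_wpM2l ?normc_ge0// lerXn2r ?nnegrE ?normc_ge0//.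
Qed.

Lemma eq_psum a b z : a =1 b -> psum a z = psum b z.
Proof. by move=> ab; apply: eq_csum => n _; rewrite ab. Qed.

Lemma pconvS a r : 0 < r -> pconv a r -> pconv (fun n => a n.+1) r.
Proof.
move=> r0 ar; have r0' := ltW r0.
have := nsummableZ (c := r^-1) _ _ ar; rewrite invr_ge0 => /(_ r0').
move=> /(_ (fun n _ => normcMX_ge0 a n r0')) s.
apply: (nsum_le (M := nsum setT (fun n => r^-1 * (normc (a n) * r ^+ n))) _ _).1.
  by move=> n _; rewrite (normcMX_ge0 (fun n => a n.+1)).
move=> u uu _; have E n : normc (a n.+1) * r ^+ n = r^-1 * (normc (a n.+1) * r ^+ n.+1).
  by rewrite exprS mulrCA mulKf// gt_eqF.
under eq_bigr do rewrite E.
rewrite -(big_map S xpredT (fun n => r^-1 * (normc (a n) * r ^+ n))).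
apply: nsum_ge_seq => //.
  by move=> n _; rewrite mulr_ge0 ?invr_ge0 ?normcMX_ge0.
by rewrite map_inj_uniq//; exact: succn_inj.
Qed.

Lemma csum_nat_recl (f : nat -> R[i]) : csummable setT f ->
  csum setT f = f 0%N + csum setT (fun n => f n.+1).
Proof.
move=> sf; rewrite (csumID [set 0%N] sf) setTI csum_set1; congr (_ + _).
have sb : set_bij [set: nat] ([set: nat] `&` ~` [set 0%N]) S.
  split; [by move=> n _; split|by move=> n m _ _ []|].
  by move=> [|n] [_ h]; [case: h|exists n].
by rewrite (csum_bij f sb).2.
Qed.

Lemma psumS a z r : 0 < r -> pconv a r -> normc z <= r ->
  psum a z = a 0%N + z * psum (fun n => a n.+1) z.
Proof.
move=> r0 ar zr; rewrite /psum csum_nat_recl; last exact: csummable_psum ar zr.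
rewrite expr0 mulr1 -csumZ; last exact: csummable_psum (pconvS r0 ar) zr.
by congr (_ + _); apply: eq_csum => n _; rewrite exprS mulrCA.
Qed.

Lemma psum0 a : psum a 0 = a 0%N.
Proof.
rewrite /psum (@eq_csum _ _ _ _ (fun n => if n == 0%N then a 0%N else 0)).
  rewrite (@csumID _ _ [set 0%N]).
    rewrite setTI csum_set1 csum0 ?addr0// => n [_ /= n0].
    by case: eqP.
  apply: eq_csummable (_ : csummable setT (fun n => 0 + (if n == 0%N then a 0%N else 0))).
    by move=> n _; rewrite add0r.
  apply: (nsum_nat_le (M := normc (a 0%N)) _ _).1; first by move=> *; exact: normc_ge0.
  move=> [|n]; first by rewrite big_geq// normc_ge0.
  rewrite big_nat_recl// big1 ?add0r ?addr0// => k _.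
  by rewrite addr0 normc0.
by move=> [|n] _; rewrite /= ?expr0 ?mulr1// exprS mul0r mulr0.
Qed.

Lemma pconv_shift a r k : 0 < r -> pconv a r -> pconv (fun n => a (k + n)%N) r.
Proof.
move=> r0 ar; elim: k => [|k IH] //.
by have := pconvS r0 IH; under eq_fun do rewrite addnS -addSn.
Qed.

Lemma psum_shift a z r k : 0 < r -> pconv a r -> normc z <= r ->
  (forall i, (i < k)%N -> a i = 0) ->
  psum a z = z ^+ k * psum (fun n => a (k + n)%N) z.
Proof.
move=> r0 ar zr; elim: k => [|k IH] a0; first by rewrite expr0 mul1r.
rewrite IH; last by move=> i ik; apply: a0; exact: leqW.
rewrite (psumS r0 (pconv_shift k r0 ar) zr) addn0 a0// add0r mulrA -exprSr.
by congr (_ * _); apply: eq_psum => n; rewrite addnS addSn.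
Qed.

Lemma psum_sub0 a z r : 0 < r -> pconv a r -> normc z <= r ->
  normc (psum a z - a 0%N) <= normc z * pnorm (fun n => a n.+1) r.
Proof.
move=> r0 ar zr; rewrite (psumS r0 ar zr) addrAC subrr add0r normcM.
by rewrite ler_wpM2l ?normc_ge0// normc_psum//; exact: pconvS.
Qed.

Lemma psum_neq0 a r : 0 < r -> pconv a r -> a 0%N != 0 ->
  exists2 e : R, 0 < e <= r & forall z, normc z <= e -> psum a z != 0.
Proof.
move=> r0 ar a0; set M := pnorm (fun n => a n.+1) r.
have M0 : 0 <= M by apply: nsum_ge0 => n _; rewrite (normcMX_ge0 (fun n => a n.+1))// ltW.
have na0 : 0 < normc (a 0%N) by rewrite normc_gt0.
(* On this disc the series differs from [a 0] by at most half of its modulus; the 1 added to M keeps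
   the denominator positive. *)
pose e := Num.min r (normc (a 0%N) / (2 * (M + 1))).
have q0 : 0 < normc (a 0%N) / (2 * (M + 1)) by rewrite divr_gt0// mulr_gt0// ltr_pwDr.
exists e; first by rewrite lt_min r0 q0 ge_min lexx.
move=> z ze; have zr : normc z <= r by apply: le_trans ze _; rewrite ge_min lexx.
have := psum_sub0 r0 ar zr; rewrite -/M => H; apply/negP => /eqP z0.
move: H; rewrite z0 sub0r normcN => H.
have ze' : normc z <= normc (a 0%N) / (2 * (M + 1)).
  by apply: le_trans ze _; rewrite ge_min lexx orbT.
have : normc z * M <= normc (a 0%N) / (2 * (M + 1)) * (M + 1).
  by apply: ler_pM => //; [exact: normc_ge0|rewrite lerDl].
have -> : normc (a 0%N) / (2 * (M + 1)) * (M + 1) = normc (a 0%N) / 2.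
  by field; rewrite gt_eqF// ltr_pwDr.
by lra.
Qed.

Lemma pconvB a b r : 0 <= r -> pconv a r -> pconv b r -> pconv (fun n => a n - b n) r.
Proof.
move=> r0 ar br; apply: le_nsummable (nsummableD _ _ ar br) => n _.
- by rewrite -mulrDl ler_wpM2r ?exprn_ge0// -[normc (b n)]normcN le_normcD.
- exact: normcMX_ge0.
- exact: normcMX_ge0.
Qed.

Lemma psumB a b r z : pconv a r -> pconv b r -> normc z <= r ->
  psum (fun n => a n - b n) z = psum a z - psum b z.
Proof.
move=> ar br zr; rewrite -csumB; last 2 first.
- exact: csummable_psum ar zr.
- exact: csummable_psum br zr.
by apply: eq_csum => n _; rewrite mulrBl.
Qed.

(** If [a n] is the first nonzero coefficient, the series is z^n times a series with nonzero
    constant term, which does not vanish near 0; a small positive real z is then a contradiction. *)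
Lemma psum_eq0 a r e : 0 < r -> 0 < e -> pconv a r ->
  (forall z, normc z <= e -> psum a z = 0) -> forall n, a n = 0.
Proof.
move=> r0 e0 ar H n; elim/ltn_ind: n => n IH; apply/eqP; apply: contraT => an0.
have [|d /andP[d0 dr] Hd] := psum_neq0 r0 (pconv_shift n r0 ar); first by rewrite addn0.
pose x := Num.min d e; have x0 : 0 < x by rewrite lt_min d0 e0.
have nx : normc x%:C = x by rewrite normcR ger0_norm// ltW.
have xd : normc x%:C <= d by rewrite nx ge_min lexx.
have := psum_shift r0 ar (le_trans xd dr) IH.
rewrite H ?nx ?ge_min ?lexx ?orbT// => /esym/eqP; rewrite mulf_eq0 (negbTE (Hd _ xd)) orbF.
by rewrite expf_eq0 => /andP[_ /eqP x00]; move: x0; rewrite -nx x00 normc0 ltxx.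
Qed.

(** The form of the identity theorem on which the binomial series and the continuation of theta
    rest. *)
Lemma psum_inj a b r e : 0 < e -> e <= r -> pconv a r -> pconv b r ->
  (forall z, normc z <= e -> psum a z = psum b z) -> a =1 b.
Proof.
move=> e0 er ar br H n; have r0 := lt_le_trans e0 er.
apply/eqP; rewrite -subr_eq0; apply/eqP.
apply: (psum_eq0 (a := fun n => a n - b n) r0 e0 (pconvB (ltW r0) ar br)) => z ze.
by rewrite (psumB ar br (le_trans ze er)) H// subrr.
Qed.

End PowerSeries.

(** * Change of centre, and holomorphy of power series *)

Section Recentering.
Context {R : realType}.
Implicit Types (a b : nat -> R[i]) (z h p : R[i]) (r : R).

(** The coefficient of h^k in the sum of the a_n (p + h)^n, with n written as k + m. *)
Definition recenter a p : nat -> R[i] :=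
  fun k => csum setT (fun m => a (k + m)%N * 'C(k + m, k)%:R * p ^+ m).

Lemma normc_nat n : normc (n%:R : R[i]) = n%:R.
Proof. by rewrite -(rmorph_nat (real_complex R)) normcR ger0_norm. Qed.

Let cross a p h k m : R[i] := a (k + m)%N * 'C(k + m, k)%:R * p ^+ m * h ^+ k.

Let crossE a p h n (i : 'I_n.+1) :
  cross a p h i (n - i)%N = a n * (p ^+ (n - i) * h ^+ i *+ 'C(n, i)).
Proof. by rewrite /cross subnKC -1?ltnS// -mulr_natr; ring. Qed.

(** On the antidiagonal of index n the moduli add up to |a_n| (|p| + |h|)^n. *)
Let summable_cross a p h r : pconv a r -> normc p + normc h <= r ->
  csummable setT (fun k : nat * nat => cross a p h k.1 k.2).
Proof.
move=> ar pr; apply: csummable_diag.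
apply: le_nsummable (le_pconv _ pr ar); last by rewrite addr_ge0 ?normc_ge0.
move=> n _; rewrite exprDn mulr_sumr ler_sum// => i _.
by rewrite crossE normcM normcMn normcM !normcX.
Qed.

Let row_cross a p h k : cross a p h k = fun m => (a (k + m)%N * 'C(k + m, k)%:R * p ^+ m) * h ^+ k.
Proof. by []. Qed.

Lemma recenterP a p r : normc p < r -> pconv a r ->
  pconv (recenter a p) (r - normc p) /\
  forall h, normc h <= r - normc p -> psum a (p + h) = psum (recenter a p) h.
Proof.
move=> pr ar; set d := r - normc p; have d0 : 0 < d by rewrite subr_gt0.
have nd : normc (d%:C : R[i]) = d by rewrite normcR ger0_norm// ltW.
have eT : [set: nat * nat] = setT `*`` (fun=> setT) by apply/seteqP; split.
have rows h : normc h <= d ->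
    (forall k, csum setT (cross a p h k) = recenter a p k * h ^+ k) /\
    csum setT (fun k : nat * nat => cross a p h k.1 k.2) =
    csum setT (fun k => recenter a p k * h ^+ k).
  move=> hd; have s := summable_cross ar (_ : normc p + normc d%:C <= r).
  have s1 : csummable setT (fun k : nat * nat => cross a p h k.1 k.2).
    by apply: summable_cross ar _; move: hd; rewrite /d; lra.
  have E k : csum setT (cross a p h k) = recenter a p k * h ^+ k.
    rewrite row_cross csumZr//.
    (* Summability of the series of each coefficient is read off at the real point h = d > 0, where
       division by d^k is possible; [h] itself may be 0. *)
    have := s; rewrite nd addrC subrK lexx => /(_ isT).
    rewrite eT => /(@csum_pair _ _ _ _ _ (cross a p d%:C))[/(_ k Logic.I) + _ _].
    move/(csummableZ (d%:C ^+ k)^-1); apply: eq_csummable => m _.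
    rewrite /cross mulrC mulfK// expf_neq0// -normc_gt0 nd//.
  split => //; move: s1; rewrite eT => /(@csum_pair _ _ _ _ _ (cross a p h))[_ _ ->].
  by apply: eq_csum => k _; rewrite E.
split.
  have s := summable_cross ar (_ : normc p + normc d%:C <= r).
  move: s; rewrite nd addrC subrK lexx => /(_ isT).
  rewrite eT => /(@csum_pair _ _ _ _ _ (cross a p d%:C))[_ + _].
  apply: le_nsummable => k _; rewrite (rows d%:C _).1 ?nd//.
  by rewrite normcM normcX nd.
move=> h hd; have [_ E] := rows h hd.
have s1 : csummable setT (fun k : nat * nat => cross a p h k.1 k.2).
  by apply: summable_cross ar _; move: hd; rewrite /d; lra.
have [_ _ E2] := csum_diag s1.
rewrite /psum -E E2; apply: eq_csum => n _.
by rewrite exprDn mulr_sumr; apply: eq_bigr => i _; rewrite crossE.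
Qed.

Lemma nbhs_normc p (P : R[i] -> Prop) (r : R) : 0 < r ->
  (forall z, normc (z - p) < r -> P z) -> \forall z \near p, P z.
Proof.
move=> r0 H; apply/nbhs_ballP; exists r%:C => /=; first by rewrite ltcR.
move=> z /=; rewrite -ball_normE /= distrC -[ `| _ |]/((normc _)%:C) ltcR; exact: H.
Qed.

Lemma dnbhs_normc p (P : R[i] -> Prop) (r : R) : 0 < r ->
  (forall z, z != p -> normc (z - p) < r -> P z) -> \forall z \near p^', P z.
Proof.
move=> r0 H; apply: (nbhs_normc r0) => z zr zp; exact: H.
Qed.

Lemma derivable_psum a p r (f : R[i] -> R[i]) : 0 < r -> pconv a r ->
  (forall z, normc (z - p) <= r -> f z = psum a (z - p)) -> derivable f p 1.
Proof.
move=> r0 ar fE; apply/cvg_ex; exists (a 1%N).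
apply/cvgrPdist_lt => -[e i] /=; rewrite ltcE /= => /andP[/eqP -> e0].
set M := pnorm (fun n => a n.+2) r.
have ar1 := pconvS r0 ar.
have M0 : 0 <= M by apply: nsum_ge0 => n _; rewrite (normcMX_ge0 (fun n => a n.+2))// ltW.
have q0 : 0 < e / (M + 1) by rewrite divr_gt0// ltr_pwDr.
apply: (@dnbhs_normc 0 _ (Num.min r (e / (M + 1)))); first by rewrite lt_min r0 q0.
move=> h h0; rewrite subr0 lt_min => /andP[hr hq].
rewrite -[ `| _ |]/((normc _)%:C) ltcR /= scaler1 fE; last by rewrite addrK ltW.
rewrite fE; last by rewrite subrr normc0 ltW.
rewrite subrr psum0 addrK (psumS r0 ar (ltW hr)) addrAC subrr add0r.
rewrite -[_ *: _]/(_ * _) mulKf// normcB.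
apply: le_lt_trans (psum_sub0 r0 ar1 (ltW hr)) _.
apply: (@le_lt_trans _ _ (normc h * (M + 1))).
  by rewrite ler_wpM2l ?normc_ge0// lerDl.
by rewrite -ltr_pdivlMr// ltr_pwDr.
Qed.

Lemma holomorphic_psum a p r (f : R[i] -> R[i]) : 0 < r -> pconv a r ->
  (forall z, normc (z - p) <= r -> f z = psum a (z - p)) -> holomorphic_at f p.
Proof.
move=> r0 ar fE; apply: (nbhs_normc r0) => q qr.
have [cb E] := recenterP qr ar.
have d0 : 0 < r - normc (q - p) by rewrite subr_gt0.
apply: (derivable_psum d0 cb) => z zq.
rewrite -E// fE; first by congr psum; ring.
have -> : z - p = (q - p) + (z - q) by ring.
by apply: le_trans (le_normcD _ _) _; move: zq; lra.
Qed.

End Recentering.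

(** * Products and infinite sums of power series *)

Section PowerSeriesAlgebra.
Context {R : realType}.
Implicit Types (a b : nat -> R[i]) (z h p : R[i]) (r : R).

Lemma csum_nonneg (T : choiceType) (D : set T) (g : T -> R) :
  (forall t, D t -> 0 <= g t) -> csum D (fun t => (g t)%:C) = (nsum D g)%:C.
Proof.
move=> g0; apply: complex_eq => /=.
  rewrite /rsum (@eq_nsum _ _ D (fun t => Num.max (g t) 0) g); last first.
    by move=> t Dt; rewrite (max_idPl _)// g0.
  rewrite [X in _ - X](_ : _ = 0) ?subr0// /nsum esum1// => t Dt.
  by rewrite (max_idPr _)// oppr_le0 g0.
by rewrite /rsum oppr0 subrr.
Qed.

Lemma csummable_nonneg (T : choiceType) (D : set T) (g : T -> R) :
  (forall t, D t -> 0 <= g t) -> nsummable D g -> csummable D (fun t => (g t)%:C).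
Proof.
by move=> g0; apply: le_nsummable => t Dt; rewrite normcR ger0_norm ?g0.
Qed.

Lemma nsum_diag (f g : nat -> R) :
  (forall n, 0 <= f n) -> (forall n, 0 <= g n) ->
  nsummable setT f -> nsummable setT g ->
  nsummable setT (fun n => \sum_(i < n.+1) f i * g (n - i)%N) /\
  nsum setT (fun n => \sum_(i < n.+1) f i * g (n - i)%N) = nsum setT f * nsum setT g.
Proof.
move=> f0 g0 sf sg.
have [s E] := csum_prod (csummable_nonneg (fun n _ => f0 n) sf)
  (csummable_nonneg (fun n _ => g0 n) sg).
have [_ s2 E2] := csum_diag (F := fun i j => (f i)%:C * (g j)%:C) s.
have fg n (i : 'I_n.+1) : normc ((f i)%:C * (g (n - i)%N)%:C) = f i * g (n - i)%N.
  by rewrite normcM !normcR !ger0_norm.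
split; first by apply: le_nsummable s2 => n _; rewrite ler_sum// => i _; rewrite fg.
apply: (@complexI R); rewrite rmorphM /= -!csum_nonneg//; last first.
  by move=> n _; rewrite sumr_ge0// => i _; rewrite mulr_ge0.
rewrite -[RHS]E E2; apply: eq_csum => n _.
by rewrite rmorph_sum; apply: eq_bigr => i _; rewrite rmorphM.
Qed.

Definition pmul a b : nat -> R[i] := fun n => \sum_(i < n.+1) a i * b (n - i)%N.

Lemma pmulP a b r : 0 <= r -> pconv a r -> pconv b r ->
  [/\ pconv (pmul a b) r, pnorm (pmul a b) r <= pnorm a r * pnorm b r &
      forall z, normc z <= r -> psum (pmul a b) z = psum a z * psum b z].
Proof.
move=> r0 ar br.
have [s E] := nsum_diag (fun n => normcMX_ge0 a n r0) (fun n => normcMX_ge0 b n r0) ar br.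
have le n : normc (pmul a b n) * r ^+ n <=
    \sum_(i < n.+1) normc (a i) * r ^+ i * (normc (b (n - i)%N) * r ^+ (n - i)).
  apply: le_trans (ler_wpM2r (exprn_ge0 n r0) (normc_sum _ _ _)) _.
  rewrite mulr_suml ler_sum// => i _; rewrite normcM.
  have -> : r ^+ n = r ^+ i * r ^+ (n - i) by rewrite -exprD subnKC// -ltnS.
  by rewrite mulrACA.
split.
- by apply: le_nsummable s => n _.
- rewrite /pnorm -E; apply: le_nsum => // n _; exact: normcMX_ge0.
move=> z zr; have [s1 E1] := csum_prod (csummable_psum ar zr) (csummable_psum br zr).
have [_ _ E2] := csum_diag (F := fun i j => a i * z ^+ i * (b j * z ^+ j)) s1.
rewrite /psum -E1 E2; apply: eq_csum => n _; rewrite mulr_suml; apply: eq_bigr => i _.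
have -> : z ^+ n = z ^+ i * z ^+ (n - i) by rewrite -exprD subnKC// -ltnS.
by rewrite mulrACA.
Qed.

(** Summable weighted norms make the double family absolutely summable, so that it may be summed by
    rows or by columns: a series of power series becomes a single one, again with a norm bound. *)
Lemma psum_csum (I : choiceType) (A : I -> nat -> R[i]) r : 0 < r ->
  (forall i, pconv (A i) r) -> nsummable setT (fun i => pnorm (A i) r) ->
  [/\ pconv (fun n => csum setT (fun i => A i n)) r,
      pnorm (fun n => csum setT (fun i => A i n)) r <= nsum setT (fun i => pnorm (A i) r) &
      forall z, normc z <= r ->
        csummable setT (fun i => psum (A i) z) /\
        psum (fun n => csum setT (fun i => A i n)) z = csum setT (fun i => psum (A i) z)].
Proof.
move=> r0 cA sA.
have nr : normc (r%:C : R[i]) = r by rewrite normcR ger0_norm// ltW.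
have eT : [set: I * nat] = setT `*`` (fun=> setT) by apply/seteqP; split.
have eT' : [set: nat * I] = setT `*`` (fun=> setT) by apply/seteqP; split.
have s z : normc z <= r -> csummable setT (fun k : I * nat => A k.1 k.2 * z ^+ k.2).
  move=> zr; rewrite eT; apply: (@csummable_pair _ _ _ _ _ (fun i n => A i n * z ^+ n) _ _ _ sA).
    by move=> i _; exact: csummable_psum (cA i) zr.
  move=> i _; apply: le_nsum (cA i) => n _; first exact: normc_ge0.
  by rewrite normc_termE ler_wpM2l ?normc_ge0// lerXn2r ?nnegrE ?normc_ge0// ltW.
have sb : set_bij [set: nat * I] [set: I * nat] (fun k => (k.2, k.1)).
  split => //; first by move=> [x y] [u v] _ _ /= [-> ->].
  by move=> [x y] _; exists (y, x).
have sw z : normc z <= r -> csummable setT (fun k : nat * I => A k.2 k.1 * z ^+ k.1).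
  by move=> /s/(csum_bij (fun k : I * nat => A k.1 k.2 * z ^+ k.2) sb).1.
have col n : csummable setT (fun i => A i n).
  have := sw r%:C; rewrite nr lexx => /(_ isT); rewrite eT'.
  move=> /(@csum_pair _ _ _ _ _ (fun n i => A i n * r%:C ^+ n))[/(_ n Logic.I) + _ _].
  move/(csummableZ (r%:C ^+ n)^-1); apply: eq_csummable => i _.
  by rewrite mulrC mulfK// expf_neq0// -normc_gt0 nr.
have colE z n : csum setT (fun i => A i n * z ^+ n) = csum setT (fun i => A i n) * z ^+ n.
  by rewrite csumZr.
have g0 n i : 0 <= normc (A i n) * r ^+ n by apply: normcMX_ge0; exact: ltW.
have n1 : nsummable setT (fun k : I * nat => normc (A k.1 k.2) * r ^+ k.2).
  have := s r%:C; rewrite nr lexx => /(_ isT); apply: le_nsummable => k _.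
  by rewrite normc_termE nr.
have n2 := (nsum_bij (fun k : I * nat => normc (A k.1 k.2) * r ^+ k.2) sb).1.1 n1.
have E12 := (nsum_bij (fun k : I * nat => normc (A k.1 k.2) * r ^+ k.2) sb).2.
move: n1 n2 E12; rewrite eT eT' => n1 n2.
have [_ _ ->] := @nsum_pair _ _ _ _ _ (fun i n => normc (A i n) * r ^+ n) (fun i n _ _ => g0 n i) n1.
have [r1 r2 ->] := @nsum_pair _ _ _ _ _ (fun n i => normc (A i n) * r ^+ n) (fun n i _ _ => g0 n i) n2.
move=> E12.
have le n : normc (csum setT (fun i => A i n)) * r ^+ n <=
    nsum setT (fun i => normc (A i n) * r ^+ n).
  have := normc_csum (csummableZ (r%:C ^+ n) (col n)).
  rewrite csumZ// normcM normcX nr mulrC => /le_trans; apply.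
  rewrite le_eqVlt; apply/orP; left; apply/eqP/eq_nsum => i _.
  by rewrite normcM normcX nr mulrC.
split.
- by apply: le_nsummable r2 => n _.
- rewrite [leRHS]E12; apply: le_nsum => // n _.
  by rewrite mulr_ge0 ?normc_ge0 ?exprn_ge0 ?(ltW r0).
move=> z zr; split.
  have := s z zr; rewrite eT.
  by move=> /(@csum_pair _ _ _ _ _ (fun i n => A i n * z ^+ n))[_ + _].
have := csum_exchange (f := fun i n => A i n * z ^+ n) (s z zr) => /esym <-.
by apply: eq_csum => n _; rewrite colE.
Qed.

Definition plin (u v : R[i]) : nat -> R[i] :=
  fun n => if n is m.+1 then if m is _.+1 then 0 else v else u.

Lemma plinP (u v : R[i]) r : 0 <= r ->
  [/\ pconv (plin u v) r, pnorm (plin u v) r <= normc u + normc v * r &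
      forall z, psum (plin u v) z = u + v * z].
Proof.
move=> r0.
have le n : \sum_(0 <= k < n) normc (plin u v k) * r ^+ k <= normc u + normc v * r.
  have vr : 0 <= normc v * r by rewrite mulr_ge0 ?normc_ge0.
  case: n => [|[|n]]; first by rewrite big_geq// addr_ge0 ?normc_ge0.
    by rewrite big_nat1 /= expr0 mulr1 lerDl.
  rewrite big_nat_recl// big_nat_recl// big1; last first.
    by move=> k _; rewrite (_ : plin u v k.+2 = 0)// normc0 mul0r.
  by rewrite addr0 expr0 mulr1 expr1.
have [c n] := nsum_nat_le (fun n => normcMX_ge0 (plin u v) n r0) le.
split => // z.
have [c' _] : pconv (plin u v) (normc z + 1) /\ True.
  split => //; apply: (nsum_nat_le (M := normc u + normc v * (normc z + 1)) _ _).1.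
    by move=> k; rewrite normcMX_ge0// addr_ge0 ?normc_ge0.
  move=> [|[|m]].
  - by rewrite big_geq// addr_ge0 ?mulr_ge0 ?addr_ge0 ?normc_ge0.
  - by rewrite big_nat1 /= expr0 mulr1 lerDl mulr_ge0 ?addr_ge0 ?normc_ge0.
  rewrite big_nat_recl// big_nat_recl// big1; last first.
    by move=> k _; rewrite (_ : plin u v k.+2 = 0)// normc0 mul0r.
  by rewrite addr0 expr0 mulr1 expr1.
have z1 : normc z <= normc z + 1 by rewrite lerDl.
have p1 : 0 < normc z + 1 by rewrite ltr_pwDr// normc_ge0.
rewrite (psumS p1 c' z1) (psumS p1 (pconvS p1 c') z1) /=.
rewrite (_ : psum _ z = 0) ?mulr0 ?addr0 1?mulrC//.
by apply: csum0 => k _; rewrite mul0r.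
Qed.

Lemma nsum_geometric (x : R) : 0 <= x < 1 -> nsummable setT (fun k : nat => x ^+ k).
Proof.
move=> /andP[x0 x1].
apply: (nsum_nat_le (M := (1 - x)^-1) (fun n => exprn_ge0 n x0) _).1 => n.
have x1' : 0 < 1 - x by rewrite subr_gt0.
rewrite -[_^-1]mul1r ler_pdivlMr// mulrC.
have -> : (1 - x) * \sum_(0 <= k < n) x ^+ k = 1 - x ^+ n.
  elim: n => [|n IH]; first by rewrite big_geq// mulr0 expr0 subrr.
  by rewrite big_nat_recr//= mulrDr IH exprS; ring.
by rewrite gerBl exprn_ge0.
Qed.

End PowerSeriesAlgebra.

(** * Rising factorials *)

Section Rising.
Context {R : realType}.

(** This is (s)_k / k!, the coefficient of x^k in (1 - x)^(-s). *)
Definition rising (F : fieldType) (k : nat) (s : F) : F :=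
  \prod_(j < k) ((s + j%:R) / j.+1%:R).

Lemma risingS (F : fieldType) k (s : F) :
  rising k.+1 s = rising k s * ((s + k%:R) / k.+1%:R).
Proof. by rewrite /rising big_ord_recr. Qed.

Lemma rising0 (F : fieldType) (s : F) : rising 0 s = 1.
Proof. by rewrite /rising big_ord0. Qed.

Lemma rising1 (F : numFieldType) k : rising k (1 : F) = 1.
Proof. by elim: k => [|k IH]; rewrite ?rising0// risingS IH nat1r divff// mul1r. Qed.

Lemma rising_ge0 k (T : R) : 0 <= T -> 0 <= rising k T.
Proof. by move=> T0; apply: prodr_ge0 => j _; rewrite divr_ge0// addr_ge0. Qed.

(** The ratio (T + k) / (k + 1) of consecutive values is at most 3/2 as soon as k >= 2T, and at most
    T + 1 before that. Any rate below 2 would do: the values will be multiplied by powers of 1/2. *)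
Lemma rising_bound (T : R) : 0 <= T ->
  exists C : R, 0 <= C /\ forall k, rising k T <= C * (3 / 2) ^+ k.
Proof.
move=> T0; have [J HJ] : exists J : nat, 2 * T <= J%:R.
  by exists (Num.bound (2 * T)); apply: ltW; apply: archi_boundP; rewrite mulr_ge0.
have g1 n : (1 : R) <= (3 / 2) ^+ n by rewrite exprn_ege1//; lra.
have c1 n : (0 : R) <= (T + 1) ^+ n by rewrite exprn_ge0// addr_ge0.
have tk m : 0 <= T + m%:R by rewrite addr_ge0.
exists ((T + 1) ^+ J); split => //; elim => [|k IH].
  by rewrite rising0 expr0 mulr1 exprn_ege1// lerDr.
have [kJ|Jk] := ltnP k J.
  apply: (@le_trans _ _ ((T + 1) ^+ k.+1)).
    elim: {IH} k kJ => [|k IH] kJ.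
      by rewrite risingS rising0 mul1r addr0 divr1 expr1 lerDl.
    rewrite risingS exprSr ler_pM ?rising_ge0 ?divr_ge0 ?tk//; first exact/IH/ltnW.
    rewrite ler_pdivrMr// mulrDl mul1r lerD// ?ler_nat// ler_peMr//.
    by rewrite ler1n.
  apply: (@le_trans _ _ ((T + 1) ^+ J)); first by rewrite ler_weXn2l// lerDr.
  by rewrite ler_peMr.
rewrite risingS exprSr [leRHS]mulrA; apply: ler_pM; first exact: rising_ge0.
- by rewrite divr_ge0 ?tk.
- exact: IH.
rewrite ler_pdivrMr// -natr1.
have : J%:R <= k%:R :> R by rewrite ler_nat.
by lra.
Qed.

(** The Chu-Vandermonde identity. After multiplication by n + 1 = i + (n + 1 - i), each part lowers
    one index by k (u)_k / k! = (u + k - 1) (u)_(k-1) / (k-1)!, and the two factors add up to s + t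
    + n. *)
Lemma rising_vandermonde (F : numFieldType) n (s t : F) :
  \sum_(i < n.+1) rising i s * rising (n - i) t = rising n (s + t).
Proof.
elim: n => [|n IH].
  by rewrite big_ord1 !rising0 mulr1.
have rE k (u : F) : k.+1%:R * rising k.+1 u = (u + k%:R) * rising k u.
  by rewrite risingS mulrC -mulrA divfK ?pnatr_eq0// mulrC.
have n0 : (n.+1%:R : F) != 0 by rewrite pnatr_eq0.
apply: (mulfI n0); rewrite rE -IH !mulr_sumr.
have -> : \sum_(i < n.+2) n.+1%:R * (rising i s * rising (n.+1 - i) t) =
    \sum_(i < n.+2) i%:R * rising i s * rising (n.+1 - i) t +
    \sum_(i < n.+2) rising i s * ((n.+1 - i)%:R * rising (n.+1 - i) t).
  rewrite -big_split /=; apply: eq_bigr => i _.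
  have -> : n.+1%:R = i%:R + (n.+1 - i)%:R :> F.
    by rewrite -natrD subnKC// -ltnS.
  by ring.
rewrite big_ord_recl /= !mul0r add0r [X in _ + X]big_ord_recr /= subnn mul0r mulr0 addr0.
rewrite -big_split /=; apply: eq_bigr => i _.
have ni : (i <= n)%N by rewrite -ltnS.
rewrite /bump /= add1n subSS rE subSn// rE natrB//.
by ring.
Qed.

Lemma normc_rising k (s : R[i]) (T : R) : normc s <= T -> normc (rising k s) <= rising k T.
Proof.
move=> sT; elim: k => [|k IH]; first by rewrite !rising0 normc1.
rewrite !risingS normcM ler_pM ?normc_ge0// normcM normcV normc_nat.
rewrite ler_wpM2r ?invr_ge0//; apply: le_trans (le_normcD _ _) _.
by rewrite normc_nat lerD2r.
Qed.

(** The Taylor coefficients at [c] of the polynomial [rising k]. Built as iterated products of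
    linear factors, they inherit the bound rising k (|c| + r) on their norm. *)
Fixpoint rcoef (c : R[i]) (k : nat) : nat -> R[i] :=
  if k is k'.+1 then pmul (rcoef c k') (plin ((c + k'%:R) / k'.+1%:R) (k'.+1%:R)^-1)
  else plin 1 0.

Lemma rcoefP (c : R[i]) k (r : R) : 0 <= r ->
  [/\ pconv (rcoef c k) r, pnorm (rcoef c k) r <= rising k (normc c + r) &
      forall h, normc h <= r -> psum (rcoef c k) h = rising k (c + h)].
Proof.
move=> r0; elim: k => [|k [c1 n1 E1]] /=.
  have [c1 n1 E1] := plinP 1 0 r0; split => //.
    by rewrite rising0; apply: le_trans n1 _; rewrite normc0 normc1 mul0r addr0.
  by move=> h _; rewrite E1 rising0 mul0r addr0.
have [c2 n2 E2] := plinP ((c + k%:R) / k.+1%:R) (k.+1%:R)^-1 r0.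
have [c3 n3 E3] := pmulP r0 c1 c2; split => //.
  apply: le_trans n3 _; rewrite risingS ler_pM//.
  - by apply: nsum_ge0 => n _; exact: normcMX_ge0.
  - by apply: nsum_ge0 => n _; exact: normcMX_ge0.
  apply: le_trans n2 _; rewrite normcM !normcV normc_nat.
  rewrite [_^-1 * r]mulrC -mulrDl ler_wpM2r ?invr_ge0//.
  by have := le_normcD c k%:R; rewrite normc_nat; lra.
move=> h hr; rewrite E3// E1// E2 risingS; congr (_ * _).
by rewrite [c + h + _]addrAC [RHS]mulrDl [h * _]mulrC.
Qed.

Lemma rcoef_real k n : rcoef 0 k n \is Num.real.
Proof.
elim: k n => [|k IH] n /=.
  by case: n => [|[|n]] /=; rewrite ?rpred1 ?rpred0.
rewrite /pmul; apply: rpred_sum => i _; apply: rpredM; first exact: IH.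
case: (n - i)%N => [|[|m]] /=; rewrite ?rpred0// ?rpredV ?realn// add0r.
by rewrite rpred_div ?realn.
Qed.

End Rising.

(** * The binomial series of (1 - x)^(-s), as a function of s *)

Section BinomialSeries.
Context {R : realType}.
Implicit Types (s t h z : R[i]) (r T : R).

Lemma nsummable_rising T : 0 <= T ->
  nsummable setT (fun k : nat => rising k T * (2^-1) ^+ k).
Proof.
move=> T0; have [C [C0 HC]] := rising_bound T0.
have g : nsummable setT (fun k : nat => (3 / 4 : R) ^+ k) by apply: nsum_geometric; lra.
apply: le_nsummable (nsummableZ C0 _ g); last by move=> k _; rewrite exprn_ge0//; lra.
move=> k _; apply: le_trans (ler_wpM2r _ (HC k)) _; first by rewrite exprn_ge0// invr_ge0.
by rewrite -mulrA -exprMn (_ : 3 / 2 * 2^-1 = 3 / 4 :> R)//; lra.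
Qed.

Variable x : R.
Hypothesis x01 : 0 < x <= 2^-1.

Let x0 : 0 < x. Proof. by case/andP: x01. Qed.
Let x1 : x <= 2^-1. Proof. by case/andP: x01. Qed.

Lemma rising_xk_le k T : 0 <= T -> rising k T * x ^+ k <= rising k T * (2^-1) ^+ k.
Proof.
by move=> T0; rewrite ler_wpM2l ?rising_ge0// lerXn2r ?nnegrE ?invr_ge0// ltW.
Qed.

Lemma normc_xk k : normc (x%:C ^+ k : R[i]) = x ^+ k.
Proof. by rewrite normcX normcR ger0_norm// ltW. Qed.

Lemma csummable_rising s : csummable setT (fun k : nat => rising k s * x%:C ^+ k).
Proof.
apply: le_csummable (nsummable_rising (normc_ge0 s)) => k _.
apply: le_trans (rising_xk_le k (normc_ge0 s)); rewrite normcM normc_xk.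
by rewrite ler_wpM2r ?exprn_ge0 ?(ltW x0)// normc_rising.
Qed.

Let G s := csum setT (fun k : nat => rising k s * x%:C ^+ k).

Let a n : R[i] := csum setT (fun k : nat => rcoef 0 k n * x%:C ^+ k).

Let aP r : 0 < r -> pconv a r /\ forall z, normc z <= r -> psum a z = G z.
Proof.
move=> r0; have r0' := ltW r0.
have cE k (n : nat) : pmul (rcoef 0 k) (plin (x%:C ^+ k) 0) n = rcoef 0 k n * x%:C ^+ k.
  rewrite /pmul big_ord_recr /= subnn big1 ?add0r// => i _.
  by rewrite -[(n - i)%N]prednK ?subn_gt0//=; case: _.-1 => [|m]; rewrite mulr0.
have H k : [/\ pconv (fun n => rcoef 0 k n * x%:C ^+ k) r,
    pnorm (fun n => rcoef 0 k n * x%:C ^+ k) r <= rising k r * x ^+ k &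
    forall z, normc z <= r -> psum (fun n => rcoef 0 k n * x%:C ^+ k) z = rising k z * x%:C ^+ k].
  have [c1 n1 E1] := rcoefP 0 k r0'.
  have [c2 n2 E2] := plinP (x%:C ^+ k) 0 r0'.
  have [c3 n3 E3] := pmulP r0' c1 c2.
  have <- : pmul (rcoef 0 k) (plin (x%:C ^+ k) 0) = fun n => rcoef 0 k n * x%:C ^+ k.
    by apply/funext => n; rewrite cE.
  split => //.
    apply: le_trans n3 _; apply: ler_pM => //.
    - by apply: nsum_ge0 => n _; exact: normcMX_ge0.
    - by apply: nsum_ge0 => n _; exact: normcMX_ge0.
    - by move: n1; rewrite normc0 add0r.
    - by move: n2; rewrite normc_xk normc0 mul0r addr0.
  by move=> z zr; rewrite E3// E1// E2 add0r mul0r addr0.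
have cA k : pconv (fun n => rcoef 0 k n * x%:C ^+ k) r by case: (H k).
have [|c _ E] := psum_csum r0 cA.
  apply: le_nsummable (nsummable_rising r0') => k _; have [_ n1 _] := H k.
  exact: le_trans n1 (rising_xk_le k r0').
split => // z zr; have [_ ->] := E z zr.
by apply: eq_csum => k _; have [_ _ ->] := H k.
Qed.

Let ac r : 0 <= r -> pconv a r.
Proof.
move=> r0; apply: (le_pconv r0 (_ : r <= r + 1)); first by rewrite lerDl.
by have [] := aP (ltr_pwDr ltr01 r0).
Qed.

Let aG z : psum a z = G z.
Proof.
have [_] := aP (ltr_pwDr ltr01 (normc_ge0 z)); apply; by rewrite lerDl.
Qed.

Let GD s t : G (s + t) = G s * G t.
Proof.
have [s1 E1] := csum_prod (csummable_rising s) (csummable_rising t).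
have [_ _ E2] := csum_diag (F := fun i j => rising i s * x%:C ^+ i * (rising j t * x%:C ^+ j)) s1.
rewrite /G -E1 E2; apply: eq_csum => n _; rewrite -rising_vandermonde mulr_suml.
apply: eq_bigr => i _.
have -> : x%:C ^+ n = x%:C ^+ i * x%:C ^+ (n - i) :> R[i] by rewrite -exprD subnKC// -ltnS.
by rewrite mulrACA.
Qed.

Let G1 : G 1 = ((1 - x)^-1)%:C.
Proof.
have x1' : 0 < 1 - x by have := x1; lra.
apply: csum_limit; first exact: csummable_rising.
move=> e e0.
have cx : x ^+ n @[n --> \oo] --> 0.
  by apply: cvg_expr; rewrite ger0_norm ?(ltW x0)//; have := x1; lra.
have ex0 : 0 < e * (1 - x) by rewrite mulr_gt0.
have [N _ HN] := (cvgrPdist_lt _ _).1 cx _ ex0.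
exists N => n /HN /=; rewrite sub0r normrN ger0_norm ?exprn_ge0 ?(ltW x0)// => xn.
have -> : \sum_(0 <= k < n) rising k (1 : R[i]) * x%:C ^+ k = ((1 - x ^+ n) / (1 - x))%:C.
  elim: n {xn} => [|n IH]; first by rewrite big_geq// expr0 subrr mul0r.
  rewrite big_nat_recr//= IH rising1 mul1r -rmorphXn -rmorphD exprS /=; congr _%:C.
  by field; rewrite gt_eqF.
rewrite -rmorphB normcR.
have -> : (1 - x ^+ n) / (1 - x) - (1 - x)^-1 = - (x ^+ n / (1 - x)) by field; rewrite gt_eqF.
rewrite normrN ger0_norm ?divr_ge0 ?exprn_ge0 ?(ltW x0) ?(ltW x1')//.
by rewrite ltr_pdivrMr.
Qed.

Let a0 : a 0%N = 1.
Proof.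
have G0 : G 0 = 1.
  apply: csum_limit; first exact: csummable_rising.
  move=> e e0; exists 1%N => -[//|n] _; rewrite big_nat_recl// rising0 expr0 mulr1.
  rewrite big1 ?addr0 ?subrr ?normc0// => k _.
  by rewrite /rising big_ord_recl /= addr0 !mul0r.
by rewrite -G0 -aG psum0.
Qed.

(** The coefficients of h on both sides of G(t + h) = G(t) G(h) are compared, which gives G'(t) =
    a_1 G(t); then the coefficients of the powers of t are compared. *)
Let aS n : a n.+1 * n.+1%:R = a 1%N * a n.
Proof.
pose d m := a m.+1 * m.+1%:R.
have cd (r : R) : 0 < r -> pconv d r.
  (* Doubling the radius pays for the factor m + 1 of the derivative, as m + 1 <= 2^(m + 1). *)
  move=> r0; have r20 : 0 < 2 * r by rewrite mulr_gt0.
  have := pconvS r20 (ac (ltW r20)).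
  have s1 m : 0 <= normc (a m.+1) * (2 * r) ^+ m.
    by rewrite mulr_ge0 ?normc_ge0 ?exprn_ge0 ?(ltW r20).
  move=> /(nsummableZ (c := 2) (ler0n _ _) (fun m _ => s1 m)).
  apply: le_nsummable => m _; rewrite normcM normc_nat exprMn.
  rewrite mulrCA -[leLHS]mulrA ler_wpM2l ?normc_ge0// mulrA -exprS.
  by rewrite ler_wpM2r ?exprn_ge0 ?(ltW r0)// -natrX ler_nat ltnW// ltn_expl.
have c2 (r : R) : 0 < r -> pconv (fun m => a 1%N * a m) r.
  move=> r0; apply: le_nsummable (nsummableZ (c := normc (a 1%N)) _ _ (ac (ltW r0))).
  - by move=> m _; rewrite normcM mulrA.
  - exact: normc_ge0.
  - by move=> m _; rewrite normcMX_ge0// ltW.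
apply: (psum_inj ltr01 (lexx 1) (cd _ ltr01) (c2 _ ltr01)) => t _.
have tr : normc t < normc t + 1 by rewrite ltrDl.
have p1 : 0 <= normc t + 1 by rewrite addr_ge0 ?normc_ge0.
have [] := recenterP tr (ac p1); rewrite addrAC subrr add0r => cr Er.
have cG : pconv (fun m => G t * a m) 1.
  apply: le_nsummable (nsummableZ (c := normc (G t)) _ _ (ac ler01)).
  - by move=> m _; rewrite normcM mulrA.
  - exact: normc_ge0.
  - by move=> m _; rewrite normcMX_ge0.
have /(_ 1%N) : recenter a t =1 (fun m => G t * a m).
  apply: (psum_inj ltr01 (lexx 1) cr cG) => h h1; rewrite -Er// aG GD -(aG h) /psum -csumZ.
    by apply: eq_csum => m _; rewrite mulrA.
  exact: csummable_psum (ac (normc_ge0 h)) (lexx _).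
have -> : psum d t = recenter a t 1%N by apply: eq_csum => m _; rewrite /d add1n bin1.
move=> ->; rewrite mulrC -aG /psum -csumZ; last exact: csummable_psum (ac (normc_ge0 t)) (lexx _).
by apply: eq_csum => m _; rewrite mulrA.
Qed.

Let aE n : a n = a 1%N ^+ n / n`!%:R.
Proof.
elim: n => [|n IH]; first by rewrite a0 expr0 divr1.
have n0 : (n.+1%:R : R[i]) != 0 by rewrite pnatr_eq0.
apply: (mulIf n0); rewrite aS IH factS natrM exprS.
by field; rewrite nat1r n0 pnatr_eq0 -lt0n fact_gt0.
Qed.

(** As a function of s the left side is an entire series G with G(s + t) = G(s) G(t) by Vandermonde,
    hence G(s) = exp(a_1 s). The geometric series gives G(1) = 1 / (1 - x), which determines a_1. *)
Lemma binomial_series s :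
  csum setT (fun k : nat => rising k s * x%:C ^+ k) = cpow (1 - x) (- s).
Proof.
have x1' : 0 < 1 - x by have := x1; lra.
have GE z : G z = cexp (a 1%N * z).
  rewrite -aG -csum_exp; apply: eq_csum => n _.
  by rewrite aE exprMn mulrAC.
(* G(1) gives exp(a_1), hence a_1 only up to multiples of 2 pi i; that a_1 is real removes the
   ambiguity. *)
have a1E : a 1%N = (complex.Re (a 1%N))%:C.
  have rE k : rcoef 0 k 1 * x%:C ^+ k = (complex.Re (rcoef 0 k 1) * x ^+ k)%:C :> R[i].
    by rewrite rmorphM rmorphXn /= RRe_real// rcoef_real.
  by rewrite /a (eq_csum (fun k _ => rE k)) /csum /rsum /= oppr0 subrr.
have L : complex.Re (a 1%N) = - ln (1 - x).
  have := G1; rewrite GE mulr1 a1E /cexp /= cos0 sin0 mulr1 => -[].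
  by move=> /(congr1 (@ln R)); rewrite expRK lnV ?posrE.
by rewrite -/(G s) GE a1E L cpowE// rmorphN !mulNr mulrC.
Qed.

End BinomialSeries.

(** * Continuation of the alternating zeta function *)

Section EtaContinuation.
Context {R : realType}.
Implicit Types (s h z : R[i]) (c r : R).

Lemma nsummable_inj (I J : choiceType) (e : I -> J) (g : J -> R) :
  injective e -> (forall j, 0 <= g j) -> nsummable setT g -> nsummable setT (g \o e).
Proof.
move=> ei g0 sg; apply: (nsum_le (M := nsum setT g) _ _).1; first by move=> i _; exact: g0.
move=> r ur _.
have -> : \sum_(i <- r) (g \o e) i = \sum_(j <- map e r) g j by rewrite big_map.
apply: nsum_ge_seq => //.
by rewrite map_inj_uniq.
Qed.

Lemma nsum_inv_sqr :
  nsummable setT (fun n : nat => (n.+2%:R : R) `^ (- 2)) /\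
  nsum setT (fun n : nat => (n.+2%:R : R) `^ (- 2)) <= 1.
Proof.
apply: nsum_nat_le; first by move=> n; exact: powR_ge0.
(* Telescoping: 1 / (n + 2)^2 <= 1 / (n + 1) - 1 / (n + 2). *)
move=> n; apply: (@le_trans _ _ (1 - (n.+1%:R)^-1)); last by rewrite gerBl invr_ge0.
elim: n => [|n IH]; first by rewrite big_geq// invr1 subrr.
rewrite big_nat_recr//=; apply: le_trans (lerD IH (lexx _)) _.
rewrite powR_invn// -!(natr1 n.+1) -natr1.
have n0 : (0 : R) <= n%:R by [].
rewrite -subr_ge0.
have -> : 1 - (n%:R + 1 + 1)^-1 - (1 - (n%:R + 1)^-1 + ((n%:R + 1 + 1) ^+ 2)^-1) =
   ((n%:R + 1) * (n%:R + 1 + 1) ^+ 2)^-1 :> R.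
  by field; rewrite !gt_eqF//; lra.
by rewrite invr_ge0 mulr_ge0 ?exprn_ge0//; lra.
Qed.

Lemma powRN_bound n (x : R) : 2 <= x ->
  (n.+2%:R : R) `^ (- x) <= 2 `^ (2 - x) * n.+2%:R `^ (- 2).
Proof.
move=> x2; have p : (0 : R) < n.+2%:R by rewrite ltr0n.
have E : - x = (2 - x) + - 2 by ring.
rewrite [X in _ `^ X <= _]E.
rewrite [leLHS]powRD; last by rewrite (gt_eqF p) implybT.
rewrite ler_wpM2r ?powR_ge0//.
have -> : 2 - x = - (x - 2) by ring.
rewrite !powRN lef_pV2 ?posrE ?powR_gt0//.
by apply: ge0_ler_powR; rewrite ?nnegrE ?subr_ge0// ler_nat.
Qed.

(** The decay in x like 2^(-x) matters more than finiteness: it will beat the growth of [rising] in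
    the series over k of the functional equation. *)
Lemma nsum_powRN (x : R) : 2 <= x ->
  nsummable setT (fun n : nat => (n.+2%:R : R) `^ (- x)) /\
  nsum setT (fun n : nat => (n.+2%:R : R) `^ (- x)) <= 2 `^ (2 - x).
Proof.
move=> x2; have [s S] := nsum_inv_sqr.
have p0 n : setT n -> 0 <= (n.+2%:R : R) `^ (- 2) by move=> _; exact: powR_ge0.
have sZ := nsummableZ (powR_ge0 2 (2 - x)) p0 s.
split; first by apply: le_nsummable sZ => n _; exact: powRN_bound.
apply: le_trans (le_nsum _ (fun n _ => powRN_bound n x2) sZ) _.
  by move=> n _; exact: powR_ge0.
by rewrite nsumZ ?powR_ge0// ler_piMr ?powR_ge0.
Qed.

Lemma csummable_npow s : 2 <= complex.Re s ->
  csummable setT (fun n : nat => cpow (n.+2%:R : R) (- s)).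
Proof.
move=> s2; apply: le_csummable (nsum_powRN s2).1 => n _.
by rewrite normc_cpow ReN.
Qed.

(* theta s = 2^-s - 3^-s + 4^-s - ..., that is 1 - (1 - 2^(1-s)) zeta s. *)
Definition theta s : R[i] := csum setT (fun n : nat => (-1) ^+ n * cpow (n.+2%:R : R) (- s)).

Lemma normc_sign n : normc ((-1) ^+ n : R[i]) = 1.
Proof. by rewrite normcX normcN normc1 expr1n. Qed.

Lemma csummable_theta s : 2 <= complex.Re s ->
  csummable setT (fun n : nat => (-1) ^+ n * cpow (n.+2%:R : R) (- s)).
Proof.
by move=> /csummable_npow; apply: le_nsummable => n _; rewrite normcM normc_sign mul1r.
Qed.

(** Each (n+2)^(-c-h) is (n+2)^(-c) times the exponential series of -h ln(n+2), whose weighted norm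
    is at most (n+2)^(-c+r); these norms are summable because c - r >= 2. *)
Lemma theta_base c r : 0 < r -> 2 <= c - r ->
  exists a, [/\ pconv a r, pnorm a r <= 2 `^ (2 - (c - r)) &
    forall h, normc h <= r -> theta (c%:C + h) = psum a h].
Proof.
move=> r0 cr; have r0' := ltW r0.
pose A (n m : nat) : R[i] :=
  (-1) ^+ n * cpow (n.+2%:R : R) (- c%:C) * ((- (ln (n.+2%:R : R)))%:C ^+ m / m`!%:R).
have p n : (0 : R) < n.+2%:R by rewrite ltr0n.
have l0 n : (0 : R) <= ln n.+2%:R by rewrite ln_ge0// ler1n.
have AE n m : normc (A n m) * r ^+ m =
    n.+2%:R `^ (- c) * ((ln n.+2%:R * r) ^+ m / m`!%:R).
  rewrite /A normcM (normcM ((-1) ^+ n)) normc_sign mul1r normc_cpow normcM normcX normcR normrN ger0_norm//.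
  by rewrite normc_fact_inv exprMn /=; ring.
have e0 n m : setT m -> 0 <= (ln n.+2%:R * r) ^+ m / m`!%:R.
  by move=> _; rewrite divr_ge0// exprn_ge0// mulr_ge0.
have es n := nsum_exp (mulr_ge0 (l0 n) r0').
have cA n : pconv (A n) r.
  apply: le_nsummable (nsummableZ (powR_ge0 n.+2%:R (- c)) (e0 n) (es n).1) => m _.
  by rewrite AE.
have nA n : pnorm (A n) r <= n.+2%:R `^ (- (c - r)).
  rewrite /pnorm (eq_nsum (fun m _ => AE n m)) nsumZ ?powR_ge0//; [|exact: e0|exact: (es n).1].
  apply: le_trans (ler_wpM2l (powR_ge0 _ _) (es n).2) _.
  by rewrite /powR gt_eqF// -expRD ler_expR; lra.
have [s S] := nsum_powRN cr.
have sA : nsummable setT (fun n => pnorm (A n) r).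
  by apply: le_nsummable s => n _.
have [cb nb Eb] := psum_csum r0 cA sA.
exists (fun m => csum setT (fun n => A n m)); split => //.
  apply: le_trans nb (le_trans (le_nsum _ (fun n _ => nA n) s) S) => n _.
  by apply: nsum_ge0 => m _; exact: normcMX_ge0.
move=> h hr; have [_ ->] := Eb h hr; apply: eq_csum => n _.
rewrite opprD cpowD// mulrA [cpow _ (- h)]cpowE// -csum_exp /psum -csumZ.
  apply: eq_csum => m _; rewrite /A; move: (cpow _ (- c%:C)) => C.
  rewrite -!mulrA; congr (_ * (_ * _)).
    by rewrite [_^-1 * _]mulrC mulrA -exprMn rmorphN !mulNr [h * _]mulrC.
exact: csummable_exp.
Qed.

(** Write (n+1)^(-s) = (n+2)^(-s) (1 - 1/(n+2))^(-s) and expand by the binomial series. Summed by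
    rows, the double family gives the alternating sum of the (n+1)^(-s), which is 1 - theta(s); by
    columns, it gives the sum of the rising k s theta(s + k) over k >= 0, whose term k = 0 is
    another theta(s). *)
Lemma theta_feq s : 2 <= complex.Re s ->
  csummable setT (fun k : nat => rising k.+1 s * theta (s + k.+1%:R)) /\
  2 * theta s = 1 - csum setT (fun k : nat => rising k.+1 s * theta (s + k.+1%:R)).
Proof.
move=> s2.
have p n : (0 : R) < n.+2%:R by rewrite ltr0n.
pose F (n k : nat) : R[i] := (-1) ^+ n * cpow (n.+2%:R : R) (- s) *
  (rising k s * (n.+2%:R^-1)%:C ^+ k).
have x2 n : 0 < (n.+2%:R : R)^-1 <= 2^-1 by rewrite invr_gt0 p lef_pV2 ?posrE// ler_nat.
have rows n : csummable setT (F n) by apply: csummableZ; exact: csummable_rising.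
have eT : [set: nat * nat] = setT `*`` (fun=> setT) by apply/seteqP; split.
have sF : csummable setT (fun k : nat * nat => F k.1 k.2).
  rewrite eT; apply: (@csummable_pair _ _ _ _ _ F
    (fun n => nsum setT (fun k : nat => rising k (normc s) * (2^-1) ^+ k) *
              (n.+2%:R : R) `^ (- complex.Re s))).
  - by move=> n _; exact: rows.
  - move=> n _; rewrite mulrC -nsumZ ?powR_ge0//; last 2 first.
    + by move=> k _; rewrite mulr_ge0 ?rising_ge0 ?normc_ge0// exprn_ge0// invr_ge0.
    + exact: nsummable_rising (normc_ge0 s).
    apply: le_nsum; first by move=> *; exact: normc_ge0.
      move=> k _; rewrite /F normcM (normcM ((-1) ^+ n)) normc_sign mul1r normc_cpow normcM ReN.
      rewrite ler_wpM2l ?powR_ge0// ; apply: le_trans (rising_xk_le (x2 n) k (normc_ge0 s)).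
      rewrite (normc_xk (x2 n)) ler_wpM2r ?normc_rising// exprn_ge0// invr_ge0//.
    apply: nsummableZ; rewrite ?powR_ge0//.
      by move=> k _; rewrite mulr_ge0 ?rising_ge0 ?normc_ge0// exprn_ge0// invr_ge0.
    exact: nsummable_rising (normc_ge0 s).
  - apply: nsummableZ; last exact: (nsum_powRN s2).1.
      apply: nsum_ge0 => k _.
      by rewrite mulr_ge0 ?rising_ge0 ?normc_ge0// exprn_ge0// invr_ge0.
    by move=> *; exact: powR_ge0.
have rowE n : csum setT (F n) = (-1) ^+ n * cpow (n.+1%:R : R) (- s).
  rewrite csumZ; last exact: csummable_rising.
  rewrite binomial_series// -mulrA -cpowM//; last by have /andP[_] := x2 n; move: _^-1 => y; lra.
  congr (_ * cpow _ _); rewrite mulrBr mulr1 divff ?gt_eqF//.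
  by rewrite -natr1 addrK.
have colE k : csum setT (fun n => F n k) = rising k s * theta (s + k%:R).
  have sk : 2 <= complex.Re (s + k%:R).
    rewrite ReD -(rmorph_nat (real_complex R)) /=.
    by have : (0 : R) <= k%:R by []; move: s2; lra.
  rewrite /theta -csumZ; last exact: csummable_theta.
  apply: eq_csum => n _; rewrite /F opprD cpowD// (cpowN k%:R)// cpow_nat//.
  rewrite -fmorphV -exprVn rmorphXn /=.
  by move: (cpow _ (- s)) (rising k s) => u v; ring.
have sG : csummable setT (fun k : nat * nat => F k.2 k.1).
  have sb : set_bij [set: nat * nat] [set: nat * nat] (fun k => (k.2, k.1)).
    split => //; first by move=> [x y] [u v] _ _ /= [-> ->].
    by move=> [x y] _; exists (y, x).
  by have /(csum_bij (fun k : nat * nat => F k.1 k.2) sb).1 := sF.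
have sK : csummable setT (fun k : nat => rising k s * theta (s + k%:R)).
  move: sG; rewrite eT => /(@csum_pair _ _ _ _ _ (fun k n => F n k))[_ + _].
  by apply: eq_csummable => k _; rewrite colE.
have sK1 : csummable setT (fun k : nat => rising k.+1 s * theta (s + k.+1%:R)).
  by apply: (nsummable_inj succn_inj _ sK) => k; exact: normc_ge0.
split => //.
have := csum_exchange sF.
rewrite (eq_csum (fun n _ => rowE n)) (eq_csum (fun k _ => colE k)).
rewrite (csum_nat_recl sK) rising0 mul1r addr0.
rewrite csum_nat_recl; last first.
  have := csum_pair (I := nat) (J := nat) (A := setT) (B := fun=> setT) (f := F).
  rewrite -eT => /(_ sF)[_ + _]; apply: eq_csummable => n _; exact: rowE.
rewrite expr0 mul1r cpow1.
rewrite (_ : csum setT (fun n : nat => (-1) ^+ n.+1 * cpow (n.+2%:R : R) (- s)) = - theta s).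
  move=> E; have -> : csum setT (fun k : nat => rising k.+1 s * theta (s + k.+1%:R)) =
     1 - theta s - theta s by rewrite E; ring.
  by ring.
by rewrite /theta -csumN; apply: eq_csum => n _; rewrite exprS mulN1r mulNr.
Qed.

End EtaContinuation.

(** * Theta and the alternating zeta function as entire series *)

Section EntireEta.
Context {R : realType}.
Implicit Types (s h z : R[i]) (c r rho : R).

Lemma Re_normc_ge s : - normc s <= complex.Re s.
Proof. by rewrite lerNl (le_trans _ (Re_le_normc s))// -normrN ler_norm. Qed.

(** Two radii are needed: the series converges on radius [r], possibly far to the left of the domain
    of the defining sum, but is compared with [theta] only on radius [rho], inside that domain. The
    number [m] counts the uses of the functional equation; each moves the centre to the right by at
    least 1, and so gains one unit for [r]. *)
Lemma theta_disc (m : nat) r rho c : 0 < rho -> rho <= r -> 5 / 2 <= c - rho ->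
  2 - m%:R <= c - r ->
  exists a, pconv a r /\ forall h, normc h <= rho -> theta (c%:C + h) = psum a h.
Proof.
elim: m r rho c => [|m IH] r rho c rho0 rr crho crm.
  have [|a [ca _ Ea]] := theta_base (lt_le_trans rho0 rr) (_ : 2 <= c - r).
    by move: crm; rewrite subr0.
  by exists a; split => // h hr; apply: Ea; exact: le_trans hr rr.
have r0 := lt_le_trans rho0 rr; have r0' := ltW r0.
have c0 : 0 <= c by lra.
pose cc (k : nat) := c + k.+1%:R.
have kp k : (1 : R) <= k.+1%:R by rewrite ler1n.
have ex k : exists a, [/\ pconv a r,
    forall h, normc h <= rho -> theta ((cc k)%:C + h) = psum a h &
    2 <= cc k - r -> pnorm a r <= 2 `^ (2 - (cc k - r))].
  have [big|small] := leP 2 (cc k - r).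
    have [a [ca na Ea]] := theta_base r0 big; exists a; split => // h hr.
    by apply: Ea; exact: le_trans hr rr.
  have [||a [ca Ea]] := IH r rho (cc k) rho0 rr.
  - by have := kp k; rewrite /cc; lra.
  - by have := kp k; move: crm; rewrite /cc -natr1; lra.
  exists a; split => //; rewrite leNgt => /negP; by rewrite small.
have [a_ Ha] := choice ex.
(* For k >= K the series comes from [theta_base], with norm decaying like 2^(-k). The finitely many
   others come from the induction, without control of their norm, and are absorbed into M. *)
have [M [M0 HM]] : exists M : R, 0 <= M /\ forall k, pnorm (a_ k) r <= M * (2^-1) ^+ k.+1.
  pose K := Num.bound `|2 - c + r|.
  have p0 k : 0 <= pnorm (a_ k) r by apply: nsum_ge0 => n _; exact: normcMX_ge0.
  have q0 k : (0 : R) < 2 ^+ k by rewrite exprn_gt0.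
  have s0 (D : pred 'I_K) : 0 <= \sum_(j < K | D j) pnorm (a_ j) r * 2 ^+ j.+1.
    by apply: sumr_ge0 => j _; rewrite mulr_ge0// ltW.
  exists (2 `^ (2 - c + r) + \sum_(j < K) pnorm (a_ j) r * 2 ^+ j.+1); split.
    by rewrite addr_ge0 ?powR_ge0.
  move=> k; rewrite exprVn ler_pdivlMr//.
  have [kK|Kk] := ltnP k K.
    by rewrite (bigD1 (Ordinal kK)) //= addrCA lerDl addr_ge0 ?powR_ge0.
  have [_ _ big] := Ha k.
  have : 2 - c + r <= k%:R.
    apply: le_trans (ler_norm _) (le_trans (ltW (archi_boundP (normr_ge0 _))) _).
    by rewrite ler_nat.
  move=> ck; have /big le : 2 <= cc k - r by rewrite /cc -natr1; lra.
  apply: le_trans (ler_wpM2r (ltW (q0 _)) le) _.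
  rewrite -powR_mulrn// -powRD; last by rewrite pnatr_eq0 implybT.
  by rewrite (_ : 2 - (cc k - r) + k.+1%:R = 2 - c + r) ?lerDl ?s0//; rewrite /cc; ring.
have T0 : 0 <= c + r by rewrite addr_ge0.
pose T (k : nat) := pmul (rcoef c%:C k.+1) (a_ k).
have TP k : [/\ pconv (T k) r, pnorm (T k) r <= M * (rising k.+1 (c + r) * (2^-1) ^+ k.+1) &
    forall h, normc h <= rho -> psum (T k) h =
      rising k.+1 (c%:C + h) * theta (c%:C + h + k.+1%:R)].
  have [ca Ea _] := Ha k; have [cr nr Er] := rcoefP c%:C k.+1 r0'.
  have [cT nT ET] := pmulP r0' cr ca; split => //.
    apply: le_trans nT _; rewrite mulrCA; apply: ler_pM (HM k).
    - by apply: nsum_ge0 => n _; exact: normcMX_ge0.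
    - by apply: nsum_ge0 => n _; exact: normcMX_ge0.
    - by move: nr; rewrite normcR ger0_norm.
  move=> h hr; have hr' := le_trans hr rr.
  rewrite ET// Er// -Ea//; congr (_ * theta _).
  by rewrite /cc rmorphD rmorph_nat addrAC.
have sT : nsummable setT (fun k => pnorm (T k) r).
  have := nsummable_inj succn_inj _ (nsummable_rising T0).
  have g0 k : 0 <= rising k (c + r) * (2^-1) ^+ k.
    by rewrite mulr_ge0 ?rising_ge0// exprn_ge0// invr_ge0.
  move=> /(_ g0)/(nsummableZ M0)/=/(_ (fun k _ => g0 k.+1)).
  by apply: le_nsummable => k _; have [] := TP k.
have cT k : pconv (T k) r by have [] := TP k.
have [cb _ Eb] := psum_csum r0 cT sT.
pose b n := csum setT (fun k => T k n).
have [cl _ El] := plinP (1 : R[i]) 0 r0'.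
have cd := pconvB r0' cl cb.
exists (fun n => 2^-1 * (plin 1 0 n - b n)); split.
  have g0 n : setT n -> 0 <= normc (plin 1 0 n - b n) * r ^+ n.
    by move=> _; exact: (normcMX_ge0 (fun n => plin 1 0 n - b n)).
  apply: le_nsummable (nsummableZ (normc_ge0 (2^-1 : R[i])) g0 cd) => n _.
  by rewrite normcM mulrA.
move=> h hr; have hr' := le_trans hr rr.
have s2 : 2 <= complex.Re (c%:C + h).
  by rewrite ReD /=; have := Re_normc_ge h; lra.
have [_ F] := theta_feq s2.
rewrite /psum; under eq_csum do rewrite -mulrA.
rewrite csumZ; last exact: csummable_psum cd hr'.
rewrite -/(psum (fun n => plin 1 0 n - b n) h) (psumB cl cb hr') El mul0r addr0.
have [_ ->] := Eb h hr'.
have -> : csum setT (fun k => psum (T k) h) =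
    csum setT (fun k : nat => rising k.+1 (c%:C + h) * theta (c%:C + h + k.+1%:R)).
  by apply: eq_csum => k _; have [_ _ ->] := TP k.
by rewrite -F mulKf// pnatr_eq0.
Qed.

(** The series that [theta_disc] provides for different radii represent the same function on the
    disc of radius [rho], so by uniqueness of coefficients they are equal, and one of them converges
    on every disc. *)
Lemma theta_entire_at rho c : 0 < rho -> 5 / 2 <= c - rho ->
  exists a, (forall r, 0 <= r -> pconv a r) /\
    forall h, normc h <= rho -> theta (c%:C + h) = psum a h.
Proof.
move=> rho0 crho.
have ex (n : nat) : exists a, pconv a (rho + n%:R) /\
    forall h, normc h <= rho -> theta (c%:C + h) = psum a h.
  apply: (@theta_disc n) => //; first by rewrite lerDl.
  by have : (0 : R) <= n%:R by []; lra.
have [a_ Ha] := choice ex.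
exists (a_ 0%N); split; last by have [] := Ha 0%N.
move=> r r0; have [c0 E0] := Ha 0%N; rewrite addr0 in c0.
have [cn En] := Ha (Num.bound r).
have -> : a_ 0%N = a_ (Num.bound r).
  apply/funext; apply: (psum_inj rho0 (lexx rho) c0).
    by apply: le_pconv cn; [exact: ltW|rewrite lerDl].
  by move=> z zr; rewrite -E0// En.
apply: le_pconv cn => //; have := archi_boundP r0.
by move: rho0; move: (Num.bound r)%:R => y; lra.
Qed.

(** Discs with real centre c that touch the line Re s = 5/2 from the right exhaust the half-plane.
    The entire series at such a c, recentred at 3, agrees with the series at 3 on a small disc,
    hence has the same coefficients. *)
Lemma theta_entire : exists a : nat -> R[i], (forall r, 0 <= r -> pconv a r) /\
  forall s, 5 / 2 < complex.Re s -> theta s = psum a (s - 3).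
Proof.
have [||a [ca Ea]] := @theta_entire_at (2^-1) 3; [by rewrite invr_gt0|lra|].
exists a; split => // s s52.
(* The condition |s - c| <= c - 5/2 means |s|^2 <= c d + 25/4, and this [c] makes c d equal to 3 d +
   |s|^2. *)
pose d := 2 * complex.Re s - 5; have d0 : 0 < d by rewrite /d; lra.
pose c := 3 + normc s ^+ 2 / d.
have q0 : 0 <= normc s ^+ 2 / d by rewrite divr_ge0 ?exprn_ge0 ?normc_ge0// ltW.
have c3 : 3 <= c by rewrite lerDl.
have [||b [cb Eb]] := @theta_entire_at (c - 5 / 2) c; [lra|lra|].
pose p : R[i] := 3 - c%:C.
have np : normc p = c - 3.
  rewrite /p -(rmorph_nat (real_complex R)) -rmorphB normcR distrC ger0_norm//.
  by rewrite subr_ge0.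
have R0 : normc p < normc p + (normc (s - 3) + 1).
  by rewrite ltrDl ltr_wpDl ?normc_ge0.
have RR : 0 <= normc p + (normc (s - 3) + 1).
  by rewrite !addr_ge0 ?normc_ge0.
have [] := recenterP R0 (cb _ RR); rewrite addrAC subrr add0r => cr Er.
have sc : normc (s - c%:C) <= c - 5 / 2.
  rewrite -(ger0_norm (_ : 0 <= c - 5 / 2)) -?sqrtr_sqr; last by lra.
  have E : normc s ^+ 2 = complex.Re s ^+ 2 + complex.Im s ^+ 2.
    by case: (s) => u v /=; rewrite sqr_sqrtr ?addr_ge0 ?sqr_ge0.
  have cd : normc s ^+ 2 = (c - 3) * d by rewrite /c addrAC subrr add0r divfK// gt_eqF.
  move: E cd s52; rewrite /d; case: (s) => u v /= -> cd u52.
  rewrite ler_wsqrtr// oppr0 addr0.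
  suff: u ^+ 2 + v ^+ 2 <= c * (2 * u - 5) + 25 / 4 by nra.
  by rewrite cd; lra.
have -> : theta s = psum b (s - c%:C).
  by rewrite -Eb//; congr theta; ring.
have -> : s - c%:C = p + (s - 3) by rewrite /p; ring.
rewrite Er; last by rewrite lerDl.
have c1 : pconv (recenter b p) (2^-1).
  apply: le_pconv cr; first by rewrite invr_ge0.
  by have := normc_ge0 (s - 3); lra.
apply: eq_psum; apply: (psum_inj (e := 2^-1) _ (lexx _) c1); first by rewrite invr_gt0.
  by apply: ca; rewrite invr_ge0.
move=> h hr; have h1 : normc h <= normc (s - 3) + 1.
  by have := normc_ge0 (s - 3); lra.
rewrite -Er// -Ea// -Eb.
  by congr theta; rewrite rmorph_nat /p; ring.
apply: le_trans (le_normcD _ _) _; rewrite np; lra.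
Qed.

Lemma zeta_csum s : 2 <= complex.Re s ->
  csummable setT (fun n : nat => cpow (n.+1%:R : R) (- s)) /\
  zeta s = csum setT (fun n : nat => cpow (n.+1%:R : R) (- s)).
Proof.
move=> s2; have c2 := csummable_npow s2.
have c1 : csummable setT (fun n : nat => cpow (n.+1%:R : R) (- s)).
  apply: (nsum_nat_le (M := 1 + nsum setT (fun n : nat => normc (cpow (n.+2%:R : R) (- s)))) _ _).1.
    by move=> *; exact: normc_ge0.
  move=> [|n]; first by rewrite big_geq// addr_ge0// nsum_ge0// => *; exact: normc_ge0.
  rewrite big_nat_recl// cpow1 normc1 lerD2l; apply: nsum_ge_seq => //.
  - by move=> *; exact: normc_ge0.
  - exact: iota_uniq.
split => //; apply: limn_normc => e e0.
have [//|N HN] := csum_cvg_nat (a := 0) c1 _ e0.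
exists N.+1 => -[//|n]; rewrite ltnS => /HN.
by rewrite big_add1.
Qed.

Lemma zeta_eta s : 2 <= complex.Re s -> (1 - 2 * cpow 2 (- s)) * zeta s = 1 - theta s.
Proof.
move=> s2; have [c1 ->] := zeta_csum s2.
have ct := csummable_theta s2.
pose f n : R[i] := (-1) ^+ n * cpow (n.+1%:R : R) (- s).
have cf : csummable setT f by apply: le_nsummable c1 => n _; rewrite normcM normc_sign mul1r.
have -> : 1 - theta s = csum setT f.
  rewrite csum_nat_recl// /f expr0 mul1r cpow1; congr (_ + _).
  by rewrite -csumN; apply: eq_csum => n _; rewrite exprS mulN1r mulNr.
(* Indices are shifted by one: odd n = 2m + 1 stands for the even integer n + 1 = 2 (m + 1), the one
   with a minus sign in [f]. *)
have sb : set_bij [set: nat] [set n | odd n] (fun m => m.*2.+1).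
  split => //; first by move=> n _ /=; rewrite odd_double.
    by move=> n m _ _ [] /double_inj.
  move=> n /= on; exists n./2 => //; rewrite -[RHS]odd_double_half on add1n//.
have codd : csummable [set n | odd n] (fun n : nat => cpow (n.+1%:R : R) (- s)).
  by apply: csummableS c1.
have E : csum [set n | odd n] (fun n : nat => cpow (n.+1%:R : R) (- s)) =
    cpow 2 (- s) * csum setT (fun n : nat => cpow (n.+1%:R : R) (- s)).
  rewrite (csum_bij _ sb).2 -csumZ//; apply: eq_csum => m _ /=.
  by rewrite -doubleS -mul2n natrM cpowM.
rewrite mulrBl mul1r -mulrA -E (csumID [set n | odd n] c1) (csumID [set n | odd n] cf) !setTI.
have -> : csum [set n | odd n] f = - csum [set n | odd n] (fun n : nat => cpow (n.+1%:R : R) (- s)).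
  by rewrite -csumN; apply: eq_csum => n /= on; rewrite /f -signr_odd on expr1 mulN1r.
have -> : csum (~` [set n | odd n]) f = csum (~` [set n | odd n]) (fun n : nat => cpow (n.+1%:R : R) (- s)).
  by apply: eq_csum => n /= /negP on; rewrite /f -signr_odd (negbTE on) expr0 mul1r.
by ring.
Qed.

(** The terms after the first add up to at most 2^(2 - Re s) < 1 in modulus. *)
Lemma zeta_neq0 s : 3 <= complex.Re s -> zeta s != 0.
Proof.
move=> s3; have s2 : 2 <= complex.Re s by lra.
have [c1 ->] := zeta_csum s2; rewrite csum_nat_recl// cpow1.
set t := csum _ _.
have : normc t < 1.
  apply: le_lt_trans (normc_csum (csummable_npow s2)) _.
  under eq_nsum do rewrite normc_cpow ReN.
  apply: le_lt_trans (nsum_powRN s2).2 _.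
  rewrite -[ltRHS](powRr0 2) /powR gt_eqF// ltr_expR ltr_pM2r ?ln_gt0 ?ltr1n//; lra.
move=> t1; apply/negP => /eqP t0; move: t1.
have -> : t = -1 by apply/eqP; rewrite -addr_eq0 addrC t0.
by rewrite normcN normc1 ltxx.
Qed.

Lemma eta_entire : exists e : nat -> R[i], (forall r, 0 <= r -> pconv e r) /\
  forall s, 5 / 2 < complex.Re s -> psum e (s - 3) = (1 - 2 * cpow 2 (- s)) * zeta s.
Proof.
have [a [ca Ea]] := theta_entire.
have cl r : 0 <= r -> pconv (plin (1 : R[i]) 0) r by move=> r0; have [] := plinP (1 : R[i]) 0 r0.
exists (fun n => plin 1 0 n - a n); split.
  by move=> r r0; apply: pconvB => //; [exact: cl|exact: ca].
move=> s s52; rewrite zeta_eta; last by lra.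
have n0 := normc_ge0 (s - 3).
rewrite (psumB (cl _ n0) (ca _ n0) (lexx _)) -Ea//.
by have [_ _ ->] := plinP (1 : R[i]) 0 n0; rewrite mul0r addr0.
Qed.

Lemma two_cpow_neq1 s : 3 <= complex.Re s -> 1 - 2 * cpow 2 (- s) != 0.
Proof.
move=> s3; rewrite subr_eq0; apply/eqP => /(congr1 (@normc R)).
rewrite normc1 normcM normc_nat normc_cpow ReN.
have := ler_powR (ler1n R 2) (_ : - complex.Re s <= - 3).
rewrite lerN2 => /(_ s3); rewrite powR_invn//.
by move: (2 `^ _) => y; lra.
Qed.

End EntireEta.

(** * Meromorphic functions *)

Section MeromorphicCalculus.
Context {R : realType}.
Implicit Types (f g : R[i] -> R[i]) (p z s : R[i]).

Lemma holomorphicM f g p :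
  holomorphic_at f p -> holomorphic_at g p -> holomorphic_at (fun z => f z * g z) p.
Proof. by apply: filterS2 => z df dg; exact: derivableM df dg. Qed.

Lemma holomorphicB f g p :
  holomorphic_at f p -> holomorphic_at g p -> holomorphic_at (fun z => f z - g z) p.
Proof. by apply: filterS2 => z df dg; exact: derivableB df dg. Qed.

Lemma holomorphic_cst (c : R[i]) p : holomorphic_at (fun=> c) p.
Proof. by apply: (nbhs_normc ltr01) => z _; exact: derivable_cst. Qed.

Lemma holomorphic_subX n p q : holomorphic_at (fun z => (z - q) ^+ n) p.
Proof.
elim: n => [|n IH]; first exact: (holomorphic_cst 1).
have -> : (fun z => (z - q) ^+ n.+1) = (fun z => (z - q) * (z - q) ^+ n).
  by apply/funext => z; rewrite exprS.
apply: (@holomorphicM (fun z => z - q) (fun z => (z - q) ^+ n)); last exact: IH.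
apply: (@holomorphicB id (fun=> q)); last exact: holomorphic_cst.
by apply: (nbhs_normc ltr01) => z _; exact: derivable_id.
Qed.

Lemma holomorphicV f p (r : R) : 0 < r -> holomorphic_at f p ->
  (forall z, normc (z - p) < r -> f z != 0) -> holomorphic_at (fun z => (f z)^-1) p.
Proof.
move=> r0 hf f0; have n0 : \forall z \near p, f z != 0 by exact: nbhs_normc r0 f0.
by rewrite /holomorphic_at in hf *; apply: filterS2 hf n0 => z df fz; exact: derivableV fz df.
Qed.

Lemma meromorphic_holomorphic f p : holomorphic_at f p -> meromorphic_at f p.
Proof.
move=> hf; exists 0%N, f; split => //.
by apply: (dnbhs_normc ltr01) => z _ _; rewrite expr0 divr1.
Qed.

Lemma meromorphicM f g p :
  meromorphic_at f p -> meromorphic_at g p -> meromorphic_at (fun z => f z * g z) p.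
Proof.
move=> [n [f1 [hf Ef]]] [m [g1 [hg Eg]]].
exists (n + m)%N, (fun z => f1 z * g1 z); split; first exact: holomorphicM.
apply: filterS2 Ef Eg => z -> ->.
by rewrite exprD invfM mulrACA.
Qed.

Lemma meromorphic_cstB (c : R[i]) f p :
  meromorphic_at f p -> meromorphic_at (fun z => c - f z) p.
Proof.
move=> [n [f1 [hf Ef]]]; exists n, (fun z => c * (z - p) ^+ n - f1 z); split.
  apply: (@holomorphicB (fun z => c * (z - p) ^+ n) f1); last exact: hf.
  apply: (@holomorphicM (fun=> c) (fun z => (z - p) ^+ n)); first exact: holomorphic_cst.
  exact: holomorphic_subX.
have n0 : \forall z \near p^', z - p != 0.
  by apply: (dnbhs_normc ltr01) => z; rewrite subr_eq0.
apply: filterS2 Ef n0 => z -> zp.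
by rewrite mulrBl mulfK// expf_neq0.
Qed.

(** The order of the pole is the index of the first nonzero coefficient: after division by that
    power of z - p the series is nonzero near p, and its inverse is holomorphic there. *)
Lemma meromorphic_inv_psum (a : nat -> R[i]) f p (r : R) (k : nat) : 0 < r ->
  pconv a r -> (forall z, normc (z - p) <= r -> f z = psum a (z - p)) -> a k != 0 ->
  meromorphic_at (fun z => (f z)^-1) p.
Proof.
move=> r0 ca fE ak; pose n := ex_minn (ex_intro (fun k => a k != 0) k ak).
have [an0 a0] : a n != 0 /\ forall i, (i < n)%N -> a i = 0.
  rewrite /n; case: ex_minnP => m am min; split => // i im.
  by apply/eqP; apply: contraTT im => /min; rewrite -leqNgt.
have cb := pconv_shift n r0 ca.
have [|e /andP[e0 er] He] := psum_neq0 r0 cb; first by rewrite addn0.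
pose g z := (psum (fun m => a (n + m)%N) (z - p))^-1.
exists n, g; split.
  apply: (holomorphicV (r := e) e0); first exact: (holomorphic_psum r0 cb).
  by move=> z /ltW; exact: He.
apply: (dnbhs_normc r0) => z zp /ltW zr.
by rewrite fE// (psum_shift r0 ca zr a0) invfM mulrC.
Qed.

Lemma holomorphic_cexp (u v : R[i]) p : holomorphic_at (fun s => cexp (u + v * s)) p.
Proof.
pose a n := cexp (u + v * p) * (v ^+ n / n`!%:R).
have ca : pconv a 1.
  apply: le_nsummable (nsummableZ (normc_ge0 (cexp (u + v * p))) _ (csummable_exp v)).
    by move=> n _; rewrite /a normcM expr1n mulr1.
  by move=> n _; exact: normc_ge0.
apply: (holomorphic_psum ltr01 ca) => z _.
have -> : u + v * z = (u + v * p) + v * (z - p) by ring.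
rewrite cexpD -(csum_exp (v * (z - p))) /psum /a -csumZ; last exact: csummable_exp.
by apply: eq_csum => n _; rewrite exprMn; ring.
Qed.

(** One point [w] where the entire series is nonzero serves for all [p]: were every coefficient at v
    p - c zero, the recentred series, which also reaches [w], would vanish there. Composition with
    the affine map multiplies the coefficients by powers of [v]. *)
Lemma meromorphic_inv_entire (e : nat -> R[i]) (c v w p : R[i]) : v != 0 ->
  (forall r, 0 <= r -> pconv e r) -> psum e w != 0 ->
  meromorphic_at (fun s => (psum e (v * s - c))^-1) p.
Proof.
move=> v0 ce ew; set q := v * p - c.
have nq := normc_ge0 q.
have rP (r : R) : 0 <= r -> pconv (recenter e q) r /\
    forall h, normc h <= r -> psum e (q + h) = psum (recenter e q) h.
  move=> r0; have q1 : normc q < normc q + (r + 1) by rewrite ltrDl ltr_wpDl.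
  have [|cr Er] := recenterP q1 (ce _ _); first by rewrite !addr_ge0.
  move: cr Er; rewrite addrAC subrr add0r => cr Er; split.
    by apply: le_pconv cr; rewrite ?lerDl.
  by move=> h hr; apply: Er; rewrite (le_trans hr)// lerDl.
have [k bk] : exists k, recenter e q k != 0.
  apply: contrapT => H; move/negP: ew; apply; apply/eqP.
  have [_ E] := rP _ (normc_ge0 (w - q)).
  have -> : w = q + (w - q) by ring.
  rewrite E//; apply: csum0 => n _; have [->|n0] := eqVneq (recenter e q n) 0.
    by rewrite mul0r.
  by exfalso; apply: H; exists n.
have [cb Eb] := rP _ (normc_ge0 v).
have cv : pconv (fun n => recenter e q n * v ^+ n) 1.
  by apply: le_nsummable cb => n _; rewrite expr1n mulr1 normc_termE.
apply: (meromorphic_inv_psum (k := k) ltr01 cv).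
  move=> z z1; have -> : v * z - c = q + v * (z - p) by rewrite /q; ring.
  rewrite Eb; last by rewrite normcM ler_piMr ?normc_ge0.
  by apply: eq_csum => n _; rewrite exprMn mulrA.
by rewrite mulf_neq0// expf_neq0.
Qed.

Lemma meromorphic_inv_quadratic p : meromorphic_at (fun s => (s * (s - 1))^-1) p.
Proof.
have r01 : (0 : R) <= 1 by [].
have [c1 _ E1] := plinP p 1 r01.
have [c2 _ E2] := plinP (p - 1) 1 r01.
have [c3 _ E3] := pmulP r01 c1 c2.
apply: (meromorphic_inv_psum (k := 2%N) ltr01 c3).
  by move=> z z1; rewrite E3// E1 E2; ring.
by rewrite /pmul !big_ord_recl big_ord0 /= !(mulr0, mul0r, addr0, add0r) mulr1 oner_eq0.
Qed.

End MeromorphicCalculus.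

(** 1 / zeta(3s) is replaced by (1 - 2 2^(-3s)) / eta(3s), with eta the entire extension of (1 -
    2^(1-s)) zeta(s). Every factor but the continuation of [zetaSU3] is then meromorphic on the
    whole plane, so the same domain [U] works. *)
Lemma continuation_of_formula {R : realType} (f : R[i] -> R[i]) (U : set R[i]) :
  (forall s : R[i], 2 < complex.Re s ->
     f s = (8 - cpow 2 (2 - s) * (zetaSU3 s / zeta (3 * s))) * (s * (s - 1))^-1) ->
  meromorphic_continuation [set s : R[i] | 2 < complex.Re s] zetaSU3 U ->
  meromorphic_continuation [set s : R[i] | 2 < complex.Re s] f U.
Proof.
move=> fE [oU cU VU [F0 mF0 F0E]]; split => //.
have [e [ce Ee]] := @eta_entire R.
(* The series [e] is centred at 3, so this is the value of eta at 6, where both factors of (1 -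
   2^(1-s)) zeta(s) are nonzero. *)
have e0 : psum e 3 != 0.
  have -> : (3 : R[i]) = 6 - 3 by ring.
  have R6 : complex.Re (6 : R[i]) = 6 by rewrite -(rmorph_nat (real_complex R)).
  by rewrite Ee ?R6 ?mulf_neq0 ?zeta_neq0 ?two_cpow_neq1 ?R6//; lra.
exists (fun s => (8 - cpow 2 (2 - s) *
   (F0 s * (1 - 2 * cpow 2 (- (3 * s))) * (psum e (3 * s - 3))^-1)) * (s * (s - 1))^-1).
  move=> p Up; apply: (@meromorphicM _ _ (fun s => (s * (s - 1))^-1)); last exact: meromorphic_inv_quadratic.
  apply: meromorphic_cstB; apply: meromorphicM.
    apply: meromorphic_holomorphic.
    have -> : (fun s => cpow 2 (2 - s)) =
        (fun s => cexp (2 * (ln 2)%:C + - (ln 2)%:C * s)) :> (R[i] -> R[i]).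
      by apply/funext => s; rewrite cpowE//; congr cexp; ring.
    exact: holomorphic_cexp.
  apply: meromorphicM; last by apply: meromorphic_inv_entire e0 => //; rewrite pnatr_eq0.
  apply: meromorphicM; first exact: mF0.
  apply: meromorphic_cstB; apply: meromorphic_holomorphic.
  apply: (@holomorphicM _ (fun=> 2) (fun s => cpow 2 (- (3 * s)))); first exact: holomorphic_cst.
  have -> : (fun s => cpow 2 (- (3 * s))) =
      (fun s => cexp (0 + (- 3 * (ln 2)%:C) * s)) :> (R[i] -> R[i]).
    by apply/funext => s; rewrite cpowE//; congr cexp; ring.
  exact: holomorphic_cexp.
move=> s /= s2; rewrite fE// F0E//.
have R3 : complex.Re (3 * s) = 3 * complex.Re s.
  by rewrite -(rmorph_nat (real_complex R)) ReM /= mul0r subr0.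
rewrite Ee ?R3; last by lra.
have b0 : 1 - 2 * cpow (2 : R) (- (3 * s)) != 0 by rewrite two_cpow_neq1// R3; lra.
by rewrite invfM [zetaSU3 s * _ * _]mulrA mulfK.
Qed.

(** * Sums over coprime pairs *)

Section CoprimeSum.
Context {R : realType}.
Implicit Types (s : R[i]).

Definition pos : set nat := [set k | (1 <= k)%N].

Definition coprime_pairs : set (nat * nat) :=
  [set k | [/\ (1 <= k.1)%N, (1 <= k.2)%N & coprime k.1 k.2]].

Definition su3 s (k : nat * nat) : R[i] :=
  cpow ((k.1 * k.2 * (k.1 + k.2))%:R : R) (- s).

Lemma nsummable_inv_sqr : nsummable pos (fun n : nat => (n%:R : R) `^ (- 2)).
Proof.
have sb : set_bij [set: nat] pos S.
  split => //; first by move=> n m _ _ [].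
  by move=> [|n] //= _; exists n.
apply: (nsum_bij _ sb).1.2.
have [s S] := @nsum_inv_sqr R.
apply: (nsum_nat_le (M := 1 + 1) _ _).1; first by move=> n; exact: powR_ge0.
move=> [|n]; first by rewrite big_geq// addr_ge0.
rewrite big_nat_recl//= powR1 lerD2l; apply: le_trans (nsum_ge_seq _ s (iota_uniq 0 (n - 0)) _) S.
- by move=> *; exact: powR_ge0.
- by [].
Qed.

Lemma zeta_pos s : 2 <= complex.Re s ->
  csummable pos (fun n : nat => cpow (n%:R : R) (- s)) /\
  zeta s = csum pos (fun n : nat => cpow (n%:R : R) (- s)).
Proof.
move=> s2; have [c1 ->] := zeta_csum s2.
have sb : set_bij [set: nat] pos S.
  split => //; first by move=> n m _ _ [].
  by move=> [|n] //= _; exists n.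
have [c E] := csum_bij (fun n : nat => cpow (n%:R : R) (- s)) sb.
by split; [exact: c.2 c1|rewrite E].
Qed.

Lemma powRN_le (x y a : R) : 0 < x -> x <= y -> 0 <= a -> y `^ (- a) <= x `^ (- a).
Proof.
move=> x0 xy a0; have y0 := lt_le_trans x0 xy.
rewrite !powRN lef_pV2 ?posrE ?powR_gt0//.
by apply: ge0_ler_powR; rewrite ?nnegrE ?(ltW x0) ?(ltW y0).
Qed.

(** Since p q (p + q) >= p q >= 1, the moduli are at most p^(-2) q^(-2). *)
Lemma csummable_su3 s : 2 <= complex.Re s -> csummable (pos `*`` (fun=> pos)) (su3 s).
Proof.
move=> s2; have s1 := nsummable_inv_sqr.
have p0 n : pos n -> 0 <= (n%:R : R) `^ (- 2) by move=> _; exact: powR_ge0.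
have le p q : pos p -> pos q -> normc (su3 s (p, q)) <= (p%:R : R) `^ (- 2) * q%:R `^ (- 2).
  move=> pp qq; have p1 : (0 < p)%N := pp; have q1 : (0 < q)%N := qq.
  rewrite /su3 normc_cpow ReN /= -powRM//.
  have pq1 : (1 <= p * q)%N by rewrite muln_gt0 p1.
  apply: (@le_trans _ _ (((p * q)%:R : R) `^ (- complex.Re s))).
    apply: powRN_le; rewrite ?ltr0n// ?ler_nat; last by lra.
    by rewrite leq_pmulr// addn_gt0 p1.
  rewrite natrM; apply: ler_powR; last by lra.
  by rewrite -natrM ler1n.
have sr p : pos p -> csummable pos (fun q => su3 s (p, q)).
  by move=> pp; apply: le_csummable (nsummableZ (p0 p pp) p0 s1) => q qq; exact: le.
apply: eq_csummable (_ : csummable _ (fun k => su3 s (k.1, k.2))); first by case.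
apply: (@csummable_pair _ _ _ pos (fun=> pos) (fun p q => su3 s (p, q))
  (fun p => nsum pos (fun q : nat => (q%:R : R) `^ (- 2)) * p%:R `^ (- 2))) => //.
  move=> p pp; rewrite mulrC -nsumZ ?powR_ge0//.
  apply: le_nsum; [by move=> *; exact: normc_ge0|by move=> q; exact: le|].
  exact: nsummableZ.
by apply: nsummableZ => //; exact: nsum_ge0.
Qed.

Lemma zetaSU3_csum s : 2 <= complex.Re s ->
  zetaSU3 s = cpow 2 s * csum (pos `*`` (fun=> pos)) (su3 s).
Proof.
move=> s2; have c := csummable_su3 s2.
have c' : csummable (pos `*`` (fun=> pos)) (fun k => su3 s (k.1, k.2)).
  by apply: eq_csummable c; case.
have [c1 c2 E] := @csum_pair _ _ _ _ _ (fun p q => su3 s (p, q)) c'.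
rewrite /zetaSU3; congr (_ * _).
rewrite (@eq_csum _ _ _ _ (fun k => su3 s (k.1, k.2))); last by case.
rewrite E; apply: limn_normc => e e0.
have [//|N HN] := csum_cvg_nat (a := 1) c2 _ e0.
exists N => n /HN; congr (normc (_ - _) < _).
rewrite !big_nat; apply: eq_bigr => p /andP[p1 _]; apply/esym/limn_normc => d d0.
by apply: (csum_cvg_nat (a := 1) (c1 p p1) _ d0).
Qed.

(** Every pair of positive integers is d times a unique coprime pair, with d the gcd; as p q (p + q)
    is homogeneous of degree 3, d contributes d^(-3s). *)
Lemma csum_su3 s : 2 <= complex.Re s ->
  csummable coprime_pairs (su3 s) /\
  csum (pos `*`` (fun=> pos)) (su3 s) = zeta (3 * s) * csum coprime_pairs (su3 s).
Proof.
move=> s2; have c := csummable_su3 s2.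
have R3 : complex.Re (3 * s) = 3 * complex.Re s.
  by rewrite -(rmorph_nat (real_complex R)) ReM /= mul0r subr0.
have [|cz ->] := @zeta_pos (3 * s); first by rewrite R3; lra.
have cc : csummable coprime_pairs (su3 s).
  by apply: csummableS c => -[p q] [p1 q1 _]; split.
split => //.
pose e (k : nat * (nat * nat)) : nat * nat := ((k.1 * k.2.1)%N, (k.1 * k.2.2)%N).
have sb : set_bij (pos `*`` (fun=> coprime_pairs)) (pos `*`` (fun=> pos)) e.
  split.
  - move=> [d [p q]] [/= d1 [/= p1 q1 _]]; split; rewrite /pos /= muln_gt0; apply/andP; split => //.
  - move=> [d [p q]] [d' [p' q']] /set_mem[/= d1 [/= p1 q1 pq]] /set_mem[/= d1' [/= p1' q1' pq']].
    rewrite /e /= => -[E1 E2].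
    have dd : d = d'.
      have : gcdn (d * p) (d * q) = gcdn (d' * p') (d' * q') by rewrite E1 E2.
      by rewrite -!muln_gcdr (eqP pq) (eqP pq') !muln1.
    move: E1 E2; rewrite -dd => /eqP; rewrite eqn_pmul2l// => /eqP -> /eqP.
    by rewrite eqn_pmul2l// => /eqP ->.
  - move=> [p q] [/= p1 q1]; pose d := gcdn p q.
    have d0 : (0 < d)%N by rewrite gcdn_gt0 p1.
    have dp : (d * (p %/ d))%N = p by rewrite mulnC divnK// dvdn_gcdl.
    have dq : (d * (q %/ d))%N = q by rewrite mulnC divnK// dvdn_gcdr.
    exists (d, (p %/ d, q %/ d)%N); last by rewrite /e /= dp dq.
    split => //=; split => /=.
    + by rewrite divn_gt0// dvdn_leq// dvdn_gcdl.
    + by rewrite divn_gt0// dvdn_leq// dvdn_gcdr.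
    + rewrite /coprime -(eqn_pmul2l d0) muln_gcdr dp dq muln1//.
have sE d k : pos d -> coprime_pairs k -> su3 s (e (d, k)) = cpow (d%:R : R) (- (3 * s)) * su3 s k.
  rewrite /pos /= => d1; case: k => p q [/= p1 q1 _]; rewrite /su3 /e /=.
  have d0 : (0 : R) < d%:R by rewrite ltr0n.
  have -> : (d * p * (d * q) * (d * p + d * q) = d * (d * (d * (p * q * (p + q)))))%N by ring.
  have pq0 : (0 : R) < (p * q * (p + q))%:R by rewrite ltr0n !muln_gt0 p1 q1 addn_gt0 p1.
  rewrite !natrM -!natrM; rewrite 3!natrM !cpowM ?mulr_gt0//.
  have -> : - (3 * s) = - s + (- s + - s) by ring.
  by rewrite !cpowD// !mulrA.
have [c1 E1] := csum_bij (su3 s) sb.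
have c2 := c1.1 c.
rewrite E1.
have c3 : csummable (pos `*`` (fun=> coprime_pairs)) (fun k => su3 s (e (k.1, k.2))).
  by apply: eq_csummable c2; case.
have [_ _ E3] := @csum_pair _ _ _ _ _ (fun d k => su3 s (e (d, k))) c3.
rewrite (@eq_csum _ _ _ _ (fun k => su3 s (e (k.1, k.2)))); last by case.
rewrite E3 -csumZr//; apply: eq_csum => d dp.
by rewrite -csumZ//; apply: eq_csum => k ck; exact: sE.
Qed.

Lemma zetaSU3_ratio s : 2 < complex.Re s ->
  cpow 2 (2 - s) * (zetaSU3 s / zeta (3 * s)) = 4 * csum coprime_pairs (su3 s).
Proof.
move=> s2; have s2' := ltW s2.
have R3 : complex.Re (3 * s) = 3 * complex.Re s.
  by rewrite -(rmorph_nat (real_complex R)) ReM /= mul0r subr0.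
have z0 : zeta (3 * s) != 0 by apply: zeta_neq0; rewrite R3; lra.
have E : cpow (2 : R) (2 - s) * cpow 2 s = 4.
  by rewrite -cpowD// subrK cpow_nat// -natrX rmorph_nat.
rewrite zetaSU3_csum// (csum_su3 s2').2 -E.
move: (cpow _ _) (cpow _ _) (csum _ _) (zeta _) z0 => a b c z z0.
by field.
Qed.

End CoprimeSum.

(** * Integration in the plane *)

Section LebesgueInvariance.
Context {R : realType}.
Local Notation mu := (@lebesgue_measure R).
Local Notation T := (measurableTypeR R).
Local Notation TT := (T * T)%type.
Local Notation mu2 := ((@lebesgue_measure R \x @lebesgue_measure R)%E).

Lemma measurable_real_fst : measurable_fun setT (fun x : TT => x.1 : R).
Proof. exact: measurable_fst. Qed.

Lemma measurable_real_snd : measurable_fun setT (fun x : TT => x.2 : R).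
Proof. exact: measurable_snd. Qed.

Lemma lebesgue_measure_shift (c : R) (A : set T) : measurable A ->
  pushforward mu (fun x : T => (x + c : T)) A = mu A.
Proof.
move=> mA; apply/esym/lebesgue_measure_unique => //=.
  by apply: measurable_funD; [exact: measurable_id|exact: measurable_cst].
move=> _ _ [[a b]] _ <-; rewrite /pushforward.
have -> : (fun x : R => x + c) @^-1` `]a, b] = `]a - c, b - c]%classic.
  by apply/seteqP; split => x /=; rewrite !in_itv /= ltrBlDr lerBrDr.
rewrite !lebesgue_measure_itv /= !lte_fin ltrD2r; case: ifP => // _.
by rewrite -!EFinB opprB addrA subrK.
Qed.

(** If the coordinates are the values of two adjacent forms and c is the [cut] of their coordinate
    sums, the new second coordinate is the value of the mediant form: these are the coordinates of
    the left child. *)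
Definition shear (c : R) (x : TT) : TT := (x.1, x.1 + x.2 - c).

Definition flip (x : TT) : TT := (x.2, x.1).

Lemma measurable_flip : measurable_fun setT flip.
Proof. by apply: measurable_fun_pair; [exact: measurable_snd|exact: measurable_fst]. Qed.

Lemma measurable_shear (c : R) : measurable_fun setT (shear c).
Proof.
apply: measurable_fun_pair; first exact: measurable_fst.
apply: measurable_funB; last exact: measurable_cst.
by apply: measurable_funD; [exact: measurable_real_fst|exact: measurable_real_snd].
Qed.

Lemma pushforward_shear (c : R) (A : set TT) : measurable A ->
  pushforward mu2 (shear c) A = mu2 A.
Proof.
move=> mA; rewrite /pushforward /product_measure1.
apply: eq_integral => x _ /=.
have -> : xsection (shear c @^-1` A) x = (fun y => y + (x - c)) @^-1` (xsection A x).
  apply/seteqP; split => y /=; rewrite !xsectionP /= /shear /=;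
    by rewrite (_ : y + (x - c) = x + y - c) //; ring.
rewrite -[LHS]/(pushforward mu (fun y : T => (y + (x - c) : T)) _).
apply: lebesgue_measure_shift; exact: measurable_xsection.
Qed.

Lemma pushforward_flip (A : set TT) : measurable A ->
  pushforward mu2 flip A = mu2 A.
Proof.
move=> mA; apply/esym.
apply: (product_measure_unique (m' := pushforward mu2 flip)) => //=; first exact: measurable_flip.
move=> mf B C mB mC; rewrite /pushforward.
have -> : flip @^-1` (B `*` C) = C `*` B.
  by apply/seteqP; split => -[x y] [].
by rewrite product_measure1E// muleC.
Qed.

End LebesgueInvariance.

(** * Bounded measurable functions supported in a fixed box *)

Section CompactlySupported.
Context {R : realType}.
Local Notation mu := (@lebesgue_measure R).
Local Notation T := (measurableTypeR R).
Local Notation TT := (T * T)%type.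
Local Notation mu2 := ((@lebesgue_measure R \x @lebesgue_measure R)%E).

(* Large enough to contain the supports of all the integrands, before and after
   the shears. *)
Definition segm : set T := `[(- 3 : R), 3]%classic.

Definition segm_bounded (h : T -> R) : Prop :=
  measurable_fun setT h /\ exists M, forall t, `|h t| <= M * \1_segm t.

Definition box_bounded (f : TT -> R) : Prop :=
  measurable_fun setT f /\ exists M, forall z, `|f z| <= M * \1_(segm `*` segm) z.

Lemma measurable_segm : measurable segm.
Proof. exact: measurable_itv. Qed.

Lemma segm_fin : (mu segm < +oo)%E.
Proof. by rewrite /segm lebesgue_measure_itv /=; case: ifP => // _; rewrite -EFinB ltry. Qed.

Lemma box_fin : (mu2 (segm `*` segm) < +oo)%E.
Proof.
rewrite product_measure1E; [|exact: measurable_segm|exact: measurable_segm].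
by rewrite lte_mul_pinfty// ?segm_fin// ge0_fin_numE// segm_fin.
Qed.

Lemma integrable_dominated d (X : measurableType d) (m : {measure set X -> \bar R})
    (A : set X) (M : R) (f : X -> R) :
  measurable A -> (m A < +oo)%E -> measurable_fun setT f ->
  (forall z, `|f z| <= M * \1_A z) -> m.-integrable setT (EFin \o f).
Proof.
move=> mA fA mf fM.
have iA : m.-integrable setT (EFin \o (fun z => M * \1_A z)).
  apply: (@eq_integrable _ _ _ m _ measurableT (fun z => (M%:E * (\1_A z)%:E)%E)) => //.
  apply: integrableZl => //; apply/integrableP; split.
    exact/measurable_EFinP/measurable_indicP.
  under eq_integral do rewrite gee0_abs ?lee_fin//.
  by rewrite integral_indic// setIT.
apply: le_integrable iA => //; first exact/measurable_EFinP.
by move=> z _; rewrite /= lee_fin; apply: le_trans (fM z) (ler_norm _).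
Qed.

Lemma segm_bounded_integrable h : segm_bounded h -> mu.-integrable setT (EFin \o h).
Proof.
move=> [mh [M hM]]; apply: integrable_dominated hM => //.
  exact: measurable_segm.
exact: segm_fin.
Qed.

Lemma box_bounded_integrable f : box_bounded f -> mu2.-integrable setT (EFin \o f).
Proof.
move=> [mf [M fM]]; apply: integrable_dominated fM => //; last exact: box_fin.
by apply: measurableX; exact: measurable_segm.
Qed.

Lemma box_bounded_section f x : box_bounded f -> segm_bounded (fun y => f (x, y)).
Proof.
move=> [mf [M fM]]; split; first exact: measurable_fun_pair2.
exists `|M| => y; apply: le_trans (fM _) _; rewrite !indicE in_setX.
apply: le_trans (ler_norm _) _; rewrite normrM ler_wpM2l// ger0_norm//.
by rewrite ler_nat; case: (_ \in _) => //=; case: (_ \in _).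
Qed.

Lemma box_bounded_fubini f : box_bounded f ->
  \int[mu2]_z f z = \int[mu]_x \int[mu]_y f (x, y).
Proof.
move=> nf; rewrite /Rintegral -integral12_prod_meas1; last exact: box_bounded_integrable.
congr fine; apply: eq_integral => x _; rewrite fineK//.
by apply: integrable_fin_num => //; exact: segm_bounded_integrable (box_bounded_section x nf).
Qed.

Lemma box_bounded_measurable_section f : box_bounded f -> measurable_fun setT (fun x : T => \int[mu]_y f (x, y)).
Proof.
move=> nf; apply/measurable_EFinP.
have := measurable_fubini_F (box_bounded_integrable nf); congr measurable_fun.
apply/funext => x /=; rewrite /fubini_F fineK//.
by apply: integrable_fin_num => //; exact: segm_bounded_integrable (box_bounded_section x nf).
Qed.

Lemma box_bounded_shear f c : box_bounded f -> box_bounded (f \o shear c) ->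
  \int[mu2]_z f (shear c z) = \int[mu2]_z f z.
Proof.
move=> nf nfs; rewrite /Rintegral; congr fine.
have mf : measurable_fun setT (EFin \o f) by apply/measurable_EFinP; case: nf.
have ifs : mu2.-integrable (shear c @^-1` setT) ((EFin \o f) \o shear c).
  by rewrite preimage_setT; exact: box_bounded_integrable nfs.
have := integral_pushforward (measurable_shear c) mf ifs measurableT.
rewrite preimage_setT => /= <-.
apply: eq_measure_integral => /=; first exact: measurable_shear.
by move=> _ A mA _; exact: pushforward_shear.
Qed.

Lemma box_bounded_flip f : box_bounded f -> box_bounded (f \o flip).
Proof.
move=> [mf [M fM]]; split; first exact: (measurableT_comp mf measurable_flip).
exists M => z; apply: le_trans (fM _) _.
by rewrite !indicE !in_setX /= andbC.
Qed.

Lemma box_bounded_flipE f : box_bounded f -> \int[mu2]_z f (flip z) = \int[mu2]_z f z.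
Proof.
move=> nf; have nfs := box_bounded_flip nf; rewrite /Rintegral; congr fine.
have mf : measurable_fun setT (EFin \o f) by apply/measurable_EFinP; case: nf.
have ifs : mu2.-integrable (flip @^-1` setT) ((EFin \o f) \o flip).
  by rewrite preimage_setT; exact: box_bounded_integrable nfs.
have := integral_pushforward measurable_flip mf ifs measurableT.
rewrite preimage_setT => /= <-.
apply: eq_measure_integral => /=; first exact: measurable_flip.
by move=> _ A mA _; exact: pushforward_flip.
Qed.

Lemma segmE (t : R) : \1_segm t = (`|t| <= 3)%R%:R :> R.
Proof. by rewrite indicE /segm mem_setE /= in_itv /= ler_norml. Qed.

Lemma boxE (z : TT) : \1_(segm `*` segm) z = ((`|z.1| <= 3)%R && (`|z.2| <= 3)%R)%:R :> R.
Proof. by rewrite indicE in_setX !mem_setE /= !in_itv /= !ler_norml. Qed.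

Lemma segm_boundedI (h : T -> R) (M : R) : measurable_fun setT h -> 0 <= M -> (forall t, `|h t| <= M) ->
  (forall t, ~~ (`|t| <= 3) -> h t = 0) -> segm_bounded h.
Proof.
move=> mh M0 hM h0; split => //; exists M => t; rewrite segmE.
have [t3|/h0 ->] := boolP (_ <= 3); first by rewrite mulr1.
by rewrite normr0 mulr0.
Qed.

Lemma box_boundedI (f : TT -> R) (M : R) : measurable_fun setT f -> 0 <= M -> (forall z, `|f z| <= M) ->
  (forall z, ~~ ((`|z.1| <= 3) && (`|z.2| <= 3)) -> f z = 0) -> box_bounded f.
Proof.
move=> mh M0 hM h0; split => //; exists M => t; rewrite boxE.
have [t3|/h0 ->] := boolP (_ && _); first by rewrite mulr1.
by rewrite normr0 mulr0.
Qed.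

Lemma segm_bounded_comp (h : T -> R) (u : T -> T) : segm_bounded h -> measurable_fun setT u ->
  (forall t, h (u t) != 0 -> `|t| <= 3) -> segm_bounded (h \o u).
Proof.
move=> [mh [M hM]] mu_ hu; apply: (@segm_boundedI _ `|M|) => //.
- exact: (measurableT_comp mh mu_).
- move=> t /=; apply: le_trans (hM _) _; rewrite segmE.
  apply: le_trans (ler_norm _) _; rewrite normrM ler_piMr//.
  by case: (_ <= 3); rewrite ?normr1 ?normr0.
- by move=> t t3; apply/eqP; apply: contraNT t3 => /hu.
Qed.

Lemma box_bounded_comp (f : TT -> R) (u : TT -> TT) : box_bounded f -> measurable_fun setT u ->
  (forall z, f (u z) != 0 -> (`|z.1| <= 3) && (`|z.2| <= 3)) -> box_bounded (f \o u).
Proof.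
move=> [mh [M hM]] mu_ hu; apply: (@box_boundedI _ `|M|) => //.
- exact: (measurableT_comp mh mu_).
- move=> t /=; apply: le_trans (hM _) _; rewrite boxE.
  apply: le_trans (ler_norm _) _; rewrite normrM ler_piMr//.
  by case: (_ && _); rewrite ?normr1 ?normr0.
- by move=> t t3; apply/eqP; apply: contraNT t3 => /hu.
Qed.

Lemma segm_bounded_shift h c : segm_bounded h -> segm_bounded (fun t : T => h (t + c)) ->
  \int[mu]_t h (t + c) = \int[mu]_t h t.
Proof.
move=> nf nfs; rewrite /Rintegral; congr fine.
have mf : measurable_fun setT (EFin \o h) by apply/measurable_EFinP; case: nf.
have ms : measurable_fun setT (fun x : T => (x + c : T)).
  by apply: measurable_funD; [exact: measurable_id|exact: measurable_cst].
have ifs : mu.-integrable ((fun x : T => (x + c : T)) @^-1` setT) ((EFin \o h) \o (fun x : T => (x + c : T))).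
  by rewrite preimage_setT; exact: segm_bounded_integrable nfs.
have := integral_pushforward ms mf ifs measurableT.
rewrite preimage_setT => /= <-.
by apply: eq_measure_integral => A mA _; exact: lebesgue_measure_shift.
Qed.

Lemma segm_bounded_opp h : segm_bounded h -> segm_bounded (fun t : T => h (- t)) ->
  \int[mu]_t h (- t) = \int[mu]_t h t.
Proof.
move=> nf nfs; rewrite /Rintegral; congr fine.
have mf : measurable_fun setT (EFin \o h) by apply/measurable_EFinP; case: nf.
have ms : measurable_fun setT (fun x : T => (- x : T)) by exact: oppr_measurable.
have ifs : mu.-integrable ((fun x : T => (- x : T)) @^-1` setT) ((EFin \o h) \o (fun x : T => (- x : T))).
  by rewrite preimage_setT; exact: segm_bounded_integrable nfs.
have := integral_pushforward ms mf ifs measurableT.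
rewrite preimage_setT => /= <-.
by apply: eq_measure_integral => A mA _; exact: lebesgue_measureN.
Qed.

Lemma Rintegral_off_point (h k : T -> R) (c : T) : segm_bounded h -> segm_bounded k ->
  (forall t, t != c -> h t = k t) -> \int[mu]_t h t = \int[mu]_t k t.
Proof.
move=> [mh _] [mk _] hk; rewrite /Rintegral; congr fine; apply: ae_eq_integral => //.
- exact/measurable_EFinP.
- exact/measurable_EFinP.
exists [set c]; split; [exact: measurable_set1|exact: lebesgue_measure_set1|].
move=> t /= H; apply: contrapT => tc; apply: H => _.
by rewrite hk//; apply/eqP.
Qed.

End CompactlySupported.

(** * Cutting corners along the Stern-Brocot tree *)

Section CornerCutting.
Context {R : realType}.
Implicit Types (p q al be : R).

Definition cut p q : R := (p * q * (p + q))^-1.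

(* The sum of cut (p + k * q) q over all k >= 0. *)
Definition reach p q : R := (p * q ^+ 2)^-1.

(* p and q are the coordinate sums of two adjacent primitive vectors u and v, and
   al and be the values of their forms; by ellD the form of u + v takes the value
   al + be - cut p q. *)
Fixpoint tree_min (n : nat) p q al be : R :=
  if n is n'.+1 then
    Num.min (tree_min n' p (p + q) al (al + be - cut p q))
            (tree_min n' (p + q) q (al + be - cut p q) be)
  else Num.min al be.

Lemma cut_gt0 p q : 0 < p -> 0 < q -> 0 < cut p q.
Proof. by move=> p0 q0; rewrite invr_gt0 !mulr_gt0// addr_gt0. Qed.

Lemma reach_gt0 p q : 0 < p -> 0 < q -> 0 < reach p q.
Proof. by move=> p0 q0; rewrite invr_gt0 mulr_gt0// exprn_gt0. Qed.

Lemma cutC p q : cut p q = cut q p.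
Proof. by rewrite /cut; congr _^-1; ring. Qed.

Lemma reachD p q : 0 < p -> 0 < q -> reach p (p + q) + reach q (p + q) = cut p q.
Proof.
by move=> p0 q0; rewrite /reach /cut; field; rewrite !gt_eqF// addr_gt0.
Qed.

Lemma reach_cut p q : 0 < p -> 0 < q -> reach p q = cut p q + reach (p + q) q.
Proof.
by move=> p0 q0; rewrite /reach /cut; field; rewrite !gt_eqF// addr_gt0.
Qed.

Lemma reach_child p q : 0 < p -> 0 < q -> reach p (p + q) <= cut p q.
Proof.
move=> p0 q0; have := reachD p0 q0.
by have := reach_gt0 q0 (addr_gt0 p0 q0); lra.
Qed.

Lemma tree_min_le n p q al be : tree_min n p q al be <= Num.min al be.
Proof.
elim: n p q al be => [//|n IH] p q al be /=.
rewrite le_min !ge_min; apply/andP; split; apply/orP; [left|right].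
  by apply: le_trans (IH _ _ _ _) _; rewrite ge_min lexx.
by apply: le_trans (IH _ _ _ _) _; rewrite ge_min lexx orbT.
Qed.

Lemma tree_min_sym n p q al be : tree_min n p q al be = tree_min n q p be al.
Proof.
elim: n p q al be => [|n IH] p q al be /=; first exact: minC.
by rewrite minC (IH p) (IH (p + q)) [q + p]addrC [be + al]addrC (cutC q p).
Qed.

(** The bound on [al] persists: in the right child because reach p q - cut p q = reach (p + q) q, in
    the left one because reach p (p + q) <= cut p q. It also puts the mediant form above [be], so no
    descendant lowers the minimum. *)
Lemma tree_min_cap_left n p q al be : 0 < p -> 0 < q -> 0 <= be -> reach p q <= al ->
  tree_min n p q al be = Num.min al be.
Proof.
elim: n p q al be => [//|n IH] p q al be p0 q0 be0 hal /=.
have pq0 : 0 < p + q by rewrite addr_gt0.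
have E := reach_cut p0 q0.
have r0 := reach_gt0 pq0 q0.
have c1 := reach_child p0 q0.
have ga0 : 0 <= al + be - cut p q by lra.
rewrite IH//; last by lra.
rewrite IH//; last by lra.
have bega : be <= al + be - cut p q by lra.
by rewrite (min_idPr bega) -minA (min_idPr bega).
Qed.

Lemma tree_min_cap_right n p q al be : 0 < p -> 0 < q -> 0 <= al -> reach q p <= be ->
  tree_min n p q al be = Num.min al be.
Proof. by move=> *; rewrite tree_min_sym tree_min_cap_left// minC. Qed.

Section Telescoping.
Variable phi : R -> R.
Hypothesis phi0 : forall t, t <= 0 -> phi t = 0.

Definition gap n p q al be := phi (Num.min al be) - phi (tree_min n p q al be).

(** A subtree acts only on an open rectangle at the origin. This bounds the supports for
    integration, and it separates the two children in [gapS]. *)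
Lemma gap_eq0 n p q al be : 0 < p -> 0 < q ->
  ~~ ((0 < al < reach p q) && (0 < be < reach q p)) -> gap n p q al be = 0.
Proof.
move=> p0 q0 H; rewrite /gap.
have le := tree_min_le n p q al be.
have [al0|al0] := leP al 0.
  by rewrite !phi0 ?subrr// ?(le_trans le)// ge_min al0.
have [be0|be0] := leP be 0.
  by rewrite !phi0 ?subrr// ?(le_trans le)// ge_min be0 orbT.
have [h|h] := leP (reach p q) al; first by rewrite tree_min_cap_left ?subrr// ltW.
have [h'|h'] := leP (reach q p) be; first by rewrite tree_min_cap_right ?subrr// ltW.
by rewrite al0 be0 h h' in H.
Qed.

(** The bracket is what the mediant form [ga] cuts off by itself. What remains is to write the loss
    between [Num.min (Num.min al be) ga] and [Num.min m1 m2] as the sum of the losses of the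
    subtrees; if [ga] is nonpositive, everything is zero by [phi0]. *)
Lemma gapS n p q al be : 0 < p -> 0 < q ->
  let ga := al + be - cut p q in
  gap n.+1 p q al be =
    (phi (Num.min al be) - phi (Num.min (Num.min al be) ga)) +
    gap n p (p + q) al ga + gap n (p + q) q ga be.
Proof.
move=> p0 q0 ga; have pq0 : 0 < p + q by rewrite addr_gt0.
set m1 := tree_min n p (p + q) al ga; set m2 := tree_min n (p + q) q ga be.
have l1 : m1 <= Num.min al ga := tree_min_le _ _ _ _ _.
have l2 : m2 <= Num.min ga be := tree_min_le _ _ _ _ _.
rewrite /gap /= -/ga -/m1 -/m2.
suff : phi (Num.min (Num.min al be) ga) - phi (Num.min m1 m2) =
  gap n p (p + q) al ga + gap n (p + q) q ga be.
  by rewrite /gap -/m1 -/m2; lra.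
have c0 := cut_gt0 p0 q0.
have r1 : reach p (p + q) + reach q (p + q) = cut p q := reachD p0 q0.
have rp := reach_gt0 p0 pq0; have rq := reach_gt0 q0 pq0.
have z (x : R) : x <= Num.min al ga \/ x <= Num.min ga be -> ga <= 0 -> x <= 0.
  by case=> /le_trans h g0; apply: h; rewrite ge_min g0 ?orbT.
have [ga0|ga0] := leP ga 0.
  have g1 : gap n p (p + q) al ga = 0.
    by apply: gap_eq0 => //; rewrite [0 < ga]ltNge ga0 andbF.
  have g2 : gap n (p + q) q ga be = 0.
    by apply: gap_eq0 => //; rewrite [0 < ga]ltNge ga0.
  rewrite g1 g2.
  by rewrite !phi0 ?subrr ?addr0//; rewrite ge_min ?ga0 ?orbT// (z m1)//; left.
(* since reach p (p + q) + reach q (p + q) = cut p q, at most one of the two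
   subtrees is active *)
have [hal|hal] := leP (reach p (p + q)) al; last first.
  have hbe : reach q (p + q) <= be by rewrite /ga in ga0; lra.
  have be0 : 0 < be by lra.
  have g2 : gap n (p + q) q ga be = 0.
    by apply: gap_eq0 => //; rewrite [be < _]ltNge hbe andbF andbF.
  have m2E : m2 = Num.min ga be by rewrite /m2 tree_min_cap_right// ltW.
  have gbe : ga < be by rewrite /ga; lra.
  rewrite g2 addr0 /gap -/m1 m2E.
  have -> : Num.min (Num.min al be) ga = Num.min al ga.
    by rewrite minAC (min_idPl (_ : Num.min al ga <= be))// ge_min (ltW gbe) orbT.
  have -> // : Num.min m1 (Num.min ga be) = m1.
  rewrite (min_idPl (ltW gbe)); apply/min_idPl; apply: le_trans l1 _.
  by rewrite ge_min lexx orbT.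
have [be0|be0] := leP be 0.
  have al1 : cut p q < al by rewrite /ga in ga0; lra.
  have g1 : gap n p (p + q) al ga = 0.
    by apply: gap_eq0 => //; rewrite [al < _]ltNge hal andbF.
  have g2 : gap n (p + q) q ga be = 0.
    by apply: gap_eq0 => //; rewrite [0 < be]ltNge be0 andbF.
  rewrite g1 g2.
  have h1 : Num.min (Num.min al be) ga <= 0 by rewrite !ge_min be0 orbT.
  have h2 : Num.min m1 m2 <= 0.
    rewrite ge_min; apply/orP; right; apply: le_trans l2 _.
    by rewrite ge_min be0 orbT.
  by rewrite (phi0 h1) (phi0 h2) subrr addr0.
have al0 : 0 < al by lra.
have g1 : gap n p (p + q) al ga = 0.
  by apply: gap_eq0 => //; rewrite [al < _]ltNge hal andbF.
have m1E : m1 = Num.min al ga by rewrite /m1 tree_min_cap_left// ltW.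
rewrite g1 add0r /gap -/m2 m1E.
have [hbe|hbe] := leP (reach q (p + q)) be.
  have m2E : m2 = Num.min ga be by rewrite /m2 tree_min_cap_right// ltW.
  have -> : Num.min (Num.min al ga) m2 = Num.min (Num.min al be) ga.
    by rewrite m2E minA -(minA al ga ga) minxx minAC.
  by rewrite m2E !subrr.
have gal : ga < al by rewrite /ga; lra.
have -> : Num.min (Num.min al be) ga = Num.min ga be.
  rewrite -minA [Num.min be ga]minC (min_idPr _)// ge_min (ltW gal)//.
have -> // : Num.min (Num.min al ga) m2 = m2.
rewrite (min_idPr (ltW gal)); apply/min_idPr; apply: le_trans l2 _.
by rewrite ge_min lexx.
Qed.

End Telescoping.

End CornerCutting.

(** * Folding the four quadrants onto the unit square *)

Section Folding.
Context {R : realType}.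
Local Notation mu := (@lebesgue_measure R).
Local Notation T := (measurableTypeR R).
Local Notation TT := (T * T)%type.
Local Notation mu2 := ((@lebesgue_measure R \x @lebesgue_measure R)%E).

Definition fold (t : T) : T := 1 - `|t|.

Lemma measurable_fold : measurable_fun setT fold.
Proof.
apply: measurable_funB; first exact: measurable_cst.
exact: normr_measurable.
Qed.

Lemma fold_integral (h : T -> R) : segm_bounded h -> (forall t, h t != 0 -> 0 < t <= 1) ->
  segm_bounded (h \o fold) /\ \int[mu]_t h (fold t) = 2 * \int[mu]_t h t.
Proof.
move=> nh supp.
have z (t : R) : ~~ (0 < t <= 1) -> h t = 0.
  by move=> t01; apply/eqP; apply: contraNT t01 => /supp.
have nf : segm_bounded (h \o fold).
  apply: segm_bounded_comp => //; first exact: measurable_fold.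
  by move=> t /supp; rewrite /fold => /andP[]; lra.
have n1 : segm_bounded (fun t : T => h (t + 1)).
  apply: (segm_bounded_comp (u := fun t : T => (t + 1 : T))) => //.
    by apply: measurable_funD; [exact: measurable_id|exact: measurable_cst].
  by move=> t /supp /andP[]; rewrite ler_norml; lra.
have n2 : segm_bounded (fun t : T => h (- t + 1)).
  apply: (segm_bounded_comp (u := fun t : T => (- t + 1 : T))) => //.
    by apply: measurable_funD; [exact: oppr_measurable|exact: measurable_cst].
  by move=> t /supp /andP[]; rewrite ler_norml; lra.
split => //.
have n3 : segm_bounded (fun t : T => h (- t + 1) + h (t + 1)).
  case: n1 => m1 [M1 b1]; case: n2 => m2 [M2 b2]; split; first exact: measurable_funD.
  exists (M2 + M1) => t; rewrite mulrDl; apply: le_trans (ler_normD _ _) _.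
  by apply: lerD.
(* The two branches of the fold overlap only at 0, where the right-hand function takes the value 2
   h(1) instead of h(1). *)
rewrite (@Rintegral_off_point _ (h \o fold) (fun t : T => h (- t + 1) + h (t + 1)) 0) //.
  rewrite RintegralD//; [|exact: segm_bounded_integrable n2|exact: segm_bounded_integrable n1].
  rewrite (segm_bounded_opp (h := fun t => h (t + 1)) n1 n2) (segm_bounded_shift nh n1).
  by rewrite mulr_natl mulr2n.
move=> t t0; rewrite /= /fold; have [tp|tn] := leP 0 t.
  rewrite ger0_norm// [h (t + 1)]z ?addr0; first by congr h; rewrite addrC.
  have tp' : 0 < t by rewrite lt_neqAle eq_sym t0.
  by apply/negP => /andP[_]; lra.
rewrite ltr0_norm// [h (- t + 1)]z ?add0r; first by congr h; rewrite opprK addrC.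
by apply/negP => /andP[_]; lra.
Qed.

Definition fold2 (z : TT) : TT := (fold z.1, fold z.2).

Lemma measurable_fold2 : measurable_fun setT fold2.
Proof.
apply: measurable_fun_pair; apply: measurableT_comp; [exact: measurable_fold|exact: measurable_fst| |exact: measurable_snd].
exact: measurable_fold.
Qed.

Lemma measurable_indic_segm : measurable_fun setT (\1_segm : T -> R).
Proof. by apply: (@measurable_indicP _ _ R _).1; exact: measurable_segm. Qed.

Lemma fold2_integral (f : TT -> R) : box_bounded f ->
  (forall z, f z != 0 -> (0 < z.1 <= 1) && (0 < z.2 <= 1)) ->
  box_bounded (f \o fold2) /\ \int[mu2]_z f (fold2 z) = 4 * \int[mu2]_z f z.
Proof.
move=> nf supp.
have nf2 : box_bounded (f \o fold2).
  apply: box_bounded_comp => //; first exact: measurable_fold2.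
  move=> [x y] /supp; rewrite /fold2 /fold /= => /andP[/andP[a b] /andP[c d]].
  by apply/andP; split; lra.
split => //.
rewrite (box_bounded_fubini nf2) (box_bounded_fubini nf) /=.
(* The inner integral must itself be measurable, bounded and supported in (0, 1] before the fold of
   the first axis can be undone; each axis gives a factor 2. *)
pose k (x : T) := \int[mu]_y f (x, y).
have nk : segm_bounded k.
  have [mf [M fM]] := nf.
  split; first exact: box_bounded_measurable_section.
  exists (`|M| * fine (mu segm)) => x.
  have nx := box_bounded_section x nf.
  apply: le_trans (le_normr_Rintegral _ (segm_bounded_integrable nx)) _ => //.
  have is1 : mu.-integrable setT (EFin \o (fun y => (`|M| * \1_segm x) * \1_segm y)).
    apply: (@integrable_dominated _ _ _ mu segm (`|M| * \1_segm x)) => //.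
    - exact: measurable_segm.
    - exact: segm_fin.
    - by apply: measurable_funM; [exact: measurable_cst|exact: measurable_indic_segm].
    - by move=> y; rewrite ger0_norm// !mulr_ge0.
  apply: le_trans (le_Rintegral (f2 := fun y => (`|M| * \1_segm x) * \1_segm y) _ _ is1 _) _ => //.
  - case: nx => mx [Mx bx]; apply: (@integrable_dominated _ _ _ mu segm Mx) => //.
    + exact: measurable_segm.
    + exact: segm_fin.
    + by apply: measurableT_comp.
    + by move=> y; rewrite normr_id.
  - move=> y _; apply: le_trans (fM _) _; rewrite !indicE in_setX /=.
    apply: le_trans (ler_norm _) _; rewrite normrM -mulrA ler_wpM2l//.
    by rewrite ger0_norm// -natrM mulnb.
  rewrite RintegralZl//; last first.
    apply: (@integrable_dominated _ _ _ mu segm 1) => //.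
    - exact: measurable_segm.
    - exact: segm_fin.
    - exact: measurable_indic_segm.
    - by move=> y; rewrite mul1r ger0_norm.
  rewrite /Rintegral integral_indic; [|exact: measurableT|exact: measurable_segm].
  by rewrite setIT [leLHS]mulrAC lexx.
have sk t : k t != 0 -> 0 < t <= 1.
  apply: contraNT => t01; apply/eqP; rewrite /k /Rintegral integral0_eq// => y _.
  have [->//|/supp /=] := eqVneq (f (t, y)) 0.
  by rewrite (negbTE t01).
have -> : (fun x => \int[mu]_y f (fold2 (x, y))) = (fun x => 2 * k (fold x)).
  apply/funext => x; have [|_] := @fold_integral (fun y => f (fold x, y)) (box_bounded_section (fold x) nf).
    by move=> t /supp /andP[].
  by move=> <-.
have [nkf E] := fold_integral nk sk.
have -> : \int[mu]_x (2 * k (fold x)) = 2 * \int[mu]_x k (fold x).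
  by apply: RintegralZl; [exact: measurableT|exact: segm_bounded_integrable nkf].
by rewrite E mulrA -natrM.
Qed.

End Folding.

(** * The integral removed by a single corner *)

Section CornerIntegrals.
Context {R : realType}.
Local Notation mu := (@lebesgue_measure R).
Local Notation T := (measurableTypeR R).
Local Notation TT := (T * T)%type.
Local Notation mu2 := ((@lebesgue_measure R \x @lebesgue_measure R)%E).

Lemma measurable_tree_min n (p q : R) : measurable_fun setT (fun z : TT => tree_min n p q z.1 z.2).
Proof.
(* The recursion replaces the coordinates by combinations of them, so the induction runs over
   arbitrary measurable arguments. *)
have H (u v : TT -> R) : measurable_fun setT u -> measurable_fun setT v ->
    measurable_fun setT (fun z : TT => tree_min n p q (u z) (v z)).
  elim: n p q u v => [|n IH] p q u v mu_ mv /=; first exact: measurable_minr.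
  have mw : measurable_fun setT (fun z => u z + v z - cut p q).
    apply: measurable_funB; [exact: measurable_funD|exact: measurable_cst].
  by apply: measurable_minr; exact: IH.
by apply: H; [exact: measurable_real_fst|exact: measurable_real_snd].
Qed.

Variable phi : R -> R.
Hypothesis cphi : continuous phi.
Hypothesis phi0 : forall t, t <= 0 -> phi t = 0.
Hypothesis phi1 : forall t, t <= 1 -> `|phi t| <= 1.

Lemma measurable_phi : measurable_fun setT (phi : T -> R).
Proof. exact: continuous_measurable_fun. Qed.

Lemma phi_gt0 t : phi t != 0 -> 0 < t.
Proof. by apply: contraNT; rewrite -leNgt => /phi0 ->. Qed.

Definition kint (d : R) : R := \int[mu]_(t in `[0, d]) ((d - t) * phi t).

(** With [wedge_lt], the part of phi(min) on the square (0, d]^2, split along the diagonal; the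
    diagonal itself is counted here only. *)
Definition wedge_ge (d : R) (z : TT) : R :=
  if (z.2 <= z.1) && (z.1 <= d) then phi z.2 else 0.

Definition wedge_lt (d : R) (z : TT) : R :=
  if (z.1 < z.2) && (z.2 <= d) then phi z.1 else 0.

Lemma wedge_ge_supp d z : wedge_ge d z != 0 -> [/\ 0 < z.2, z.2 <= z.1 & z.1 <= d].
Proof.
by rewrite /wedge_ge; case: ifPn => [/andP[a b] /phi_gt0|]; rewrite ?eqxx.
Qed.

Lemma wedge_lt_supp d z : wedge_lt d z != 0 -> [/\ 0 < z.1, z.1 < z.2 & z.2 <= d].
Proof.
by rewrite /wedge_lt; case: ifPn => [/andP[a b] /phi_gt0|]; rewrite ?eqxx.
Qed.

Lemma box_bounded_supp (f : TT -> R) (M : R) : measurable_fun setT f -> 0 <= M ->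
  (forall z, f z != 0 -> [/\ 0 < z.1 <= 1, 0 < z.2 <= 1 & `|f z| <= M]) -> box_bounded f.
Proof.
move=> mf M0 H; apply: (@box_boundedI _ f M) => //.
  by move=> z; have [->|/H[]//] := eqVneq (f z) 0; rewrite normr0.
move=> z; apply: contraNeq => fz; have [/andP[a b] /andP[c d] _] := H z fz.
by rewrite (ger0_norm (ltW a)) (ger0_norm (ltW c)); apply/andP; split; lra.
Qed.

Lemma box_bounded_wedge_ge d : d <= 1 -> box_bounded (wedge_ge d).
Proof.
move=> d1; apply: (@box_bounded_supp _ 1) => //.
  apply: measurable_fun_ifT.
  - apply: measurable_and; apply: measurable_fun_ler.
    + exact: measurable_real_snd.
    + exact: measurable_real_fst.
    + exact: measurable_real_fst.
    + exact: measurable_cst.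
  - exact: (measurableT_comp measurable_phi measurable_real_snd).
  - exact: measurable_cst.
move=> z z0; have [a b c] := wedge_ge_supp z0; split; try (apply/andP; split; lra).
by rewrite /wedge_ge; case: ifP => _; rewrite ?normr0//; apply: phi1; lra.
Qed.

Lemma box_bounded_wedge_lt d : d <= 1 -> box_bounded (wedge_lt d).
Proof.
move=> d1; apply: (@box_bounded_supp _ 1) => //.
  apply: measurable_fun_ifT.
  - apply: measurable_and; [apply: measurable_fun_ltr|apply: measurable_fun_ler].
    + exact: measurable_real_fst.
    + exact: measurable_real_snd.
    + exact: measurable_real_snd.
    + exact: measurable_cst.
  - exact: (measurableT_comp measurable_phi measurable_real_fst).
  - exact: measurable_cst.
move=> z z0; have [a b c] := wedge_lt_supp z0; split; try (apply/andP; split; lra).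
by rewrite /wedge_lt; case: ifP => _; rewrite ?normr0//; apply: phi1; lra.
Qed.

Lemma Rintegral_indic_scaled (a : R) (A : set T) : measurable A -> (mu A < +oo)%E ->
  \int[mu]_y (a * \1_A y) = a * fine (mu A).
Proof.
move=> mA fA.
have m1 : measurable_fun setT (\1_A : T -> R).
  by apply: (@measurable_indicP _ _ R _).1; exact: mA.
rewrite RintegralZl//; last first.
  by apply: (@integrable_dominated _ _ _ mu A 1) => // y; rewrite mul1r ger0_norm.
congr (_ * _); rewrite /Rintegral integral_indic; [|exact: measurableT|exact: mA].
by rewrite setIT.
Qed.

Lemma kintE (d : R) : kint d = \int[mu]_x ((if 0 < x <= d then d - x else 0) * phi x).
Proof.
rewrite /kint Rintegral_mkcond; congr (Rintegral _ _ _); apply/funext => x.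
rewrite patchE mem_setE /= in_itv /=.
have [x0|x0] := leP x 0.
  by rewrite phi0// !mulr0; case: ifP.
by rewrite ltW//=; case: ifP => //; rewrite mul0r.
Qed.

Lemma wedge_lt_integral d : d <= 1 -> \int[mu2]_z wedge_lt d z = kint d.
Proof.
move=> d1; rewrite box_bounded_fubini; last exact: box_bounded_wedge_lt.
rewrite kintE; congr (Rintegral _ _ _); apply/funext => x.
have -> : (fun y => wedge_lt d (x, y)) = (fun y => phi x * \1_(`]x, d]%classic : set T) y).
  apply/funext => y; rewrite /wedge_lt indicE mem_setE /= in_itv /=.
  by case: ifP => _; rewrite ?mulr1 ?mulr0.
rewrite Rintegral_indic_scaled; last 2 first.
- exact: measurable_itv.
- by rewrite lebesgue_measure_itv /=; case: ifP => // _; rewrite -EFinB ltry.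
rewrite lebesgue_measure_itv /= lte_fin mulrC.
have [x0|x0] := leP x 0; first by rewrite phi0// !mulr0.
have [xd|xd|->] := ltgtP x d; rewrite /= ?lexx.
- by [].
- by [].
- by rewrite subrr.
Qed.

Lemma wedge_ge_integral d : d <= 1 -> \int[mu2]_z wedge_ge d z = kint d.
Proof.
move=> d1; have nw := box_bounded_wedge_ge d1.
(* After the flip the value of [phi] does not depend on the inner variable, whose integral is then
   the length of an interval. *)
rewrite -(box_bounded_flipE nw) (box_bounded_fubini (box_bounded_flip nw)).
rewrite kintE; congr (Rintegral _ _ _); apply/funext => x.
have -> : (fun y => (wedge_ge d \o flip) (x, y)) = (fun y => phi x * \1_(`[x, d]%classic : set T) y).
  apply/funext => y; rewrite /= /wedge_ge /flip indicE mem_setE /= in_itv /=.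
  by case: ifP => _; rewrite ?mulr1 ?mulr0.
rewrite Rintegral_indic_scaled; last 2 first.
- exact: measurable_itv.
- by rewrite lebesgue_measure_itv /=; case: ifP => // _; rewrite -EFinB ltry.
rewrite lebesgue_measure_itv /= lte_fin mulrC.
have [x0|x0] := leP x 0; first by rewrite phi0// !mulr0.
have [xd|xd|->] := ltgtP x d; rewrite /= ?lexx.
- by [].
- by [].
- by rewrite subrr.
Qed.

Definition corner (d : R) (z : TT) : R :=
  phi (Num.min z.1 z.2) - phi (Num.min (Num.min z.1 z.2) (z.1 + z.2 - d)).

(* The shear preserves the measure, so that cutting one corner removes the
   integral of a single wedge. *)
Lemma cornerE d z : 0 < d ->
  corner d z = wedge_ge d z + wedge_lt d z - wedge_ge d (shear d z).
Proof.
move=> d0; case: z => x y; rewrite /corner /wedge_ge /wedge_lt /shear /=.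
have [x0|x0] := leP x 0.
  rewrite (phi0 x0) (@phi0 (Num.min x y)) ?ge_min ?x0//.
  rewrite (@phi0 (Num.min _ _)) ?ge_min ?x0//.
  rewrite if_same; case: ifP => [/andP[yx _]|_].
    rewrite (phi0 (le_trans yx x0)).
    by case: ifP => [/andP[h _]|_]; rewrite ?(phi0 (le_trans h x0)); lra.
  by case: ifP => [/andP[h _]|_]; rewrite ?(phi0 (le_trans h x0)); lra.
have [y0|y0] := leP y 0.
  rewrite (phi0 y0) (@phi0 (Num.min x y)) ?ge_min ?y0 ?orbT//.
  rewrite (@phi0 (Num.min _ _)) ?ge_min ?y0 ?orbT//.
  rewrite ltNge (le_trans y0 (ltW x0)) /= if_same.
  case: ifP => [/andP[_ xd]|_]; last by lra.
  by rewrite (@phi0 (x + y - d)); lra.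
have [xd|dx] := leP x d; last first.
  rewrite !andbF.
  have [yx|xy] := leP y x.
    by rewrite (min_idPl (_ : y <= x + y - d)) /=; lra.
  have -> : (y <= d) = false by apply/negbTE; rewrite -ltNge; lra.
  by rewrite (min_idPl (_ : x <= x + y - d)) /=; lra.
have [yd|dy] := leP y d; last first.
  have -> : (y <= x) = false by apply/negbTE; rewrite -ltNge; lra.
  have -> : (x + y - d <= x) = false by apply/negbTE; rewrite -ltNge; lra.
  have xy : x <= y by lra.
  by rewrite (min_idPl xy) (min_idPl (_ : x <= x + y - d)) ?andbF /=; lra.
(* On the square (0, d]^2 the cut form x + y - d is at most x and y, and its [phi] is the wedge at
   the sheared point (x, x + y - d). *)
have -> : (x + y - d <= x) = true by lra.
rewrite (min_idPr (_ : x + y - d <= Num.min x y)) /=; last by rewrite le_min; apply/andP; split; lra.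
by rewrite !andbT; case: (leP y x) => _; lra.
Qed.

End CornerIntegrals.

Section CornerRecursion.
Context {R : realType}.
Local Notation mu := (@lebesgue_measure R).
Local Notation T := (measurableTypeR R).
Local Notation TT := (T * T)%type.
Local Notation mu2 := ((@lebesgue_measure R \x @lebesgue_measure R)%E).

Lemma box_boundedD (f g : TT -> R) : box_bounded f -> box_bounded g -> box_bounded (fun z => f z + g z).
Proof.
move=> [mf [M fM]] [mg [N gN]]; split; first exact: measurable_funD.
exists (M + N) => z; rewrite mulrDl; apply: le_trans (ler_normD _ _) _.
by apply: lerD.
Qed.

Lemma box_boundedN (f : TT -> R) : box_bounded f -> box_bounded (fun z => - f z).
Proof.
move=> [mf [M fM]]; split; first exact: measurable_funN.
by exists M => z; rewrite normrN.
Qed.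

Lemma box_boundedB (f g : TT -> R) : box_bounded f -> box_bounded g -> box_bounded (fun z => f z - g z).
Proof. by move=> nf ng; apply: box_boundedD => //; exact: box_boundedN. Qed.

Lemma int2D (f g : TT -> R) : box_bounded f -> box_bounded g ->
  \int[mu2]_z (f z + g z) = \int[mu2]_z f z + \int[mu2]_z g z.
Proof.
by move=> nf ng; apply: RintegralD; [exact: measurableT|exact: box_bounded_integrable|exact: box_bounded_integrable].
Qed.

Lemma int2B (f g : TT -> R) : box_bounded f -> box_bounded g ->
  \int[mu2]_z (f z - g z) = \int[mu2]_z f z - \int[mu2]_z g z.
Proof.
by move=> nf ng; apply: RintegralB; [exact: measurableT|exact: box_bounded_integrable|exact: box_bounded_integrable].
Qed.

Lemma reach_le1 (p q : R) : 1 <= p -> 1 <= q -> reach p q <= 1.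
Proof.
move=> p1 q1; have h : 1 <= p * q ^+ 2 by rewrite mulr_ege1// exprn_ege1.
by rewrite /reach invf_le1// (lt_le_trans ltr01 h).
Qed.

Lemma cut_le1 (p q : R) : 1 <= p -> 1 <= q -> cut p q <= 1.
Proof.
move=> p1 q1; have h : 1 <= p * q * (p + q).
  by rewrite mulr_ege1 ?mulr_ege1//; lra.
by rewrite /cut invf_le1// (lt_le_trans ltr01 h).
Qed.

Variable phi : R -> R.
Hypothesis cphi : continuous phi.
Hypothesis phi0 : forall t, t <= 0 -> phi t = 0.
Hypothesis phi1 : forall t, t <= 1 -> `|phi t| <= 1.

Local Notation G n p q := (fun z : TT => gap phi n p q z.1 z.2).

Lemma box_bounded_gap n (p q : R) : 1 <= p -> 1 <= q -> box_bounded (G n p q).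
Proof.
move=> p1 q1; have p0 : 0 < p by lra. have q0 : 0 < q by lra.
have r1 := reach_le1 p1 q1; have r2 := reach_le1 q1 p1.
apply: (@box_bounded_supp _ _ 2) => //.
  apply: measurable_funB; apply: (measurableT_comp (measurable_phi cphi)).
    by apply: measurable_minr; [exact: measurable_real_fst|exact: measurable_real_snd].
  exact: measurable_tree_min.
move=> z; have [|H] := boolP ((0 < z.1 < reach p q) && (0 < z.2 < reach q p)); last first.
  by rewrite (gap_eq0 phi0 n p0 q0 H) eqxx.
move=> /andP[/andP[a b] /andP[c d]] _; split; [apply/andP; split; lra..|].
have m1 : Num.min z.1 z.2 <= 1 by rewrite ge_min; apply/orP; left; lra.
have m2 := le_trans (tree_min_le n p q z.1 z.2) m1.
by have := phi1 m1; have := phi1 m2; rewrite /gap; have := ler_normB (phi (Num.min z.1 z.2)) (phi (tree_min n p q z.1 z.2)); lra.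
Qed.

Lemma box_bounded_gap_shear n (p q c : R) : 1 <= p -> 1 <= q -> 0 < c <= 1 ->
  box_bounded (G n p q \o shear c).
Proof.
move=> p1 q1 /andP[c0 c1]; have p0 : 0 < p by lra. have q0 : 0 < q by lra.
have r1 := reach_le1 p1 q1; have r2 := reach_le1 q1 p1.
apply: box_bounded_comp; [exact: box_bounded_gap|exact: measurable_shear|].
move=> z; apply: contraNT => H; apply/eqP; apply: (gap_eq0 phi0 n p0 q0).
apply: contra H => /andP[/andP[a b] /andP[]]; rewrite /shear /= in a b * => d e.
by apply/andP; split; rewrite ler_norml; apply/andP; split; lra.
Qed.

Lemma corner_integral (d : R) : 0 < d <= 1 ->
  box_bounded (corner phi d) /\ \int[mu2]_z corner phi d z = kint phi d.
Proof.
move=> /andP[d0 d1].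
have n1 := box_bounded_wedge_ge cphi phi0 phi1 d1.
have n2 := box_bounded_wedge_lt cphi phi0 phi1 d1.
have n3 : box_bounded (wedge_ge phi d \o shear d).
  apply: box_bounded_comp; [exact: n1|exact: measurable_shear|].
  move=> z /(wedge_ge_supp phi0)[]; rewrite /shear /= => a b c.
  by apply/andP; split; rewrite ler_norml; apply/andP; split; lra.
have -> : corner phi d = (fun z => wedge_ge phi d z + wedge_lt phi d z - wedge_ge phi d (shear d z)).
  by apply/funext => z; exact: cornerE.
split; first by apply: box_boundedB n3; exact: box_boundedD.
rewrite (int2B (box_boundedD n1 n2) n3) (int2D n1 n2) (box_bounded_shear n1 n3).
by rewrite wedge_ge_integral// wedge_lt_integral//; lra.
Qed.

(** The first term is the corner at the node. The left child is one shear away; the right child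
    becomes a left child by exchanging the two coordinates, so the same shear, between two flips,
    serves for it. *)
Lemma gap_integralS n (p q : R) : 1 <= p -> 1 <= q ->
  \int[mu2]_z G n.+1 p q z =
  kint phi (cut p q) + \int[mu2]_z G n p (p + q) z + \int[mu2]_z G n (p + q) q z.
Proof.
move=> p1 q1; have p0 : 0 < p by lra. have q0 : 0 < q by lra.
have pq1 : 1 <= p + q by lra.
have c01 : 0 < cut p q <= 1 by rewrite cut_gt0//= cut_le1.
have [nc Ec] := corner_integral c01.
have n1 := box_bounded_gap n p1 pq1; have n2 := box_bounded_gap n q1 pq1.
have s1 := box_bounded_gap_shear n p1 pq1 c01; have s2 := box_bounded_gap_shear n q1 pq1 c01.
have f2 := box_bounded_flip s2; have n2' := box_bounded_gap n pq1 q1.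
have -> : G n.+1 p q = (fun z => corner phi (cut p q) z + (G n p (p + q) \o shear (cut p q)) z
    + (G n q (p + q) \o shear (cut p q) \o flip) z).
  apply/funext => z; rewrite (gapS phi0)//; congr (_ + _ + _).
  by rewrite /= /shear /flip /= /gap (tree_min_sym n (p + q)) minC [z.2 + z.1]addrC.
rewrite (int2D (box_boundedD nc s1) f2) (int2D nc s1) Ec (box_bounded_shear n1 s1).
congr (_ + _ + _).
rewrite (box_bounded_flipE s2) (box_bounded_shear n2 s2) -(box_bounded_flipE n2').
congr (Rintegral _ _ _); apply/funext => z.
by rewrite /flip /= /gap (tree_min_sym n (p + q)) minC.
Qed.

End CornerRecursion.

(** * Enumeration of the coprime pairs by the Stern-Brocot tree *)

Section Forest.

Definition childl (k : nat * nat) : nat * nat := (k.1, (k.1 + k.2)%N).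
Definition childr (k : nat * nat) : nat * nat := ((k.1 + k.2)%N, k.2).
Definition children (l : seq (nat * nat)) : seq (nat * nat) := map childl l ++ map childr l.

Fixpoint forest (n : nat) (l : seq (nat * nat)) : seq (nat * nat) :=
  if n is n'.+1 then l ++ forest n' (children l) else [::].

Lemma children_cat l1 l2 : perm_eq (children (l1 ++ l2)) (children l1 ++ children l2).
Proof. by rewrite /children !map_cat perm_catACA. Qed.

Lemma forest_children n l : perm_eq (forest n (children l)) (children (forest n l)).
Proof.
elim: n l => [|n IH] l //=.
apply: (@perm_trans _ (children l ++ children (forest n (children l)))).
  by rewrite perm_cat2l.
by rewrite perm_sym; exact: children_cat.
Qed.

Definition tree n := forest n [:: (1, 1)%N].

(** [forest] grows by levels below its roots; seen from the other end, every node but the root is a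
    child of a node one depth smaller. Coprimality, uniqueness and membership are proved by
    induction in this form. *)
Lemma treeS n : perm_eq (tree n.+1) ((1, 1)%N :: children (tree n)).
Proof. by rewrite /tree /= perm_cons; exact: (forest_children n [:: (1, 1)%N]). Qed.

Lemma mem_children l k : k \in children l ->
  exists2 k', k' \in l & k = childl k' \/ k = childr k'.
Proof.
rewrite mem_cat => /orP[] /mapP[k' kl ->]; exists k' => //; [by left|by right].
Qed.

Lemma tree_coprime n k : k \in tree n -> coprime_pairs k.
Proof.
elim: n k => [//|n IH] k; rewrite (perm_mem (treeS n)) in_cons => /orP[/eqP -> //|].
move=> /mem_children[[i j] /IH[/= i1 j1 ij] []] ->; rewrite /childl /childr; split => //=.
- by rewrite addn_gt0 i1.
- by rewrite /coprime gcdnDl.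
- by rewrite addn_gt0 i1.
- by rewrite coprime_sym /coprime gcdnDr gcdnC.
Qed.

Lemma children_disjoint (k k' : nat * nat) :
  (0 < k.1)%N -> (0 < k'.2)%N -> childr k = childl k' -> False.
Proof.
case: k => i j; case: k' => i' j'; rewrite /childl /childr /= => i0 j0 [].
move: i j i' j' i0 j0 => i j i' j'; lia.
Qed.

Lemma childl_inj : injective childl.
Proof.
move=> [i j] [i' j'] [e1 e2]; congr (_, _) => //.
by apply/eqP; rewrite -(eqn_add2l i) e2 e1.
Qed.

Lemma childr_inj : injective childr.
Proof.
move=> [i j] [i' j'] [e1 e2]; congr (_, _) => //.
by apply/eqP; rewrite -(eqn_add2r j) e1 e2.
Qed.

Lemma tree_uniq n : uniq (tree n).
Proof.
elim: n => [//|n IH]; rewrite (perm_uniq (treeS n)) /=; apply/andP; split.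
  apply/negP => /mem_children[[i j] /tree_coprime[/= i1 j1 _] []];
    by rewrite /childl /childr /= => -[e1 e2]; move: i1 j1 e1 e2; clear; lia.
rewrite /children cat_uniq (map_inj_uniq childl_inj) (map_inj_uniq childr_inj) IH /= andbT.
apply/hasPn => k /mapP[k1 /tree_coprime[i1 _ _] ->].
by apply/negP => /mapP[k2 /tree_coprime[_ j2 _]]; exact: children_disjoint.
Qed.

(** The subtractive Euclidean algorithm climbs from (i, j) to the root, and the sum i + j drops at
    every step. The root has sum 2 and belongs to [tree 1], since [tree 0] is empty. *)
Lemma mem_tree n (i j : nat) : (0 < i)%N -> (0 < j)%N -> coprime i j -> (i + j <= n.+1)%N ->
  (i, j) \in tree n.
Proof.
elim: n i j => [|n IH] i j i0 j0 ij; first by lia.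
move=> le; rewrite (perm_mem (treeS n)) in_cons.
have [lt|gt|eq] := ltngtP i j.
- apply/orP; right; rewrite mem_cat; apply/orP; left.
  apply/mapP; exists (i, (j - i)%N); last by rewrite /childl /= subnKC// ltnW.
  apply: IH => //; [lia| |lia].
  by move: ij; rewrite -{1}(subnKC (ltnW lt)) /coprime gcdnDl.
- apply/orP; right; rewrite mem_cat; apply/orP; right.
  apply/mapP; exists ((i - j)%N, j); last by rewrite /childr /= subnK// ltnW.
  apply: IH => //; [lia| |lia].
  move: ij; rewrite -{1}(subnK (ltnW gt)) coprime_sym /coprime gcdnDr gcdnC.
  by rewrite -/(coprime _ _) coprime_sym.
- apply/orP; left; move: ij; rewrite -eq /coprime gcdnn => /eqP i1.
  by rewrite i1.
Qed.

End Forest.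

Section TreeIntegral.
Context {R : realType}.
Local Notation mu := (@lebesgue_measure R).
Local Notation T := (measurableTypeR R).
Local Notation TT := (T * T)%type.
Local Notation mu2 := ((@lebesgue_measure R \x @lebesgue_measure R)%E).
Variable phi : R -> R.
Hypothesis cphi : continuous phi.
Hypothesis phi0 : forall t, t <= 0 -> phi t = 0.
Hypothesis phi1 : forall t, t <= 1 -> `|phi t| <= 1.

Definition cutn (k : nat * nat) : R := cut k.1%:R k.2%:R.

(** A list of nodes in place of one lets the induction pass from a level to its children, with one
    use of [gap_integralS] per node. *)
Lemma gap_integral_forest n (l : seq (nat * nat)) :
  (forall k, k \in l -> (0 < k.1)%N /\ (0 < k.2)%N) ->
  \sum_(k <- l) \int[mu2]_z (gap phi n k.1%:R k.2%:R z.1 z.2) =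
  \sum_(k <- forest n l) kint phi (cutn k).
Proof.
elim: n l => [|n IH] l pl.
  rewrite /= big_nil big1// => k _; rewrite /Rintegral integral0_eq// => z _.
  by rewrite /gap /= subrr.
rewrite /= big_cat /= -IH; last first.
  move=> k /mem_children[[i j] /pl[/= i0 j0] []] ->; rewrite /childl /childr /=; split => //; lia.
rewrite big_cat !big_map /= -!big_split /=.
rewrite !big_seq; apply: eq_bigr => k /pl[k1 k2].
by rewrite (gap_integralS cphi phi0 phi1) ?ler1n// natrD -addrA.
Qed.

Definition sq_part n (z : TT) : R :=
  if (0 < z.1 <= 1) && (0 < z.2 <= 1) then phi (tree_min n 1 1 z.1 z.2) else 0.

(** Since reach 1 1 = 1, the gap of the root lives on the unit square, where the two wedges make up
    phi(min). *)
Lemma sq_partE n z :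
  sq_part n z = wedge_ge phi 1 z + wedge_lt phi 1 z - gap phi n 1 1 z.1 z.2.
Proof.
rewrite /sq_part; have r1 : reach 1 1 = 1 :> R by rewrite /reach expr1n mulr1 invr1.
case: ifPn => [/andP[/andP[a b] /andP[c d]]|H].
  have -> : wedge_ge phi 1 z + wedge_lt phi 1 z = phi (Num.min z.1 z.2).
    rewrite /wedge_ge /wedge_lt b d !andbT.
    by have [h|h] := leP z.2 z.1; rewrite ?addr0 ?add0r.
  by rewrite /gap opprB addrC subrK.
rewrite (gap_eq0 phi0)//; last first.
  rewrite r1; apply: contra H => /andP[/andP[a b] /andP[c d]].
  by rewrite a c !ltW.
have -> : wedge_ge phi 1 z = 0.
  apply/eqP; apply: contraNT H => /(wedge_ge_supp phi0)[a b c].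
  by rewrite a c (lt_le_trans a b) (le_trans b c).
have -> : wedge_lt phi 1 z = 0.
  apply/eqP; apply: contraNT H => /(wedge_lt_supp phi0)[a b c].
  by rewrite a c (lt_trans a b) (ltW (lt_le_trans b c)).
by rewrite !addr0 subrr.
Qed.

Lemma sq_part_integral n :
  box_bounded (sq_part n) /\
  \int[mu2]_z sq_part n z = 2 * kint phi 1 - \sum_(k <- tree n) kint phi (cutn k).
Proof.
have n1 := box_bounded_wedge_ge cphi phi0 phi1 (lexx 1).
have n2 := box_bounded_wedge_lt cphi phi0 phi1 (lexx 1).
have n3 : box_bounded (fun z : TT => gap phi n 1 1 z.1 z.2) by apply: (box_bounded_gap cphi phi0 phi1).
have -> : sq_part n = (fun z => wedge_ge phi 1 z + wedge_lt phi 1 z - gap phi n 1 1 z.1 z.2).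
  by apply/funext => z; exact: sq_partE.
split; first by apply: box_boundedB n3; exact: box_boundedD.
rewrite (int2B (box_boundedD n1 n2) n3) (int2D n1 n2).
rewrite wedge_ge_integral// wedge_lt_integral// -[2]/(2%:R) mulr_natl mulr2n.
congr (_ - _).
rewrite /tree -gap_integral_forest ?big_seq1//.
by move=> k; rewrite inE => /eqP ->.
Qed.

Lemma folded_integral n :
  box_bounded (sq_part n \o fold2) /\
  \int[mu2]_z sq_part n (fold2 z) =
    4 * (2 * kint phi 1 - \sum_(k <- tree n) kint phi (cutn k)).
Proof.
have [ns <-] := sq_part_integral n; apply: fold2_integral => // z.
by rewrite /sq_part; case: ifP => //; rewrite eqxx.
Qed.

End TreeIntegral.

(** * The lattice distance of L *)

Section LatticeDistance.
Context {R : realType}.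
Implicit Types (X Y : R) (a b c d i j : nat).

Definition ell a b X Y : R :=
  a%:R * X + b%:R * Y - a%:R * b%:R / (a%:R + b%:R).

Lemma ellD a b c d X Y : (a * d = b * c + 1)%N ->
  ell (a + c) (b + d) X Y =
  ell a b X Y + ell c d X Y - cut (a + b)%:R (c + d)%:R.
Proof.
move=> det; have a0 : (0 < a)%N by case: a det => //; rewrite addn1.
have d0 : (0 < d)%N by case: d det => //; rewrite muln0 addn1.
have Ra : (0 : R) < a%:R by rewrite ltr0n.
have Rd : (0 : R) < d%:R by rewrite ltr0n.
have Rb : (0 : R) <= b%:R by [].
have Rc : (0 : R) <= c%:R by [].
have D : a%:R * d%:R = b%:R * c%:R + 1 :> R by rewrite -!natrM det natrD.
rewrite /ell /cut !natrD.
have h1 : a%:R + b%:R != 0 :> R by rewrite gt_eqF//; lra.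
have h2 : c%:R + d%:R != 0 :> R by rewrite gt_eqF//; lra.
have h3 : a%:R + c%:R + (b%:R + d%:R) != 0 :> R by rewrite gt_eqF//; lra.
have h4 : a%:R + b%:R + (c%:R + d%:R) != 0 :> R by rewrite gt_eqF//; lra.
move: (a%:R : R) (b%:R : R) (c%:R : R) (d%:R : R) h1 h2 h3 h4 D => A B C E h1 h2 h3 h4 D.
apply/eqP; rewrite -subr_eq0.
set e := (X in X == 0).
(* Over a common denominator the numerator depends only on the determinant of the two vectors, which
   is 1. *)
have -> : e = (1 - (A * E - B * C) ^+ 2) / ((A + B) * (C + E) * (A + B + (C + E))).
  rewrite /e; field; repeat (apply/andP; split) => //; rewrite ?h1 ?h2 ?h3 ?h4 //.
by rewrite D addrAC subrr add0r expr1n subrr mul0r.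
Qed.

Lemma det_coprime a b c d : (a * d = b * c + 1)%N -> coprime a b.
Proof.
move=> det; rewrite /coprime -dvdn1.
have /(dvdn_addr 1) <- : (gcdn a b %| b * c)%N by rewrite dvdn_mulr ?dvdn_gcdr.
by rewrite -det dvdn_mulr ?dvdn_gcdl.
Qed.

Lemma tree_min_is_ell n a b c d X Y : (a * d = b * c + 1)%N ->
  exists i j, coprime i j /\
    tree_min n (a + b)%:R (c + d)%:R (ell a b X Y) (ell c d X Y) = ell i j X Y.
Proof.
elim: n a b c d => [|n IH] a b c d det.
  rewrite /= /Num.min; case: ifP => _.
    by exists a, b; split => //; exact: det_coprime det.
  exists c, d; split => //; rewrite coprime_sym.
  by apply: (@det_coprime d c b a); lia.
have E := ellD X Y det.
have [|i1 [j1 [cop1 E1]]] := IH a b (a + c)%N (b + d)%N; first by lia.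
have [|i2 [j2 [cop2 E2]]] := IH (a + c)%N (b + d)%N c d; first by lia.
have n1 : (a + c + (b + d))%:R = (a + b)%:R + (c + d)%:R :> R by rewrite -natrD; congr _%:R; lia.
rewrite n1 E in E1 E2; rewrite /= /Num.min.
case: ifP => _; [exists i1, j1|exists i2, j2]; by [].
Qed.

(** Euclid on the coordinates (i, j) in the basis u, v: if i <= j, then i u + j v = i (u + v) + (j -
    i) v lies below the right child, otherwise below the left one, and i + j decreases. *)
Lemma tree_min_le_ell n a b c d i j X Y : (a * d = b * c + 1)%N -> coprime i j ->
  (i + j <= n.+1)%N ->
  tree_min n (a + b)%:R (c + d)%:R (ell a b X Y) (ell c d X Y) <=
    ell (i * a + j * c) (i * b + j * d) X Y.
Proof.
elim: n a b c d i j => [|n IH] a b c d i j det cop le.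
  have [[-> ->]|[-> ->]] : (i = 1 /\ j = 0) \/ (i = 0 /\ j = 1).
    by case: i j cop le => [|[|i]] [|[|j]] //=; rewrite ?coprimen0; try lia; by [left|right].
  - by rewrite !mul1n !mul0n !addn0 /= ge_min lexx.
  - by rewrite !mul1n !mul0n !add0n /= ge_min lexx orbT.
have E := ellD X Y det.
have n1 : (a + c + (b + d))%:R = (a + b)%:R + (c + d)%:R :> R by rewrite -natrD; congr _%:R; lia.
case: (posnP i) => [i0|i0].
  rewrite i0 in cop *; move: cop; rewrite /coprime gcd0n => /eqP ->.
  rewrite !mul1n !mul0n !add0n.
  by apply: le_trans (tree_min_le _ _ _ _ _) _; rewrite ge_min lexx orbT.
case: (posnP j) => [j0|j0].
  rewrite j0 in cop *; move: cop; rewrite /coprime gcdn0 => /eqP ->.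
  rewrite !mul1n !mul0n !addn0.
  by apply: le_trans (tree_min_le _ _ _ _ _) _; rewrite ge_min lexx.
rewrite [tree_min _ _ _ _ _]/=; have [ij|ji] := leqP i j.
  have cop' : coprime i (j - i).
    by move: cop; rewrite -{1}(subnKC ij) /coprime gcdnDl.
  have := @IH (a + c)%N (b + d)%N c d i (j - i)%N _ cop' _.
  rewrite n1 E => H; rewrite ge_min; apply/orP; right; apply: le_trans (H _ _) _.
  - by lia.
  - by lia.
  by rewrite le_eqVlt; apply/orP; left; apply/eqP; congr ell; nia.
have cop' : coprime (i - j) j.
  move: cop; rewrite -{1}(subnK (ltnW ji)) coprime_sym /coprime gcdnDr.
  by rewrite gcdnC.
have := @IH a b (a + c)%N (b + d)%N (i - j)%N j _ cop' _.
rewrite n1 E => H; rewrite ge_min; apply/orP; left; apply: le_trans (H _ _) _.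
- by lia.
- by lia.
by rewrite le_eqVlt; apply/orP; left; apply/eqP; congr ell; nia.
Qed.

Lemma ell10 X Y : ell 1 0 X Y = X.
Proof. by rewrite /ell mul0r mulr0 !addr0 mul1r mul0r subr0. Qed.

Lemma ell01 X Y : ell 0 1 X Y = Y.
Proof. by rewrite /ell !mul0r mul1r add0r subr0. Qed.

Lemma tree_min_root_is_ell n X Y : exists i j, coprime i j /\ tree_min n 1 1 X Y = ell i j X Y.
Proof.
have [i [j [cop E]]] := @tree_min_is_ell n 1 0 0 1 X Y erefl.
by exists i, j; split => //; rewrite -E ell10 ell01.
Qed.

Lemma tree_min_root_le n i j X Y : coprime i j -> (i + j <= n.+1)%N -> tree_min n 1 1 X Y <= ell i j X Y.
Proof.
move=> cop le; have := @tree_min_le_ell n 1 0 0 1 i j X Y erefl cop le.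
by rewrite ell10 ell01 !muln1 !muln0 !add0n !addn0.
Qed.

(** With X = t^2 and Y = s^2, the form times A + B equals (A t - B s)^2 + A B ((t + s)^2 - 1). So t
    + s = 1 is the envelope of the lines where the forms vanish, touched where A t = B s. *)
Lemma ell_ge0 a b X Y : 0 <= X -> 0 <= Y -> 1 <= Num.sqrt X + Num.sqrt Y ->
  (0 < a + b)%N -> 0 <= ell a b X Y.
Proof.
move=> X0 Y0 XY ab; have ab0 : (0 : R) < a%:R + b%:R by rewrite -natrD ltr0n.
have A0 : (0 : R) <= a%:R by [].
have B0 : (0 : R) <= b%:R by [].
rewrite /ell subr_ge0 ler_pdivrMr//.
rewrite -{1}(sqr_sqrtr X0) -{1}(sqr_sqrtr Y0).
move: XY; have := sqrtr_ge0 X; have := sqrtr_ge0 Y.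
move: (Num.sqrt X) (Num.sqrt Y) (a%:R : R) (b%:R : R) A0 B0 {ab0 X0 Y0} => t s A B A0 B0 s0 t0 st.
have h : 1 <= (t + s) ^+ 2 by rewrite exprn_ege1.
have h2 : A * B <= A * B * (t + s) ^+ 2 by rewrite ler_peMr ?mulr_ge0.
have h3 := sqr_ge0 (A * t - B * s).
rewrite -subr_ge0.
have -> : (A * t ^+ 2 + B * s ^+ 2) * (A + B) - A * B =
  (A * t - B * s) ^+ 2 + (A * B * (t + s) ^+ 2 - A * B) by ring.
by rewrite addr_ge0// subr_ge0.
Qed.

(** On the envelope, the form of (p - b, b) equals (p t - b)^2 / p. With b the integer part of p t
    this is at most 1 / p, and for p prime the pair is coprime as soon as 0 < b < p. The cases t >=
    1 and b = 0 are left to the two coordinate forms. *)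
Lemma ell_small X Y (e : R) : 0 <= X -> 0 <= Y -> Num.sqrt X + Num.sqrt Y <= 1 -> 0 < e ->
  exists i j, coprime i j /\ ell i j X Y <= e.
Proof.
move=> X0 Y0 XY e0; set t := Num.sqrt X; set s := Num.sqrt Y.
have t0 : 0 <= t := sqrtr_ge0 X; have s0 : 0 <= s := sqrtr_ge0 Y.
have XE : X = t ^+ 2 by rewrite sqr_sqrtr.
have YE : Y = s ^+ 2 by rewrite sqr_sqrtr.
have [p pN pp] := prime_above (Num.bound e^-1).
have p0 : (0 : R) < p%:R by rewrite ltr0n prime_gt0.
have pe : p%:R^-1 <= e.
  rewrite -[leRHS]invrK lef_pV2 ?posrE ?invr_gt0//.
  apply: ltW; apply: lt_trans (archi_boundP (ltW _)) _; rewrite ?invr_gt0// ltr_nat//.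
have [t1|t1] := leP 1 t.
  exists 0%N, 1%N; split => //; rewrite ell01 YE.
  have -> : s = 0 by move: XY; rewrite -/t -/s; lra.
  by rewrite expr0n /= ltW.
pose b := Num.truncn (p%:R * t).
have pt0 : 0 <= p%:R * t by rewrite mulr_ge0// ltW.
have /andP[b1 b2] : b%:R <= p%:R * t < b.+1%:R by exact: Num.Theory.truncn_itv.
have [b0|b0] := posnP b.
  exists 1%N, 0%N; split => //; rewrite ell10 XE; apply: le_trans pe.
  have pt1 : p%:R * t < 1 by move: b2; rewrite b0.
  have tp : t <= p%:R^-1 by rewrite -[leRHS]mul1r ler_pdivlMr// mulrC ltW.
  by rewrite expr2; apply: le_trans tp; rewrite ler_piMr// ltW.
have bp : (b < p)%N.
  by rewrite -(ltr_nat R); apply: le_lt_trans b1 _; rewrite gtr_pMr.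
exists (p - b)%N, b; split.
  have : coprime b (p - b + b).
    by rewrite subnK ?(ltnW bp)// coprime_sym prime_coprime// gtnNdvd.
  by rewrite [coprime (p - b) b]coprime_sym /coprime gcdnDr.
have pb : (p - b)%:R + b%:R = p%:R :> R by rewrite -natrD subnK// ltnW.
apply: le_trans pe; rewrite /ell pb.
have YS : Y <= (1 - t) ^+ 2.
  by rewrite YE lerXn2r ?nnegrE//; move: XY; rewrite -/t -/s; lra.
have bR : (0 : R) <= b%:R by [].
have le1 : (p%:R * t - b%:R) ^+ 2 <= 1.
  by rewrite expr_le1//; move: b2; rewrite -natr1; lra.
apply: (@le_trans _ _ ((p%:R * t - b%:R) ^+ 2 / p%:R)); last first.
  by rewrite -[leRHS]mul1r ler_wpM2r ?invr_ge0// ltW.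
rewrite -(ler_pM2r p0) divfK ?gt_eqF// mulrBl divfK ?gt_eqF//.
have -> : (p - b)%:R = p%:R - b%:R :> R by rewrite -pb addrK.
have h := ler_wpM2l bR YS.
rewrite XE; move: h p0; move: (p%:R : R) (b%:R : R) => P B h p0.
have h2 := ler_wpM2r (ltW p0) h.
nra.
Qed.

End LatticeDistance.

(** * The support function of L, and its lattice distance as a limit of tree minima *)

Section SupportL.
Context {R : realType}.
Implicit Types (u : int * int) (x : R * R) (e : R).

Lemma intr_absz (k : int) : `|k%:~R| = (absz k)%:R :> R.
Proof. by rewrite -intr_norm -abszE. Qed.

Lemma fold_le1 (t : R) : fold t <= 1.
Proof. by rewrite /fold; have := normr_ge0 t; lra. Qed.

Lemma pairing_ge u x :
  (absz u.1)%:R * fold x.1 + (absz u.2)%:R * fold x.2 - ((absz u.1)%:R + (absz u.2)%:R) <=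
  pairing u x.
Proof.
rewrite /pairing /fold -!intr_absz.
have h (k y : R) : `|k| * (1 - `|y|) - `|k| <= k * y.
  by rewrite mulrBr mulr1 addrAC subrr add0r -normrM lerNl -normrN ler_norm.
have := h u.1%:~R x.1; have := h u.2%:~R x.2; lra.
Qed.

Lemma fold_ge0 (x : R * R) : L x -> 0 <= fold x.1 /\ 0 <= fold x.2.
Proof. by case=> h1 h2 _; rewrite /fold; split; lra. Qed.

Lemma pairing_L_ge u x : L x -> (0 < absz u.1 + absz u.2)%N ->
  - ((absz u.1)%:R + (absz u.2)%:R) +
    (absz u.1)%:R * (absz u.2)%:R / ((absz u.1)%:R + (absz u.2)%:R) <= pairing u x.
Proof.
move=> Lx u0; apply: le_trans (pairing_ge u x).
have [f1 f2] := fold_ge0 Lx; case: Lx => _ _ h.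
by have := @ell_ge0 R _ _ _ _ f1 f2 h u0; rewrite /ell; lra.
Qed.

(** The minimiser folds to the point (t^2, s^2) of the envelope at which the form is tangent, that
    is |k| t = |l| s with t + s = 1; its signs are opposite to those of [u]. *)
Lemma pairing_L_attained u : (0 < absz u.1 + absz u.2)%N -> exists2 y, L y &
  pairing u y = - ((absz u.1)%:R + (absz u.2)%:R) +
    (absz u.1)%:R * (absz u.2)%:R / ((absz u.1)%:R + (absz u.2)%:R) :> R.
Proof.
move=> u0.
have [A0 B0] : (0 : R) <= (absz u.1)%:R /\ (0 : R) <= (absz u.2)%:R by [].
have AB : (0 : R) < (absz u.1)%:R + (absz u.2)%:R by rewrite -natrD ltr0n.
move: A0 B0 AB; rewrite /pairing -!intr_absz.
move: (u.1%:~R : R) (u.2%:~R : R) => k l A0 B0 AB.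
pose t := `|l| / (`|k| + `|l|); pose s := `|k| / (`|k| + `|l|).
have t0 : 0 <= t by rewrite divr_ge0// ltW.
have s0 : 0 <= s by rewrite divr_ge0// ltW.
have ts : t + s = 1 by rewrite -mulrDl addrC divff// gt_eqF.
have nsg (r : R) : `|Num.sg r| <= 1 by rewrite normr_sg; case: (r != 0).
have sgb (r w : R) : 0 <= w -> w <= 1 -> `|- (Num.sg r * (1 - w ^+ 2))| <= 1 - w ^+ 2.
  move=> w0 w1; rewrite normrN normrM.
  have h : 0 <= 1 - w ^+ 2 by rewrite subr_ge0 expr_le1.
  by rewrite (ger0_norm h) ler_piMl.
have t1 : t <= 1 by lra.
have s1 : s <= 1 by lra.
have bt := sgb k t t0 t1; have bs := sgb l s s0 s1.
exists (- (Num.sg k * (1 - t ^+ 2)), - (Num.sg l * (1 - s ^+ 2))).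
  split => /=; [by have := sqr_ge0 t; lra|by have := sqr_ge0 s; lra|].
  have e1 : 1 = Num.sqrt (t ^+ 2) + Num.sqrt (s ^+ 2) by rewrite !sqrtr_sqr !ger0_norm.
  rewrite [leLHS]e1.
  by apply: lerD; apply: ler_wsqrtr; lra.
rewrite /= !mulrN !mulrA.
have -> : k * Num.sg k = `|k| by rewrite mulrC -normrEsg.
have -> : l * Num.sg l = `|l| by rewrite mulrC -normrEsg.
rewrite /t /s; field; by rewrite gt_eqF.
Qed.

Lemma support_min_L u : (0 < absz u.1 + absz u.2)%N ->
  support_min (@L R) u = - ((absz u.1)%:R + (absz u.2)%:R) +
    (absz u.1)%:R * (absz u.2)%:R / ((absz u.1)%:R + (absz u.2)%:R).
Proof.
move=> u0; have [y Ly Ey] := pairing_L_attained u0.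
have lb : lbound [set pairing u x | x in @L R] (pairing u y).
  by move=> _ [x Lx <-]; rewrite Ey; exact: pairing_L_ge.
rewrite /support_min -Ey; apply/eqP; rewrite eq_le; apply/andP; split.
  by apply: ge_inf; [exists (pairing u y)|exists y].
by apply: lb_le_inf lb; exists (pairing u y), y.
Qed.

Lemma primitive_absz u : primitive u = coprime (absz u.1) (absz u.2).
Proof. by rewrite /primitive coprimezE. Qed.

Lemma coprime_addn_gt0 i j : coprime i j -> (0 < i + j)%N.
Proof. by case: i j => [|i] [|j]. Qed.

Lemma pairing_support_ge u x : primitive u ->
  ell (absz u.1) (absz u.2) (fold x.1) (fold x.2) <= pairing u x - support_min L u.
Proof.
rewrite primitive_absz => /coprime_addn_gt0 u0.
by rewrite support_min_L// /ell; have := pairing_ge u x; lra.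
Qed.

(** Signs of [u] opposite to those of [x] turn [pairing_ge] into an equality. *)
Lemma pairing_support_eq i j x : coprime i j -> exists2 u, primitive u &
  pairing u x - support_min L u = ell i j (fold x.1) (fold x.2).
Proof.
move=> cop; pose sg (t : R) (k : nat) : int := if 0 <= t then - k%:Z else k%:Z.
have sgabs t k : absz (sg t k) = k by rewrite /sg; case: ifP; rewrite ?abszN.
have sgE t k : (sg t k)%:~R * t = - (k%:R * `|t|).
  rewrite /sg; case: ifPn => t0; first by rewrite ger0_norm// mulrNz mulNr.
  by rewrite ltr0_norm ?ltNge// mulrN opprK.
exists (sg x.1 i, sg x.2 j); first by rewrite primitive_absz !sgabs.
rewrite support_min_L /= !sgabs ?coprime_addn_gt0// /pairing /= !sgE /ell /fold.
by ring.
Qed.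

Let vals x := [set pairing u x - support_min (@L R) u | u in [set u | primitive u]].

Lemma vals_ge0 x : L x -> lbound (vals x) 0.
Proof.
move=> Lx _ [u pu <-]; apply: le_trans (pairing_support_ge x pu).
have [f1 f2] := fold_ge0 Lx; case: Lx => _ _ h; apply: ell_ge0 => //.
by apply: coprime_addn_gt0; rewrite -primitive_absz.
Qed.

Lemma vals_nonempty x : vals x !=set0.
Proof. by exists (pairing (1, 0) x - support_min (@L R) (1, 0)), (1, 0). Qed.

Lemma rho_L_ge0 x : 0 <= rho (@L R) x.
Proof.
rewrite /rho; case: ifPn => // /asboolP /interior_subset Lx.
by apply: lb_le_inf; [exact: vals_nonempty|exact: vals_ge0].
Qed.

Lemma rho_L_le_tree_min n x : (@L R)° x -> rho (@L R) x <= tree_min n 1 1 (fold x.1) (fold x.2).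
Proof.
move=> Lx; rewrite /rho; case: ifPn => [_|/asboolP//].
have [i [j [cop ->]]] := tree_min_root_is_ell n (fold x.1) (fold x.2).
have [u pu <-] := pairing_support_eq x cop.
apply: ge_inf; last by exists u.
by exists 0; apply: vals_ge0; exact: interior_subset Lx.
Qed.

(** From depth |u_1| + |u_2| on, the tree minimum is below the form of an almost minimising [u],
    hence below the value at [u]. *)
Lemma tree_min_le_rho_L x e : (@L R)° x -> 0 < e -> exists N, forall n, (N <= n)%N ->
  tree_min n 1 1 (fold x.1) (fold x.2) <= rho (@L R) x + e.
Proof.
move=> Lx e0; rewrite /rho; case: ifPn => [_|/asboolP//].
have [|_ [u pu <-] lt] := @inf_adherent R (vals x) e e0.
  split; first exact: vals_nonempty.
  by exists 0; apply: vals_ge0; exact: interior_subset Lx.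
exists (absz u.1 + absz u.2)%N => n le; apply/ltW/(le_lt_trans _ lt).
apply: le_trans (pairing_support_ge x pu).
by apply: tree_min_root_le; [rewrite -primitive_absz|exact: leqW].
Qed.

Lemma continuous_sqrt_fold : continuous (fun x : R * R =>
  Num.sqrt (1 - `|x.1|) + Num.sqrt (1 - `|x.2|)).
Proof.
move=> x.
have fs : {for x, continuous (fun y : R * R => 1 - `|y.1|)}.
  apply: cvgB; first exact: cvg_cst.
  by apply: cvg_norm; exact: cvg_fst.
have sn : {for x, continuous (fun y : R * R => 1 - `|y.2|)}.
  apply: cvgB; first exact: cvg_cst.
  by apply: cvg_norm; exact: cvg_snd.
by apply: cvgD; [exact: continuous_comp fs (@sqrt_continuous R _)|exact: continuous_comp sn (@sqrt_continuous R _)].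
Qed.

Lemma interior_L x : 0 < fold x.1 -> 0 < fold x.2 ->
  1 < Num.sqrt (fold x.1) + Num.sqrt (fold x.2) -> (@L R)° x.
Proof.
rewrite /fold => h1 h2 h3.
have n1 : \forall y \near x, `|y.1| < 1.
  apply: (@cvgr_lt _ _ (nbhs x) _ (fun y : R * R => `|y.1|) `|x.1|); last by lra.
  by apply: cvg_norm; exact: cvg_fst.
have n2 : \forall y \near x, `|y.2| < 1.
  apply: (@cvgr_lt _ _ (nbhs x) _ (fun y : R * R => `|y.2|) `|x.2|); last by lra.
  by apply: cvg_norm; exact: cvg_snd.
have n3 : \forall y \near x, 1 < Num.sqrt (1 - `|y.1|) + Num.sqrt (1 - `|y.2|).
  by have /cvgr_gt := @continuous_sqrt_fold x; apply.
rewrite /interior; apply: filterS3 n1 n2 n3 => y a b c.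
by split; exact: ltW.
Qed.

Lemma tree_min_small x e : ~ (@L R)° x -> 0 < fold x.1 -> 0 < fold x.2 -> 0 < e ->
  exists N, forall n, (N <= n)%N -> tree_min n 1 1 (fold x.1) (fold x.2) <= e.
Proof.
move=> nLx h1 h2 e0.
have [h|h] := leP (Num.sqrt (fold x.1) + Num.sqrt (fold x.2)) 1; last first.
  by case: nLx; exact: interior_L.
have [i [j [cop le]]] := ell_small (ltW h1) (ltW h2) h e0.
exists (i + j)%N => n hn; apply: le_trans le.
by apply: tree_min_root_le => //; exact: leqW.
Qed.

End SupportL.

(** * Passage to infinite depth *)

Section LimitOfTree.
Context {R : realType}.
Variable phi : R -> R.
Hypothesis cphi : continuous phi.
Hypothesis phi0 : forall t, t <= 0 -> phi t = 0.

(** Outside of L the tree minima may be negative; the alternative r = 0 covers that case, because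
    [phi] does not see the difference between m n and its maximum with 0. *)
Lemma phi_cvg (m : nat -> R) (r : R) : 0 <= r -> (forall n, r <= m n \/ r = 0) ->
  (forall e, 0 < e -> exists N, forall n, (N <= n)%N -> m n <= r + e) ->
  phi (m n) @[n --> \oo] --> phi r.
Proof.
move=> r0 lo hi.
have -> : (fun n => phi (m n)) = (fun n => phi (Num.max r (m n))).
  apply/funext => n; have [//|mr] := leP r (m n).
  have [/le_lt_trans/(_ mr)|E] := lo n; first by rewrite ltxx.
  by rewrite E !phi0// -E ltW.
apply: (@cvg_comp _ _ _ (fun n => Num.max r (m n)) phi _ (nbhs r)); last exact: cphi.
apply/cvgrPdist_le => e e0; have [N HN] := hi e e0.
exists N => // n /= Nn; have := HN n Nn.
by rewrite /Num.max; case: ifPn => h; rewrite ler_norml; move: h; rewrite -?leNgt; lra.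
Qed.

Definition psi (x : R * R) : R := if x \in L then phi (rho L x) else 0.

(** [rho] is 0 off the interior by definition, so the boundary of L is settled pointwise, without a
    null-set argument. *)
Lemma psi_off_interior x : ~ (@L R)° x -> psi x = 0.
Proof.
move=> h; rewrite /psi; case: ifP => // _.
by rewrite /rho; case: ifPn => [/asboolP//|_]; rewrite phi0.
Qed.

Lemma psi_interior x : (@L R)° x -> psi x = phi (rho L x).
Proof. by move=> h; rewrite /psi mem_set//; exact: interior_subset. Qed.

Lemma sq_part_cvg (x : R * R) : sq_part phi n (fold2 x) @[n --> \oo] --> psi x.
Proof.
rewrite /sq_part /fold2 /= !fold_le1 !andbT.
have [/andP[f1 f2]|f] := boolP ((0 < fold x.1) && (0 < fold x.2)).
  case: (pselect ((@L R)° x)) => [Lx|nLx].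
    rewrite psi_interior//; apply: phi_cvg.
    - exact: rho_L_ge0.
    - by move=> n; left; exact: rho_L_le_tree_min.
    - by move=> e e0; exact: tree_min_le_rho_L.
  rewrite psi_off_interior// -(phi0 (lexx 0)); apply: phi_cvg => //.
  - by move=> n; right.
  - by move=> e e0; setoid_rewrite add0r; exact: tree_min_small.
suff -> : psi x = 0 by exact: cvg_cst.
(* At an interior point [rho] is at most the depth-0 minimum, that is the smaller of the two folds,
   which is nonpositive here. *)
case: (pselect ((@L R)° x)) => [Lx|nLx]; last exact: psi_off_interior.
rewrite psi_interior// phi0//; apply: le_trans (rho_L_le_tree_min 0 Lx) _ => /=.
by move: f; rewrite negb_and -!leNgt ge_min.
Qed.

End LimitOfTree.

Section IntegralOverL.
Context {R : realType}.
Local Notation mu := (@lebesgue_measure R).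
Local Notation T := (measurableTypeR R).
Local Notation TT := (T * T)%type.
Local Notation mu2 := ((@lebesgue_measure R \x @lebesgue_measure R)%E).
Variable phi : R -> R.
Hypothesis cphi : continuous phi.
Hypothesis phi0 : forall t, t <= 0 -> phi t = 0.
Hypothesis phi1 : forall t, t <= 1 -> `|phi t| <= 1.

Lemma sq_part_bound n (z : TT) : `|sq_part phi n (fold2 z)| <= 1 * \1_(segm `*` segm) z.
Proof.
rewrite mul1r /sq_part /fold2 /=; case: ifPn => [/andP[/andP[a b] /andP[c d]]|_]; last first.
  by rewrite normr0.
rewrite indicE in_setX !mem_set /=; first 1 last.
- by move: c; rewrite /fold /segm /= in_itv /= -ler_norml; lra.
- by move: a; rewrite /fold /segm /= in_itv /= -ler_norml; lra.
by apply: phi1; apply: le_trans (tree_min_le _ _ _ _ _) _; rewrite ge_min b.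
Qed.

(** Dominated convergence, with the indicator of the box as majorant at all depths; measurability of
    the limit comes from that of the approximants. *)
Lemma psi_integral :
  \int[mu2]_z sq_part phi n (fold2 z) @[n --> \oo] --> \int[mu2]_z (psi phi z : R).
Proof.
have ni n : mu2.-integrable setT (EFin \o (sq_part phi n \o fold2)).
  by apply: box_bounded_integrable; have [] := folded_integral cphi phi0 phi1 n.
have mn n := measurable_int _ (ni n).
have cv (z : TT) : (EFin (sq_part phi n (fold2 z))) @[n --> \oo] --> ((psi phi z)%:E : \bar R).
  by apply: cvg_EFin; [exact: nearW|exact: (@sq_part_cvg R phi cphi phi0 z)].
have mpsi : measurable_fun setT (fun z : TT => (psi phi z)%:E).
  by apply: (emeasurable_fun_cvg (fun n z => (sq_part phi n (fold2 z))%:E)) => // z _; exact: cv.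
have ib : mu2.-integrable setT (fun z : TT => (1 * \1_(segm `*` segm) z : R)%:E).
  apply: (@integrable_dominated _ _ _ mu2 (segm `*` segm) 1).
  - by apply: measurableX; exact: measurable_segm.
  - exact: box_fin.
  - apply: measurable_funM; first exact: measurable_cst.
    apply: (@measurable_indicP _ _ R _).1.
    by apply: measurableX; exact: measurable_segm.
  - by move=> z; rewrite ger0_norm// mul1r.
have [ip _ cvi] := dominated_convergence measurableT mn mpsi (aeW _ (fun z _ => cv z)) ib
  (aeW _ (fun z n _ => sq_part_bound n z : (`|_%:E| <= _%:E)%E)).
apply: (fine_cvg _ ) ; rewrite fineK ?integrable_fin_num//.
Qed.

Lemma integral_over_L : \int[mu2]_(x in L) phi (rho L x) = \int[mu2]_z psi phi z.
Proof.
rewrite Rintegral_mkcond; apply: eq_Rintegral => x _.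
by rewrite /psi patchE.
Qed.

End IntegralOverL.

(** * The zeta function of L *)

Section RadialIntegral.
Context {R : realType}.
Implicit Types (c w s : R[i]) (t d : R).

(** [cpow] does not vanish at negative reals, where [ln] takes a default value; the cut-off gives a
    function continuous on the whole line when Re w > 0. *)
Definition pw w t : R[i] := if 0 < t then cpow t w else 0.

Lemma Re_cpow c w t : complex.Re (c * cpow t w) =
  t `^ complex.Re w * (complex.Re c * cos (complex.Im w * ln t) -
                       complex.Im c * sin (complex.Im w * ln t)).
Proof. by rewrite /cpow !ReM !ImM /=; ring. Qed.

Lemma is_derive_Re_cpow c w t : 0 < t ->
  is_derive t 1 (fun t => complex.Re (c * cpow t w)) (complex.Re (c * w * cpow t (w - 1))).
Proof.
move=> t0; have dl := is_derive1_ln t0.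
have dp := is_derive1_powR (complex.Re w) t0.
rewrite (_ : (fun t => _) = (fun t => t `^ complex.Re w * (complex.Re c * cos (complex.Im w * ln t) -
  complex.Im c * sin (complex.Im w * ln t)))); last by apply/funext => u; exact: Re_cpow.
apply: is_derive_eq; rewrite Re_cpow !ReM !ImM !ReD !ImD !ReN !ImN /= subr0.
have -> : t `^ complex.Re w = t `^ (complex.Re w - 1) * t.
  rewrite -{3}(powRr1 (ltW t0)) -powRD ?subrK//.
  by apply/implyP => _; rewrite gt_eqF.
by rewrite /GRing.scale /=; field; rewrite gt_eqF.
Qed.

Lemma normc_pw_le w t : 0 < complex.Re w -> normc (pw w t) <= `|t| `^ complex.Re w.
Proof.
move=> w0; rewrite /pw; case: ifPn => [t0|_]; last by rewrite normcR normr0 powR_ge0.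
by rewrite normc_cpow ger0_norm// ltW.
Qed.

Lemma is_derive_Re_pw c w t : 0 < t ->
  is_derive t 1 (fun t => complex.Re (c * pw w t)) (complex.Re (c * w * pw (w - 1) t)).
Proof.
move=> t0; rewrite {2}/pw t0; apply: near_eq_is_derive (is_derive_Re_cpow c w t0).
by near=> u; rewrite /pw ifT//; near: u; exact: lt_nbhsr.
Unshelve. all: by end_near. Qed.

Lemma continuous_Re_pw c w : 0 < complex.Re w -> continuous (fun t => complex.Re (c * pw w t)).
Proof.
move=> w0 t; have [t0|t0] := ltP 0 t.
  have [d _] := is_derive_Re_pw c w t0.
  by apply: differentiable_continuous; exact/derivable1_diffP.
have p0 : complex.Re (c * pw w t) = 0 by rewrite /pw ltNge t0 /= mulr0.
move: t0; rewrite le_eqVlt => /predU1P[t0|t0]; last first.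
  have E : \forall u \near t, 0 = complex.Re (c * pw w u).
    near=> u; rewrite /pw ifF ?mulr0//; apply/negbTE; rewrite -leNgt ltW//.
    by near: u; exact: lt_nbhsl.
  rewrite /continuous_at p0; apply: (cvg_trans (near_eq_cvg E)); exact: cvg_cst.
rewrite /continuous_at p0 t0.
apply/cvgrPdist_le => e e0 /=.
(* The radius k^(1 / Re w) is where |t|^(Re w) reaches [k]. *)
pose k := e / (normc c + 1).
have c1 : 0 < normc c + 1 by have := normc_ge0 c; lra.
have k0 : 0 < k by rewrite divr_gt0.
have d0 : 0 < k `^ (complex.Re w)^-1 by rewrite powR_gt0.
apply/nbhs_ballP; exists (k `^ (complex.Re w)^-1) => //= u; rewrite /ball /= !sub0r !normrN => ud.
apply: le_trans (Re_le_normc _) _; rewrite normcM.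
have h : normc (pw w u) <= k.
  apply: le_trans (normc_pw_le u w0) _.
  have := ge0_ler_powR (ltW w0) (_ : `|u| \in Num.nneg) (_ : k `^ (complex.Re w)^-1 \in Num.nneg) (ltW ud).
  rewrite !nnegrE normr_ge0 powR_ge0 => /(_ isT isT); rewrite -powRrM mulVf ?gt_eqF// powRr1//.
  exact: ltW.
apply: le_trans (ler_wpM2l (normc_ge0 c) h) _.
rewrite /k mulrCA ler_piMr ?(ltW e0)// ler_pdivrMr// mul1r; lra.
Unshelve. all: by end_near. Qed.

Lemma pw0 w t : t <= 0 -> pw w t = 0.
Proof. by rewrite /pw leNgt => /negbTE ->. Qed.

Lemma Re_pw_le1 c w t : 0 < complex.Re w -> normc c <= 1 -> t <= 1 ->
  `|complex.Re (c * pw w t)| <= 1.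
Proof.
move=> w0 c1 t1; have [t0|t0] := leP t 0; first by rewrite pw0// mulr0 normr0.
apply: le_trans (Re_le_normc _) _; rewrite normcM.
rewrite -[leRHS]mulr1; apply: ler_pM; rewrite ?normc_ge0//.
rewrite /pw t0 normc_cpow (_ : 1 = 1 `^ complex.Re w); last by rewrite powR1.
by apply: (ge0_ler_powR (ltW w0)); rewrite ?nnegrE// ltW.
Qed.

Lemma kint_pw c s d : 2 < complex.Re s -> 0 < d ->
  kint (fun t => complex.Re (c * pw (s - 2) t)) d =
  complex.Re (c * (cpow d s / (s * (s - 1)))).
Proof.
move=> s2 d0.
have r1 : 0 < complex.Re (s - 1) by rewrite ReD ReN /=; lra.
have r2 : 0 < complex.Re (s - 2) by rewrite ReD ReN /=; lra.
have r0 : 0 < complex.Re s by lra.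
have nz w : 0 < complex.Re w -> w != 0 by move=> h; apply: contraTneq h => ->; rewrite ltxx.
(* The antiderivative c d t^(s-1) / (s-1) - c t^s / s of c (d - t) t^(s-2). It vanishes at 0, and Re
   s > 2 makes the integrand continuous up to 0. *)
pose F t := complex.Re (c * d%:C / (s - 1) * pw (s - 1) t) - complex.Re (c / s * pw s t).
have cF : continuous F.
  by move=> t; apply: cvgB; exact: continuous_Re_pw.
have cf : continuous (fun t => (d - t) * complex.Re (c * pw (s - 2) t)).
  move=> t; apply: cvgM; last exact: continuous_Re_pw.
  by apply: cvgB; [exact: cvg_cst|exact: cvg_id].
have dF t : 0 < t -> is_derive t 1 F ((d - t) * complex.Re (c * pw (s - 2) t)).
  move=> t0.
  have h1 := is_derive_Re_pw (c * d%:C / (s - 1)) (s - 1) t0.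
  have h2 := is_derive_Re_pw (c / s) s t0.
  apply: (is_derive_eq (is_deriveB h1 h2)).
  rewrite !divfK ?nz//.
  have -> : s - 1 - 1 = s - 2 by ring.
  have -> : pw (s - 1) t = t%:C * pw (s - 2) t.
    rewrite /pw t0 (_ : s - 1 = 1%:R + (s - 2)); last by ring.
    by rewrite [cpow t (1 + _)]cpowD// (cpow_nat 1 t0) expr1.
  rewrite [c * d%:C]mulrC [c * (t%:C * _)]mulrCA -!mulrA.
  have Rc (r : R) z : complex.Re (r%:C * z) = r * complex.Re z by rewrite ReM /= mul0r subr0.
  by rewrite !Rc mulrBl.
rewrite /kint /Rintegral (@continuous_FTC2 _ _ F 0 d d0).
- rewrite /F !(pw0 _ (lexx 0)) !mulr0 /= subrr subr0.
  rewrite -ReN -ReD /pw d0.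
  have -> : cpow d s = d%:C * cpow d (s - 1).
    rewrite {1}(_ : s = 1 + (s - 1)); last by ring.
    by rewrite [LHS]cpowD// (cpow_nat 1 d0) expr1.
  have := nz _ r0; have := nz _ r1.
  move: (d%:C) (cpow d (s - 1)) => D P n1 n0.
  by congr complex.Re; field; rewrite n0 n1.
- exact: continuous_subspaceT.
- split.
  + by move=> t; rewrite in_itv /= => /andP[t0 _]; have [] := dF t t0.
  + by apply: cvg_at_right_filter; exact: cF.
  + by apply: cvg_at_left_filter; exact: cF.
- by move=> t; rewrite in_itv /= => /andP[t0 _]; rewrite derive1E; have [_ ->] := dF t t0.
Qed.

End RadialIntegral.

Section ZetaOfL.
Context {R : realType}.
Local Notation mu := (@lebesgue_measure R).
Local Notation mu2 := ((@lebesgue_measure R \x @lebesgue_measure R)%E).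

Lemma cpow_cutn (s : R[i]) k : coprime_pairs k -> cpow (cutn k : R) s = su3 s k.
Proof.
move=> [k1 k2 _]; have k0 : (0 : R) < (k.1 * k.2 * (k.1 + k.2))%:R.
  by rewrite ltr0n !muln_gt0 k1 k2 addn_gt0 k1.
have ck : cutn k = ((k.1 * k.2 * (k.1 + k.2))%:R : R)^-1.
  by rewrite /cutn /cut natrM natrM natrD.
by rewrite /su3 ck !cpowE ?invr_gt0// lnV ?posrE// rmorphN mulrN mulNr.
Qed.

Lemma rho_L_pw (s : R[i]) x : 2 < complex.Re s -> cpow (rho L x) (s - 2) = pw (s - 2) (rho (@L R) x).
Proof.
move=> s2; rewrite /pw; case: ifPn => //; rewrite -leNgt => r0.
have -> : rho (@L R) x = 0 by apply/eqP; rewrite eq_le r0 rho_L_ge0.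
by rewrite /cpow powR0 ?mul0r// ReD ReN /= gt_eqF//; lra.
Qed.

(** The constant [c] selects a component of a complex integral while the integrand stays real. The
    factor 4 counts the quadrants, and the 2 counts the two wedges of the unit square, each with
    integral 1 / (s (s - 1)) before [c] and the real part are applied. *)
Lemma integral_L_pw (s c : R[i]) : 2 < complex.Re s -> normc c <= 1 ->
  \int[mu2]_(x in L) complex.Re (c * pw (s - 2) (rho L x)) =
  complex.Re (c * (4 * (2 - csum coprime_pairs (su3 s)) / (s * (s - 1)))).
Proof.
move=> s2 c1; pose phi (t : R) := complex.Re (c * pw (s - 2) t).
have r2 : 0 < complex.Re (s - 2) by rewrite ReD ReN /=; lra.
have cphi : continuous phi by exact: continuous_Re_pw.
have phi0 t : t <= 0 -> phi t = 0 by move=> t0; rewrite /phi pw0// mulr0.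
have phi1 t : t <= 1 -> `|phi t| <= 1 by exact: Re_pw_le1.
rewrite (@integral_over_L R phi).
have := @psi_integral R phi cphi phi0 phi1.
set S := csum _ _; set V := complex.Re (c * _).
have [su _] := csum_su3 (ltW s2).
have E n : \int[mu2]_z sq_part phi n (fold2 z) =
    complex.Re (c * (4 * (2 - \sum_(k <- tree n) su3 s k) / (s * (s - 1)))).
  have [_ ->] := folded_integral cphi phi0 phi1 n.
  rewrite (kint_pw c s2 ltr01) cpow1.
  have -> : \sum_(k <- tree n) kint phi (cutn k) =
      complex.Re (c * ((\sum_(k <- tree n) su3 s k) / (s * (s - 1)))).
    rewrite mulr_suml mulr_sumr.
    have Re_sum (I : eqType) (r : seq I) (F : I -> R[i]) :
        complex.Re (\sum_(i <- r) F i) = \sum_(i <- r) complex.Re (F i).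
      by elim: r => [|a r IH]; rewrite ?big_nil// !big_cons ReD IH.
    rewrite Re_sum; apply: eq_big_seq => k /tree_coprime ck.
    rewrite (kint_pw c s2); last first.
      case: ck => k1 k2 _; apply: cut_gt0; by rewrite ltr0n.
    by rewrite (cpow_cutn s ck).
  have R2 (r : nat) (z : R[i]) : r%:R * complex.Re z = complex.Re (r%:R * z).
    by rewrite -(rmorph_nat (real_complex R) r) ReM /= mul0r subr0.
  rewrite -[2]/(2%:R) -[4]/(4%:R) R2 -ReN -ReD R2; congr complex.Re; ring.
move=> cv.
have Ecv : \int[mu2]_z sq_part phi n (fold2 z) @[n --> \oo] --> V.
  rewrite (eq_cvg _ _ E); apply/cvgrPdist_lt => e e0.
  pose A := 4 / (s * (s - 1)).
  have A1 : 0 < normc A + 1 by have := normc_ge0 A; lra.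
  have ex k : coprime_pairs k -> exists N, forall n, (N <= n)%N -> k \in tree n.
    case: k => i j [/= i1 j1 ij]; exists (i + j)%N => n le.
    by apply: mem_tree => //; exact: leqW.
  have [N HN] := csum_cvg su tree_uniq (fun n k => @tree_coprime n k) ex (divr_gt0 e0 A1).
  exists N => // n /= Nn; rewrite /V -ReN -ReD.
  apply: le_lt_trans (Re_le_normc _) _.
  set u := \sum_(k <- _) _.
  have -> : c * (4 * (2 - S) / (s * (s - 1))) - c * (4 * (2 - u) / (s * (s - 1))) =
    c * (A * (u - S)) by rewrite /A; move: (s * (s - 1))^-1 => W; ring.
  have := HN n Nn; rewrite ltr_pdivlMr// -/u -/S => lt.
  rewrite normcM normcM; apply: le_lt_trans lt.
  have h := normc_ge0 (u - S); have h2 := normc_ge0 A.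
  apply: (@le_trans _ _ (normc A * normc (u - S))).
    by rewrite ler_piMl// mulr_ge0.
  by rewrite mulrC ler_wpM2l//; lra.
exact: (cvg_unique (@Rhausdorff R) cv Ecv).
Qed.

Lemma Z_L (s : R[i]) : 2 < complex.Re s ->
  Z L s = 4 * (2 - csum coprime_pairs (su3 s)) / (s * (s - 1)).
Proof.
move=> s2; have n1 : normc (1 : R[i]) <= 1 by rewrite normcR normr1.
have ni : normc (0 +i* (- 1) : R[i]) <= 1.
  by rewrite /= expr0n /= add0r sqrrN expr1n sqrtr1.
have CE (a b : R) z : a = complex.Re z -> b = complex.Im z -> a +i* b = z.
  by case: z => u v /= -> ->.
apply: CE.
  rewrite -[X in _ = complex.Re X]mul1r -(integral_L_pw s2 n1).
  by apply: eq_Rintegral => x _; rewrite rho_L_pw// mul1r.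
(* Multiplication by -i turns the imaginary part into a real part. *)
have ImE (z : R[i]) : complex.Im z = complex.Re ((0 +i* (- 1)) * z).
  by rewrite ReM /= mul0r sub0r mulN1r opprK.
rewrite ImE -(integral_L_pw s2 ni).
by apply: eq_Rintegral => x _; rewrite rho_L_pw// ImE.
Qed.

Lemma Z_L_formula (s : R[i]) : 2 < complex.Re s ->
  Z L s = (8 - cpow 2 (2 - s) * (zetaSU3 s / zeta (3 * s))) * (s * (s - 1))^-1.
Proof.
by move=> s2; rewrite zetaSU3_ratio// Z_L//; congr (_ * _); ring.
Qed.

End ZetaOfL.

Theorem theorem5 (R : realType) :
  (forall s : R[i], 2 < complex.Re s ->
     Z L s =
       (8 - cpow 2 (2 - s) * (zetaSU3 s / zeta (3 * s))) * (s * (s - 1))^-1) /\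
  (forall U : set R[i],
     meromorphic_continuation [set s | 2 < complex.Re s] zetaSU3 U ->
     meromorphic_continuation [set s | 2 < complex.Re s] (Z L) U).
Proof.
split; first exact: Z_L_formula.
by move=> U; exact: continuation_of_formula Z_L_formula.
Qed.
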